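(* Let $\varepsilon>0$ and let $\gamma:\mathbf R\to\mathbf R^n$ be an analytic periodic function with minimal period $l>0$ parametrizing a closed analytic curve $Z\subset\mathbf R^n$, and write $z(s)=\gamma(s)$. Assume that $Z-Z=\{z_1-z_2:\ z_1,z_2\in Z\}$ spans $\mathbf R^n$ and that $$\int_0^l\gamma(s)\,ds=0.$$ Let $\varphi:\mathbf R\to\mathbf R^n$ be an $l$-periodic analytic function with $\varphi''=\gamma$, and let $$\Sigma_{kl}=\frac1l\int_0^l\varphi_k'(s)\varphi_l'(s)\,ds$$ (where the subscripts $k,l\in\{1,\dots,n\}$ denote components). Let $f=f(a,s,t)$, $a\in\mathbf R^n$, $l$-periodic in $s$, be the solution of $$f_t+z^k(s)\frac{\partial f}{\partial a^k}=\frac{\varepsilon^2}{2}\frac{\partial^2f}{\partial s^2}$$ with initial condition $f_0=f_0(a,s)$ a compactly supported (in $a$) probability density, $\int_{\mathbf R^n}\int_0^lf_0\,ds\,da=1$. Then the quantity $$a\mapsto t^{\frac n2}\int_0^lf(\sqrt t\,a,s,t)\,ds$$ converges as $t\to\infty$ (in distribution) to the density of the normal distribution with average $0$ and covariance matrix $\frac4{\varepsilon^2}\Sigma_{kl}$. In other words, the distribution of the positions of trajectories starting at time $0$ in some compact region will approach, after re-scaling, the same distribution as the diffusion with covariance matrix $\frac4{\varepsilon^2}\Sigma_{kl}$.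
   Context: Summation over repeated indices $k$ is used in the equation. The equation is the Fokker–Planck equation of the system $\dot a=\gamma(s)$, $\dot s=\varepsilon\dot w$ on $\mathbf R^n\times(\mathbf R/l\mathbf Z)$, with $w$ a standard one-dimensional Wiener process; it is the special case $G=\mathbf R^n$ of a model in which the velocity $z$ diffuses on a curve $Z$ in the Lie algebra $\mathbf R^n$. The curve $Z$ carries a measure $m$ with analytic density, and the parametrization $\gamma$ is chosen so that the $m$-measure of the segment between $\gamma(s_1)$ and $\gamma(s_2)$ is $s_2-s_1$ for $0\le s_1<s_2<l$. The condition $\int_0^l\gamma\,ds=0$ guarantees that a periodic $\varphi$ with $\varphi''=\gamma$ exists. ''Converges in distribution'' means that the probability measures with the given densities in $a$ converge weakly. *)

(* Defs.v *)
From HB Require Import structures.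
From mathcomp Require Import all_boot all_order all_algebra.
From mathcomp Require Import all_classical all_reals all_analysis.
Import Order.TTheory GRing.Theory Num.Theory.
Import numFieldNormedType.Exports.

Set Implicit Arguments.
Unset Strict Implicit.
Unset Printing Implicit Defensive.

Local Open Scope classical_set_scope.
Local Open Scope ring_scope.

Fact rV_display : measure_display. Proof. exact: default_measure_display. Qed.

Section rV_measurable.
Context {R : realType} (n : nat).

Definition rV_coord (i : 'I_n) (v : 'rV[R]_n) : R := v 0 i.

Let rV_set0 : g_sigma_preimage rV_coord set0.
Proof. exact: sigma_algebra0. Qed.

Let rV_setC A : g_sigma_preimage rV_coord A -> g_sigma_preimage rV_coord (~` A).
Proof. exact: sigma_algebraC. Qed.

Let rV_bigcup (F : _^nat) : (forall i, g_sigma_preimage rV_coord (F i)) ->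
  g_sigma_preimage rV_coord (\bigcup_i (F i)).
Proof. exact: sigma_algebra_bigcup. Qed.

(* The sigma-algebra generated by the coordinates: the Borel sets of R^n. *)
HB.instance Definition _ := @isMeasurable.Build rV_display 'rV[R]_n
  (g_sigma_preimage rV_coord) rV_set0 rV_setC rV_bigcup.

End rV_measurable.

Section rV_measurable_theory.
Context {R : realType}.

Lemma measurable_rV_coord n (i : 'I_n) :
  measurable_fun [set: 'rV[R]_n] (rV_coord i).
Proof.
move=> _ Y mY; rewrite setTI; apply: sub_sigma_algebra => /=.
rewrite -bigcup_seq/=; exists i => /=; first by rewrite mem_index_enum.
by exists Y => //; rewrite setTI.
Qed.

Lemma measurable_fun_rVP d (T : measurableType d) n (f : T -> 'rV[R]_n) :
  measurable_fun [set: T] f <->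
  forall i, measurable_fun [set: T] (fun x => f x 0 i).
Proof.
apply: (@iff_trans _ (g_sigma_preimage (fun i => rV_coord i \o f)
    `<=` measurable)).
  rewrite g_sigma_preimage_comp; split=> [mf A [/= C preC <-]|prefS].
    exact: mf.
  by move=> _ A mA; apply: prefS; exists A.
split=> [mfS i|mf].
  move=> _ A mA; apply: mfS; apply: sub_sigma_algebra.
  rewrite -bigcup_seq/=; exists i => /=; first by rewrite mem_index_enum.
  by exists A.
apply: smallest_sub; first exact: sigma_algebra_measurable.
rewrite -bigcup_seq/=; apply: bigcup_sub => i _.
by move=> A [B mB <-]; exact: mf.
Qed.

Definition rV_cons n (p : R * 'rV[R]_n) : 'rV[R]_n.+1 := row_mx p.1%:M p.2.

Definition rV_uncons n (v : 'rV[R]_n.+1) : R * 'rV[R]_n :=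
  (v 0 ord0, \row_i v 0 (lift ord0 i)).

Lemma rV_cons0 n (p : R * 'rV[R]_n) : rV_cons p 0 ord0 = p.1.
Proof.
have -> : ord0 = lshift n (ord0 : 'I_1) by apply/val_inj.
by rewrite (row_mxEl p.1%:M p.2) mxE eqxx.
Qed.

Lemma rV_consS n (p : R * 'rV[R]_n) i : rV_cons p 0 (lift ord0 i) = p.2 0 i.
Proof.
have -> : lift ord0 i = rshift 1 i by apply/val_inj.
by rewrite (row_mxEr p.1%:M p.2).
Qed.

Lemma rV_consK n : cancel (@rV_cons n) (@rV_uncons n).
Proof.
case=> x v; rewrite /rV_uncons rV_cons0; congr pair.
by apply/rowP => i; rewrite mxE rV_consS.
Qed.

Lemma measurable_rV_cons n : measurable_fun setT (@rV_cons n).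
Proof.
apply/measurable_fun_rVP => i.
have [->|i0] := eqVneq i ord0.
  by apply: (eq_measurable_fun fst) => [p _|//]; rewrite rV_cons0.
have [j ->] : exists j, i = lift ord0 j.
  by have [j ij|/esym/eqP] := unliftP ord0 i; [exists j|rewrite eq_sym (negPf i0)].
apply: (eq_measurable_fun (rV_coord j \o snd)) => [p _|].
  by rewrite rV_consS.
exact: measurableT_comp (measurable_rV_coord j) measurable_snd.
Qed.

Lemma measurable_rV_uncons n : measurable_fun setT (@rV_uncons n).
Proof.
apply/measurable_fun_pairP; split; first exact: measurable_rV_coord.
apply/measurable_fun_rVP => i.
apply: (eq_measurable_fun (rV_coord (lift ord0 i))) => [v _|].
  by rewrite /= mxE.
exact: measurable_rV_coord.
Qed.

End rV_measurable_theory.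

Section lebesgue_measure_rV.
Local Open Scope ereal_scope.
Context {R : realType}.

Section cons_measure.
Context n (m : {sigma_finite_measure set 'rV[R]_n -> \bar R}).

Definition cons_measure : set 'rV[R]_n.+1 -> \bar R :=
  pushforward (@lebesgue_measure R \x m) (@rV_cons R n).

Let cons_measure0 : cons_measure set0 = 0.
Proof. by rewrite /cons_measure /pushforward preimage_set0 measure0. Qed.

Let cons_measure_ge0 A : 0 <= cons_measure A.
Proof. exact: (measure_ge0 (@lebesgue_measure R \x m)). Qed.

Let cons_measure_sigma_additive : semi_sigma_additive cons_measure.
Proof.
move=> F mF tF mUF; rewrite /cons_measure /pushforward preimage_bigcup.
have mpre A : measurable A -> measurable (@rV_cons R n @^-1` A).
  by move=> mA; rewrite -[_ @^-1` _]setTI; exact: measurable_rV_cons.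
apply: (measure_semi_sigma_additive (s := @lebesgue_measure R \x m)).
- by move=> k; exact: mpre.
- apply/trivIsetP => i j _ _ ij; rewrite -preimage_setI.
  by move/trivIsetP : tF => /(_ i j Logic.I Logic.I ij) ->; rewrite preimage_set0.
- by rewrite -preimage_bigcup; exact: mpre.
Qed.

HB.instance Definition _ := isMeasure.Build _ _ _ cons_measure
  cons_measure0 cons_measure_ge0 cons_measure_sigma_additive.

Let cons_measure_sigma_finite : sigma_finite setT cons_measure.
Proof.
have /sigma_finiteP[I [IT Ind Ioo]] := sigma_finiteT (@lebesgue_measure R).
have /sigma_finiteP[G [GT Gnd Goo]] := sigma_finiteT m.
pose F k := I k `*` G k.
have FT : setT = \bigcup_k F k.
  apply/esym/seteqP; split => // -[x v] _.
  have [i _ Iix] : (\bigcup_i I i) x by rewrite -IT.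
  have [j _ Gjv] : (\bigcup_j G j) v by rewrite -GT.
  exists (maxn i j) => //; split => /=.
    by move: x Iix; exact/subsetPset/Ind/leq_maxl.
  by move: v Gjv; exact/subsetPset/Gnd/leq_maxr.
have mF k : measurable (F k) /\ (@lebesgue_measure R \x m) (F k) < +oo.
  have [mI Ik] := Ioo k; have [mG Gk] := Goo k.
  split; first exact: measurableX.
  by rewrite product_measure1E// lte_mul_pinfty// ge0_fin_numE.
exists (fun k => @rV_uncons R n @^-1` F k).
  by rewrite -preimage_bigcup -FT preimage_setT.
move=> k; have [mFk Fk] := mF k; split.
  by rewrite -[_ @^-1` _]setTI; exact: measurable_rV_uncons.
rewrite [ltLHS](_ : _ = (@lebesgue_measure R \x m) (F k))//.
rewrite /cons_measure /pushforward /=; congr (product_measure1 _ _ _).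
by apply/seteqP; split => p /=; rewrite rV_consK.
Qed.

HB.instance Definition _ := @Measure_isSigmaFinite.Build _ _ _ cons_measure
  cons_measure_sigma_finite.

End cons_measure.

Fixpoint lebesgue_rV n : {sigma_finite_measure set 'rV[R]_n -> \bar R} :=
  if n is n'.+1 then cons_measure (lebesgue_rV n')
  else @dirac rV_display 'rV[R]_0 0%R R.

End lebesgue_measure_rV.

Lemma lebesgue_rV_box (R : realType) n (a b : 'rV[R]_n) :
  (forall i, a 0 i <= b 0 i) ->
  lebesgue_rV n [set v : 'rV[R]_n | forall i, a 0 i < v 0 i <= b 0 i] =
  (\prod_i (b 0 i - a 0 i))%:E.
Proof.
elim: n a b => [|n IH] a b ab /=.
  by rewrite big_ord0 diracE mem_set//; case.
pose tl (c : 'rV[R]_n.+1) := (rV_uncons c).2.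
have tlE c i : tl c 0 i = c 0 (lift ord0 i) by rewrite mxE.
have mbox k (c d : 'rV[R]_k) :
    measurable [set v : 'rV[R]_k | forall i, c 0 i < v 0 i <= d 0 i].
  rewrite (_ : mkset _ = \bigcap_(i in [set: 'I_k])
      (setT `&` rV_coord i @^-1` `]c 0 i, d 0 i]%classic)); last first.
    apply/seteqP; split => v /= H i.
      by move=> _; split => //=; rewrite in_itv/= H.
    by have [//|_] := H i; rewrite /= in_itv.
  by apply: fin_bigcap_measurable => // i _; exact: measurable_rV_coord.
rewrite /cons_measure /pushforward /=.
transitivity ((@lebesgue_measure R \x lebesgue_rV n)%E
    (`]a 0 ord0, b 0 ord0]%classic `*`
     [set v : 'rV[R]_n | forall i, tl a 0 i < v 0 i <= tl b 0 i])).
  congr (product_measure1 _ _ _); apply/seteqP; split => -[x v]/=.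
    move=> H; split; first by have := H ord0; rewrite rV_cons0 in_itv.
    by move=> i; have := H (lift ord0 i); rewrite rV_consS !tlE.
  move=> [x_ab H] i; have [j ->|->] := unliftP ord0 i.
    by have := H j; rewrite !tlE rV_consS.
  by rewrite rV_cons0; move: x_ab; rewrite in_itv.
rewrite product_measure1E//; last exact: mbox.
rewrite IH; last by move=> i; rewrite !tlE.
rewrite big_ord_recl EFinM; congr (_ * _)%E.
  rewrite [LHS](lebesgue_measure_itv `]a 0 ord0, b 0 ord0]) /= lte_fin.
  have := ab ord0; rewrite le_eqVlt => /orP[/eqP ->|-> //].
  by rewrite ltxx subrr.
by congr EFin; apply: eq_bigr => i _; rewrite !tlE.
Qed.

Section analysis.
Context {R : realType}.

Definition real_analytic (f : R -> R) : Prop :=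
  forall x : R, exists (c : R^nat) (r : R), 0 < r /\
    forall h : R, `|h| < r -> pseries c h @ \oo --> f (x + h).

Definition rV_analytic n (g : R -> 'rV[R]_n) : Prop :=
  forall i, real_analytic (fun s => g s 0 i).

Definition minimal_period (T : Type) (g : R -> T) (l : R) : Prop :=
  [/\ 0 < l, forall s, g (s + l) = g s &
      forall l', 0 < l' -> (forall s, g (s + l') = g s) -> l <= l'].

Definition spans_rV n (A : set 'rV[R]_n) : Prop :=
  forall v : 'rV[R]_n, exists (k : nat) (c : 'I_k -> R) (w : 'I_k -> 'rV[R]_n),
    (forall i, A (w i)) /\ v = \sum_i c i *: w i.

(* Functions f(a, s, t) of a in R^n, s in R and a time t. *)
Definition d_a n (k : 'I_n) (f : 'rV[R]_n -> R -> R -> R) :=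
  fun a s t => 'D_(delta_mx 0 k) (fun a' => f a' s t) a.

Definition d_s n (f : 'rV[R]_n -> R -> R -> R) :=
  fun a s t => derive1 (fun s' => f a s' t) s.

Definition d_t n (f : 'rV[R]_n -> R -> R -> R) :=
  fun a s t => derive1 (f a s) t.

Definition continuous_at_positive_times n (f : 'rV[R]_n -> R -> R -> R) : Prop :=
  forall a s t, 0 < t ->
    {for (a, s, t), continuous (fun p : 'rV[R]_n * R * R => f p.1.1 p.1.2 p.2)}.

(* C^1 in (a, t) and C^2 in s on the open set t > 0. *)
Definition regular_at_positive_times n (f : 'rV[R]_n -> R -> R -> R) : Prop :=
  (forall a s t, 0 < t ->
     [/\ derivable (f a s) t 1,
         forall k : 'I_n, derivable (fun a' => f a' s t) a (delta_mx 0 k),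
         derivable (fun s' => f a s' t) s 1 &
         derivable (fun s' => d_s f a s' t) s 1]) /\
  [/\ continuous_at_positive_times f,
      continuous_at_positive_times (d_t f),
      forall k, continuous_at_positive_times (d_a k f),
      continuous_at_positive_times (d_s f) &
      continuous_at_positive_times (d_s (d_s f))].

(* The initial density is only assumed measurable, so it is attained in L^1
   rather than pointwise. Convergence on bounded sets of a suffices to determine
   f, because mass moves in a with speed at most sup |z|; this covers both
   convergence in L^1(R^n x [0, l]) and, for continuous f0, continuity of f up
   to t = 0. Values f(a, s, t) with t <= 0 are irrelevant. *)
Definition fokker_planck_solution n (eps l : R) (z : R -> 'rV[R]_n)
    (f0 : 'rV[R]_n -> R -> R) (f : 'rV[R]_n -> R -> R -> R) : Prop :=
  [/\ forall a s t, 0 < t -> f a (s + l) t = f a s t,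
      regular_at_positive_times f,
      forall a s t, 0 < t ->
        d_t f a s t + \sum_(k < n) z s 0 k * d_a k f a s t =
        eps ^+ 2 / 2 * d_s (d_s f) a s t &
      forall r : R,
        (\int[lebesgue_rV n]_(a in [set a | (`|a| <= r)%R])
           \int[lebesgue_measure]_(s in `[0%R, l]) (`|f a s t - f0 a s|)%:E)%E
          @[t --> 0^'+] --> 0%E].

Definition initial_density n (l : R) (f0 : 'rV[R]_n -> R -> R) : Prop :=
  [/\ forall a s, f0 a (s + l) = f0 a s,
      measurable_fun setT (fun p : 'rV[R]_n * R => f0 p.1 p.2),
      forall a s, 0 <= f0 a s,
      exists2 K : set 'rV[R]_n, compact K & forall a s, ~ K a -> f0 a s = 0 &
      (\int[lebesgue_rV n]_a \int[lebesgue_measure]_(s in `[0%R, l])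
         (f0 a s)%:E = 1)%E].

Definition probability_density n (p : 'rV[R]_n -> R) : Prop :=
  [/\ measurable_fun setT p, forall a, 0 <= p a &
      (\int[lebesgue_rV n]_a (p a)%:E = 1)%E].

(* Weak convergence, as t -> +oo, of the probability measures with densities
   p t (t > 0) to the probability measure with density q. *)
Definition densities_cvg_in_distribution n (p : R -> 'rV[R]_n -> R)
    (q : 'rV[R]_n -> R) : Prop :=
  [/\ forall t, 0 < t -> probability_density (p t),
      probability_density q &
      forall u : 'rV[R]_n -> R, continuous u ->
        (exists M, forall a, `|u a| <= M) ->
        (\int[lebesgue_rV n]_a (u a * p t a)%:E)%E @[t --> +oo] -->
        (\int[lebesgue_rV n]_a (u a * q a)%:E)%E].

(* Vectors are rows, so the quadratic form is v C^-1 v^T. *)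
Definition normal_density n (m : 'rV[R]_n) (C : 'M[R]_n) (a : 'rV[R]_n) : R :=
  (Num.sqrt ((2 * pi) ^+ n * \det C))^-1 *
  expR (- ((a - m) *m invmx C *m (a - m)^T) 0 0 / 2).

Definition Sigma_mx n (l : R) (phi : R -> 'rV[R]_n) : 'M[R]_n :=
  \matrix_(k, j) (l^-1 * \int[lebesgue_measure]_(s in `[0, l])
                           (derive1 phi s 0 k * derive1 phi s 0 j)).

Definition rescaled_position_density n (l : R) (f : 'rV[R]_n -> R -> R -> R)
    (t : R) (a : 'rV[R]_n) : R :=
  t `^ (n%:R / 2) *
  \int[lebesgue_measure]_(s in `[0, l]) f (Num.sqrt t *: a) s t.

End analysis.

(* Main.v *)
Require Import Defs.
From HB Require Import structures.
From mathcomp Require Import all_boot all_order all_algebra.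
From mathcomp Require Import all_classical all_reals all_analysis.
From mathcomp Require Import measurable_realfun.
From mathcomp Require Import ring lra.
Import Order.TTheory GRing.Theory Num.Theory.
Import numFieldNormedType.Exports.

(** The rescaled position at time [T] is studied through its characteristic
    function, that is, through the expectation under [f] at time [T] of
    [cos (th * dotv xi a + c)] with [th = T^(-1/2)]. Along the flow this slowly
    varying function changes at the rate [th * g], where [g s = dotv xi (gamma s)]
    has mean zero and is averaged out by the diffusion of [s]. Two correctors make
    this precise. The first, [psi] with [eps^2/2 psi'' = g], is a multiple of
    [dotv xi (phi s)] and removes the term of order [th]. In the term of order [th^2]
    there appears [psi g], whose mean is [- q/2] by an integration by parts, [q]
    being the value at [xi] of the quadratic form of [4/eps^2 Sigma]; a second
    corrector [chi] removes its oscillation ([corrector_exists]). After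
    multiplication by [exp (th^2 q t / 2)] the perturbed function is annihilated by
    the backward generator up to [O(th^3)] ([test_fun_generator]). Over a time
    [T = th^-2] its expectation therefore moves by [O(th)] only, and at time 1 it is
    [cos c + O(th)]. So the characteristic function tends to [exp (- q/2) cos c]
    ([expectation_estimate]), which belongs to the normal law
    ([normal_density_fourier]).

    This uses that [f] at a positive time is a compactly supported probability
    density, which has to be drawn from the equation and from the weak form of the
    initial condition. All of it comes from one identity ([energy_identity]) for the
    integral of [u * b (f)]. A weight [u] supported in a ball that shrinks at the
    maximal speed gives the domain of dependence, hence the support
    ([domain_of_dependence]); [u = 1] with [b = id] and [b = - id] gives the
    conservation of mass ([solution_mass]); smooth convex approximations [b] of the
    absolute value show that the L^1 norm does not exceed the mass, which forces
    positivity ([solution_ge0]).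

    Weak convergence follows from that of the characteristic functions by
    [levy_continuity], proved for densities: Gaussian mollifications are explicit in
    terms of characteristic functions, converge in L^1 by Scheffe's lemma, and
    approximate integrals of Lipschitz functions uniformly. The spanning hypothesis
    makes [Sigma] positive definite ([posdef_Sigma]), so that the normal law has a
    density, whose Fourier transform is computed by Gaussian elimination
    ([integral_cos_expR_qform]). *)

Set Implicit Arguments.
Unset Strict Implicit.
Unset Printing Implicit Defensive.

Local Open Scope classical_set_scope.
Local Open Scope ring_scope.

(** * Borel functions and Lebesgue measure on R^n *)

Section rV_norm.
Context {R : realType} {n : nat}.
Implicit Types v : 'rV[R]_n.

Lemma le_coord_norm v i : `|v 0 i| <= `|v|.
Proof.
rewrite [leRHS]/Num.Def.normr/= mx_normrE.
exact: (le_bigmax _ (fun ij : 'I_1 * 'I_n => `|v ij.1 ij.2|) (0, i)).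
Qed.

Lemma rV_norm_leP v r : 0 <= r -> `|v| <= r <-> forall i, `|v 0 i| <= r.
Proof.
move=> r0; split=> [vr i|vr]; first exact: le_trans (le_coord_norm _ _) vr.
rewrite [leLHS]/Num.Def.normr/= mx_normrE; apply: bigmax_le => //= -[i j] _ /=.
by rewrite ord1.
Qed.

Lemma rV_norm_ltP v r : 0 < r -> `|v| < r <-> forall i, `|v 0 i| < r.
Proof.
move=> r0; split=> [vr i|vr]; first exact: le_lt_trans (le_coord_norm _ _) vr.
rewrite [ltLHS]/Num.Def.normr/= mx_normrE; apply: bigmax_lt => //= -[i j] _ /=.
by rewrite ord1.
Qed.

End rV_norm.

Section continuous_measurable.
Context {R : realType}.

Lemma open_bigcup_ball (T : pseudoMetricType R) (I : Type) (g : I -> T) (U : set T) :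
  (forall x e, 0 < e -> exists i, ball x e (g i)) -> open U ->
  U = \bigcup_(p in [set p : I * nat | ball (g p.1) p.2.+1%:R^-1 `<=` U])
        ball (g p.1) p.2.+1%:R^-1.
Proof.
move=> gdense oU; apply/seteqP; split => [x Ux|x [p pU]]; last exact: pU.
have /nbhs_ballP[e /= e0 xeU] : nbhs x U by exact: open_nbhs_nbhs.
have [m me] : exists m : nat, m.+1%:R^-1 < e / 2.
  have [m] := ltr_add_invr (@divr_gt0 _ _ _ e0 (ltr0n R 2)).
  by rewrite add0r; exists m.
have [i xi] := gdense x m.+1%:R^-1 ltac:(by rewrite invr_gt0).
exists (i, m) => /=; last exact: ball_sym.
move=> y iy; apply: xeU; apply: (le_ball _ (ball_triangle xi iy)).
by rewrite [leRHS]splitr lerD// ltW.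
Qed.

Lemma rat_dense (x e : R) : 0 < e -> exists q : rat, ball x e (ratr q : R).
Proof.
move=> e0; have [q] := @rat_in_itvoo R (x - e) (x + e) ltac:(lra).
by rewrite in_itv/= => /andP[? ?]; exists q; rewrite /ball/= ltr_distlC; apply/andP; split; lra.
Qed.

Lemma ball_rV_prodE n (c : 'rV[R]_n * R) e : 0 < e ->
  ball c e = [set v : 'rV[R]_n | forall i, c.1 0 i - e < v 0 i < c.1 0 i + e] `*`
             `]c.2 - e, c.2 + e[%classic.
Proof.
move=> e0; apply/seteqP; split => -[v x] /=.
  move=> [cv cx]; split.
    move=> i; have := cv; rewrite -ball_normE/= => /(rV_norm_ltP _ e0)/(_ i).
    by rewrite !mxE ltr_distlC.
  by rewrite /= in_itv/=; move: cx; rewrite /ball/= ltr_distlC.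
move=> [cv cx]; split => /=.
  rewrite -ball_normE/=; apply/rV_norm_ltP => // i.
  by rewrite !mxE ltr_distlC.
by rewrite /ball/= ltr_distlC; move: cx; rewrite in_itv.
Qed.

(** Borel sets here are generated by the coordinates. Balls of the sup norm are
    boxes, hence measurable, and those with rational centres and radii [1/(p+1)]
    form a countable base. *)
Lemma measurable_rV_prod_open n (U : set ('rV[R]_n * R)) : open U -> measurable U.
Proof.
pose g (q : 'rV[rat]_n * rat) : 'rV[R]_n * R := (map_mx ratr q.1, ratr q.2).
move=> oU; rewrite (@open_bigcup_ball _ _ g U)//; last first.
  move=> [v x] e e0.
  have [qx xqx] := rat_dense x e0.
  have /choice[q vq] : forall i, exists q : rat, ball (v 0 i) e (ratr q : R).
    by move=> i; exact: rat_dense.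
  exists (\row_i q i, qx); split => //=.
  rewrite -ball_normE/=; apply/rV_norm_ltP => // i; rewrite !mxE.
  by have := vq i; rewrite -ball_normE.
rewrite bigcup_mkcond; apply: countable_bigcupT_measurable.
  exact: countableP.
move=> -[q m]; case: ifPn => // _.
rewrite ball_rV_prodE//=; apply: measurableX => //.
rewrite (_ : mkset _ = \bigcap_(i in [set: 'I_n]) (setT `&`
   rV_coord i @^-1` `]((g q).1 0 i - m.+1%:R^-1), ((g q).1 0 i + m.+1%:R^-1)[%classic)).
  by apply: fin_bigcap_measurable => // i _; exact: measurable_rV_coord.
apply/seteqP; split => v /= H i; first by move=> _; split => //=; rewrite in_itv/= H.
by have [//|_] := H i; rewrite /= in_itv.
Qed.

Lemma continuous_measurable_rV_prod n (f : 'rV[R]_n * R -> R) :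
  continuous f -> measurable_fun setT f.
Proof.
move=> /continuousP cf.
apply: (measurability _ (RGenOpens.measurableE R)).
move=> _ [_ [a [b ->] <-]]; rewrite setTI; apply: measurable_rV_prod_open.
exact/cf/interval_open.
Qed.

Lemma continuous_measurable_rV n (f : 'rV[R]_n -> R) :
  continuous f -> measurable_fun setT f.
Proof.
move=> cf.
have mf : measurable_fun setT (fun p : 'rV[R]_n * R => f p.1).
  apply: continuous_measurable_rV_prod => -[v x].
  by apply: (cvg_comp fst f); [exact: cvg_fst|exact: cf].
exact: (measurableT_comp mf (@pair2_measurable _ _ 'rV[R]_n R 0)).
Qed.

End continuous_measurable.

Section lebesgue_rV_change.
Local Open Scope ereal_scope.
Context {R : realType}.
Notation leb := (@lebesgue_measure R).

Let aff (c w : R) (x : measurableTypeR R) : measurableTypeR R := (c * x + w)%R.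

Let maff c w : measurable_fun [set: measurableTypeR R] (aff c w).
Proof. by apply: measurable_funD => //; apply: measurable_funM. Qed.

(** Lebesgue measure is determined by its values on half-open intervals. *)
Lemma lebesgue_affine (c w : R) (A : set R) : (0 < c)%R -> measurable A ->
  pushforward leb (aff c w) A = (c^-1)%:E * leb A.
Proof.
move=> c0 mA.
pose nu : {measure set (measurableTypeR R) -> \bar R} :=
  measure_function_pushforward__canonical__measure_function_Measure leb (maff c w).
have c0' : (0 <= c)%R by exact: ltW.
have : mscale (NngNum c0') nu A = leb A.
  apply/esym/lebesgue_measure_unique => //= _ [[a b]] _ <-.
  rewrite /mscale/= /nu/= /pushforward.
  rewrite (_ : _ @^-1` _ = `]((a - w) / c)%R, ((b - w) / c)%R]%classic); last first.
    apply/seteqP; split => x /=; rewrite !in_itv/= ltr_pdivrMr// ler_pdivlMr// /aff;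
    by rewrite ltrBlDr lerBrDr mulrC.
  rewrite !lebesgue_measure_itv/= !lte_fin ltr_pM2r ?invr_gt0// ltrD2r.
  case: ifPn => _; rewrite ?mule0// -!EFinB -EFinM; congr EFin; field.
  by rewrite gt_eqF.
rewrite /mscale/= => <-.
by rewrite muleA -EFinM mulVf ?gt_eqF// mul1e.
Qed.

Lemma ge0_integral_affine (c w : R) (g : R -> \bar R) : (0 < c)%R ->
  measurable_fun [set: R] g -> (forall x, 0 <= g x) ->
  \int[leb]_x g (c * x + w)%R = (c^-1)%:E * \int[leb]_x g x.
Proof.
move=> c0 mg g0.
transitivity (\int[pushforward leb (aff c w)]_x g x).
  by rewrite (@ge0_integral_pushforward _ _ _ _ R _ (maff c w) leb setT g).
have c0' : (0 <= c^-1)%R by rewrite invr_ge0 ltW.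
transitivity (\int[mscale (NngNum c0') leb]_x g x).
  by apply: eq_measure_integral => //= A mA _; rewrite lebesgue_affine.
by rewrite ge0_integral_mscale.
Qed.

Lemma measurable_comp_rV_cons n (g : 'rV[R]_n.+1 -> \bar R) :
  measurable_fun setT g ->
  measurable_fun [set: measurableTypeR R * 'rV[R]_n] (g \o @rV_cons R n).
Proof. by move=> mg; exact: (measurableT_comp mg (@measurable_rV_cons R n)). Qed.

Lemma ge0_integral_rVS n (g : 'rV[R]_n.+1 -> \bar R) :
  measurable_fun setT g -> (forall v, 0 <= g v) ->
  \int[lebesgue_rV n.+1]_v g v =
  \int[leb]_x \int[lebesgue_rV n]_v g (rV_cons (x, v)).
Proof.
move=> mg g0; transitivity (\int[leb \x lebesgue_rV n]_p (g \o @rV_cons R n) p).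
  have mc : measurable_fun [set: measurableTypeR R * 'rV[R]_n] (@rV_cons R n).
    exact: measurable_rV_cons.
  by rewrite -(@ge0_integral_pushforward _ _ _ _ R _ mc
   (leb \x lebesgue_rV n) setT g).
exact: (@fubini_tonelli1 _ _ _ _ R leb (lebesgue_rV n) (g \o @rV_cons R n)
  (measurable_comp_rV_cons mg) (fun=> g0 _)).
Qed.

Lemma rV_cons_affine n (c x : R) (v w : 'rV[R]_n) y :
  (c *: rV_cons (x, v) + rV_cons (y, w) = rV_cons (c * x + y, c *: v + w))%R.
Proof.
apply/rowP => i; have [j ->|->] := unliftP ord0 i.
  by rewrite [LHS]mxE [X in (X + _)%R]mxE !rV_consS [RHS]mxE [in RHS]mxE.
by rewrite [LHS]mxE [X in (X + _)%R]mxE !rV_cons0.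
Qed.

Lemma rV_unconsK n : cancel (@rV_uncons R n) (@rV_cons R n).
Proof.
move=> v; apply/rowP => i; have [j ->|->] := unliftP ord0 i.
  by rewrite rV_consS mxE.
by rewrite rV_cons0.
Qed.

End lebesgue_rV_change.

Section lebesgue_rV_change.
Local Open Scope ereal_scope.
Context {R : realType}.
Notation leb := (@lebesgue_measure R).

Lemma measurable_rV_affine n (c : R) (w : 'rV[R]_n) :
  measurable_fun setT (fun v : 'rV[R]_n => c *: v + w)%R.
Proof.
apply/measurable_fun_rVP => i.
under eq_fun do rewrite !mxE; apply: measurable_funD => //.
by apply: measurable_funM => //; exact: (measurable_rV_coord i).
Qed.

(** Induction on the dimension, one coordinate being changed at a time. *)
Lemma ge0_integral_rV_affine n (c : R) (w : 'rV[R]_n) (g : 'rV[R]_n -> \bar R) :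
  (0 < c)%R -> measurable_fun setT g -> (forall v, 0 <= g v) ->
  \int[lebesgue_rV n]_v g (c *: v + w)%R = (c ^- n)%:E * \int[lebesgue_rV n]_v g v.
Proof.
move=> c0; elim: n w g => [|n IH] w g mg g0.
  rewrite expr0 invr1 mul1e; apply: eq_integral => v _; congr g.
  by apply/rowP => -[].
have mgc y : measurable_fun setT (fun v => g (rV_cons (y, v))).
  exact: (measurableT_comp (measurable_comp_rV_cons mg) (pair1_measurable y)).
rewrite -(rV_unconsK w); case: (rV_uncons w) => y {}w.
rewrite [RHS](congr1 _ (ge0_integral_rVS mg g0)).
have mga : measurable_fun setT (fun v : 'rV[R]_n.+1 => g (c *: v + rV_cons (y, w))%R).
  exact: (measurableT_comp mg (measurable_rV_affine c (rV_cons (y, w)))).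
rewrite (ge0_integral_rVS mga (fun=> g0 _)).
pose G x := \int[lebesgue_rV n]_v g (rV_cons (x, v)).
have mG : measurable_fun setT G.
  apply: (measurable_fun_fubini_tonelli_F (g \o @rV_cons R n)) => //=.
  exact: (measurable_comp_rV_cons mg).
have G0 x : 0 <= G x by apply: integral_ge0.
transitivity (\int[leb]_x ((c ^- n)%:E * G (c * x + y)%R)).
  apply: eq_integral => x _.
 rewrite /G -(IH w _ (mgc _) (fun=> g0 _)).
 apply: eq_integral => v _.
by rewrite rV_cons_affine.
rewrite ge0_integralZl; first last.
- by rewrite lee_fin invr_ge0 exprn_ge0// ltW.
- by move=> x _; exact: G0.
- apply: (measurableT_comp mG).
  by apply: measurable_funD => //; apply: measurable_funM.
- exact: measurableT.
by rewrite (ge0_integral_affine y c0 mG G0) muleA -EFinM exprSr invfM.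
Qed.

Lemma integral_rV_translate n (w : 'rV[R]_n) (g : 'rV[R]_n -> \bar R) :
  measurable_fun setT g ->
  \int[lebesgue_rV n]_v g (v + w)%R = \int[lebesgue_rV n]_v g v.
Proof.
move=> mg.
have ge0_tr h : measurable_fun setT h -> (forall v, 0 <= h v) ->
    \int[lebesgue_rV n]_v h (v + w)%R = \int[lebesgue_rV n]_v h v.
  move=> mh h0; have := ge0_integral_rV_affine w ltr01 mh h0.
  rewrite expr1n invr1 mul1e => <-.
  by apply: eq_integral => v _; rewrite scale1r.
rewrite integralE [RHS]integralE; congr (_ - _).
- rewrite -(ge0_tr _ (measurable_funepos mg) (funepos_ge0 g)).
  by apply: eq_integral => v _; rewrite !funeposE.
- rewrite -(ge0_tr _ (measurable_funeneg mg) (funeneg_ge0 g)).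
  by apply: eq_integral => v _; rewrite !funenegE.
Qed.

Lemma integral_rV_scale n (c : R) (g : 'rV[R]_n -> \bar R) :
  (0 < c)%R -> (lebesgue_rV n).-integrable setT g ->
  \int[lebesgue_rV n]_v g (c *: v)%R = (c ^- n)%:E * \int[lebesgue_rV n]_v g v.
Proof.
move=> c0 ig; have mg := measurable_int _ ig.
have ge0_sc h : measurable_fun setT h -> (forall v, 0 <= h v) ->
    \int[lebesgue_rV n]_v h (c *: v)%R = (c ^- n)%:E * \int[lebesgue_rV n]_v h v.
  move=> mh h0; rewrite -(ge0_integral_rV_affine 0%R c0 mh h0).
  by apply: eq_integral => v _; rewrite addr0.
rewrite integralE [in RHS]integralE muleBr//; last first.
  rewrite fin_num_adde_defl// fin_numN ge0_fin_numE.
    exact: integral_funeneg_lt_pinfty ig.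
  exact: integral_ge0.
congr (_ - _).
- rewrite -(ge0_sc _ (measurable_funepos mg) (funepos_ge0 g)).
  by apply: eq_integral => v _; rewrite !funeposE.
- rewrite -(ge0_sc _ (measurable_funeneg mg) (funeneg_ge0 g)).
  by apply: eq_integral => v _; rewrite !funenegE.
Qed.

End lebesgue_rV_change.

(** * Integration over the phase space *)

Section set_product_integral.
Local Open Scope ereal_scope.
Context d1 d2 (T1 : measurableType d1) (T2 : measurableType d2) (R : realType).
Variable m1 : {sigma_finite_measure set T1 -> \bar R}.
Variable m2 : {sigma_finite_measure set T2 -> \bar R}.
Variables (A : set T1) (B : set T2).
Hypotheses (mA : measurable A) (mB : measurable B).
Variable F : T1 * T2 -> \bar R.

Let patch1 x : \int[m2]_y (F \_ (A `*` B)) (x, y) =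
  ((fun x => \int[m2]_(y in B) F (x, y)) \_ A) x.
Proof.
rewrite patchE; case: ifPn => xA.
  rewrite [RHS]integral_mkcond; apply: eq_integral => y _.
  by rewrite !patchE in_setX xA.
by apply: integral0_eq => y _; rewrite patchE in_setX (negPf xA).
Qed.

Let patch2 y : \int[m1]_x (F \_ (A `*` B)) (x, y) =
  ((fun y => \int[m1]_(x in A) F (x, y)) \_ B) y.
Proof.
rewrite patchE; case: ifPn => yB.
  rewrite [RHS]integral_mkcond; apply: eq_integral => x _.
  by rewrite !patchE in_setX yB andbT.
by apply: integral0_eq => x _; rewrite patchE in_setX (negPf yB) andbF.
Qed.

Lemma integral_setX12 : (m1 \x m2).-integrable (A `*` B) F ->
  \int[m1 \x m2]_(p in A `*` B) F p = \int[m1]_(x in A) \int[m2]_(y in B) F (x, y).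
Proof.
move=> iF; rewrite integral_mkcond -integral12_prod_meas1; last first.
  exact: (integrable_mkcond _ (measurableX mA mB)).1 iF.
by rewrite [RHS]integral_mkcond; apply: eq_integral => x _; rewrite -patch1.
Qed.

Lemma integral_setX21 : (m1 \x m2).-integrable (A `*` B) F ->
  \int[m1 \x m2]_(p in A `*` B) F p = \int[m2]_(y in B) \int[m1]_(x in A) F (x, y).
Proof.
move=> iF; rewrite integral_mkcond -integral21_prod_meas1; last first.
  exact: (integrable_mkcond _ (measurableX mA mB)).1 iF.
by rewrite [RHS]integral_mkcond; apply: eq_integral => x _; rewrite -patch2.
Qed.

Lemma ge0_integral_setX12 : measurable_fun (A `*` B) F ->
  (forall p, 0 <= F p) ->
  \int[m1 \x m2]_(p in A `*` B) F p = \int[m1]_(x in A) \int[m2]_(y in B) F (x, y).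
Proof.
move=> mF F0; rewrite integral_mkcond fubini_tonelli1.
- by rewrite [RHS]integral_mkcond; apply: eq_integral => x _; rewrite -patch1.
- exact: (measurable_restrictT _ (measurableX mA mB)).1 mF.
- by move=> p; apply: erestrict_ge0.
Qed.

End set_product_integral.

Section compactness.
Context {R : realType}.

Lemma compact_continuous_bounded (T : topologicalType) (f : T -> R) (K : set T) :
  compact K -> {in K, continuous f} -> exists2 C, 0 <= C & forall x, K x -> `|f x| <= C.
Proof.
move=> cK cf; have [/eqP -> | /set0P K0] := boolP (K == set0).
  by exists 0 => // x [].
have [|c Kc cP] := @compact_EVT_max T R (fun x => `|f x|) K K0 cK.
  apply: continuous_in_subspaceT => x xK; apply: cvg_norm; exact: cf.
exists `|f c| => // x Kx; apply: cP; exact: mem_set.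
Qed.

Lemma compact_rV_ball n (r : R) : compact [set a : 'rV[R]_n | `|a| <= r].
Proof.
have [r0|r0] := leP 0 r; last first.
  rewrite (_ : mkset _ = set0); first exact: compact0.
  by apply/seteqP; split => // a /= /(le_trans (normr_ge0 _)); rewrite leNgt r0.
rewrite (_ : mkset _ = [set v : 'rV[R]_n | forall i, `[-r, r]%classic (v ord0 i)]).
  by apply: (@rV_compact _ _ (fun=> `[-r, r]%classic)) => i; exact: segment_compact.
apply/seteqP; split => a /=; rewrite rV_norm_leP//.
  by move=> H i; rewrite /= in_itv/= -ler_norml.
by move=> H i; rewrite ler_norml; have := H i; rewrite /= in_itv.
Qed.

Lemma measurable_rV_ball n (r : R) : measurable [set a : 'rV[R]_n | `|a| <= r].
Proof.
have : measurable_fun setT (fun a : 'rV[R]_n => `|a|).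
  by apply: continuous_measurable_rV => a; exact: norm_continuous.
move=> /(_ measurableT `]-oo, r]%classic (measurable_itv _)); rewrite setTI.
by rewrite (_ : _ @^-1` _ = [set a | `|a| <= r]).
Qed.

Lemma lebesgue_rV_ball_lty n (r : R) :
  (lebesgue_rV n [set a : 'rV[R]_n | (`|a| <= r)%R] < +oo)%E.
Proof.
have mb (c d : 'rV[R]_n) : measurable [set v : 'rV[R]_n | forall i, c 0 i < v 0 i <= d 0 i].
  rewrite (_ : mkset _ = \bigcap_(i in [set: 'I_n])
      (setT `&` rV_coord i @^-1` `]c 0 i, d 0 i]%classic)); last first.
    apply/seteqP; split => v /= H i.
      by move=> _; split => //=; rewrite in_itv/= H.
    by have [//|_] := H i; rewrite /= in_itv.
  by apply: fin_bigcap_measurable => // i _; exact: measurable_rV_coord.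
pose c : 'rV[R]_n := const_mx (- (`|r| + 1)); pose e : 'rV[R]_n := const_mx (`|r| + 1).
have h := @lebesgue_rV_box R n c e.
apply: (@le_lt_trans _ _ (lebesgue_rV n [set v : 'rV[R]_n | forall i, c 0 i < v 0 i <= e 0 i])).
  apply: le_measure; rewrite ?inE//; first exact: measurable_rV_ball.
  move=> v /= vr i; rewrite !mxE.
  have := le_trans (le_coord_norm v i) vr; rewrite ler_norml => /andP[? ?].
  have := ler_norm r; move=> ?; apply/andP; split; lra.
rewrite h ?ltry// => i; rewrite !mxE; have := normr_ge0 r; lra.
Qed.

End compactness.

Section phase_space.
Context {R : realType} (n : nat) (l : R).
Notation leb := (@lebesgue_measure R).
Notation V := 'rV[R]_n.

Definition phase_measure := (@lebesgue_rV R n \x leb)%E.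

(** The norm being the sup norm, this is the cube [-r, r]^n times [0, l]. *)
Definition phase_box (r : R) : set (V * measurableTypeR R) :=
  [set a : V | `|a| <= r] `*` `[0, l]%classic.

Definition phase_integral (r : R) (G : V -> R -> R) : R :=
  \int[phase_measure]_(p in phase_box r) G p.1 p.2.

Definition jcontinuous (G : V -> R -> R) := continuous (fun p : V * R => G p.1 p.2).

Lemma measurable_phase_box r : measurable (phase_box r).
Proof. by apply: measurableX; [exact: measurable_rV_ball|exact: measurable_itv]. Qed.

Lemma phase_box_lty r : (phase_measure (phase_box r) < +oo)%E.
Proof.
rewrite /phase_measure /phase_box product_measure1E; last 2 first.
- exact: measurable_rV_ball.
- exact: measurable_itv.
apply: lte_mul_pinfty.
- exact: measure_ge0.
- by rewrite ge0_fin_numE ?lebesgue_rV_ball_lty//; exact: measure_ge0.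
- rewrite [ltLHS](lebesgue_measure_itv `[0, l]); case: ifP => _ //=.
  by rewrite -EFinB ltry.
Qed.

Lemma compact_phase_box r : compact ([set a : V | `|a| <= r] `*` `[0 : R, l]%classic).
Proof. by apply: compact_setX; [exact: compact_rV_ball|exact: segment_compact]. Qed.

Lemma jcontinuous_measurable G : jcontinuous G ->
  measurable_fun [set: V * measurableTypeR R] (fun p => G p.1 p.2).
Proof. by move=> cG; exact: continuous_measurable_rV_prod cG. Qed.

Lemma measurable_le_phase_integrable r (C : R) (G : V * measurableTypeR R -> R) :
  measurable_fun (phase_box r) G -> (forall p, phase_box r p -> `|G p| <= C) ->
  phase_measure.-integrable (phase_box r) (EFin \o G).
Proof.
move=> mG GC; apply: measurable_bounded_integrable.
- exact: measurable_phase_box.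
- exact: phase_box_lty.
- exact: mG.
- exists C; split; first exact: num_real.
  by move=> x Cx p pbox /=; apply: le_trans (ltW Cx); exact: GC.
Qed.

Lemma phase_integrable r G : jcontinuous G ->
  phase_measure.-integrable (phase_box r) (fun p => (G p.1 p.2)%:E).
Proof.
move=> cG; have [|C _ GC] := @compact_continuous_bounded R _ (fun p => G p.1 p.2) _ (@compact_phase_box r).
  by move=> p _; exact: cG.
apply: (measurable_le_phase_integrable (C := C)) => [|p pbox]; last exact: GC.
exact: measurable_funS (jcontinuous_measurable cG).
Qed.

End phase_space.

(** * Differentiation of phase integrals *)

Section derivatives.
Context {R : realType}.

Lemma is_derive_line (V : normedModType R) (x v : V) (g : V -> R) (h d : R) :
  is_derive (h *: v + x) v g d -> is_derive h 1 (fun h => g (h *: v + x)) d.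
Proof.
move=> [dg gd].
have E : (fun k : R => k^-1 *: (((fun h => g (h *: v + x)) \o shift h) (k *: 1) - g (h *: v + x)))
    = (fun k => k^-1 *: ((g \o shift (h *: v + x)) (k *: v) - g (h *: v + x))).
  by apply/funext => k /=; rewrite [k *: 1]mulr1 scalerDl addrA.
split; first by rewrite /derivable E.
by rewrite -gd /derive E.
Qed.

Lemma derive_locally_cst (V : normedModType R) (x v : V) (g : V -> R) (d c : R) :
  is_derive x v g d -> (\forall y \near x, g y = c) -> d = 0.
Proof.
move=> [_ <-] gc.
by rewrite (near_eq_derive (g := cst c))// derive_cst.
Qed.

Lemma nbhs_lt_norm (V : normedModType R) (a : V) (r : R) : r < `|a| ->
  \forall y \near a, r < `|y|.
Proof.
by move=> ra; apply: (@cvgr_gt _ _ _ _ _ _ (@norm_continuous _ V a)).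
Qed.
End derivatives.

Section under_integral.
Context {R : realType} d (Y : measurableType d) (mu : {measure set Y -> \bar R}).

Lemma is_derive_under_integral (f f' : R -> Y -> R) (B : set Y) (a u v : R) (g : Y -> R) :
  measurable B -> u < a < v ->
  (forall x, u < x < v -> mu.-integrable B (EFin \o f x)) ->
  (forall x y, u < x < v -> B y -> is_derive x 1 (f^~ y) (f' x y)) ->
  mu.-integrable B (EFin \o g) ->
  (forall x y, u < x < v -> B y -> `|f' x y| <= g y) ->
  is_derive a 1 (fun x => \int[mu]_(y in B) f x y) (\int[mu]_(y in B) f' a y).
Proof.
move=> mB uav fi df gi f'g.
have Ia : `]u, v[%classic a by rewrite /= in_itv.
have fi' x : `]u, v[%classic x -> mu.-integrable B (EFin \o f x).
  by rewrite /= in_itv/=; exact: fi.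
have df' x y : `]u, v[%classic x -> B y -> derivable (f^~ y) x 1.
  by rewrite /= in_itv/= => ? ?; have [] := df x y.
have gi' : mu.-integrable B (EFin \o (fun y => `|g y|)) by exact: integrable_norm.
have f'g' x y : `]u, v[%classic x -> B y -> `|partial1of2 f x y| <= `|g y|.
  rewrite /= in_itv/= => xuv By; rewrite partial1of2E (derive_val (is_derive := df x y xuv By)).
  exact: le_trans (f'g x y xuv By) (ler_norm _).
split; first exact: (derivable_under_integral mB Ia fi' df' (fun=> normr_ge0 _) gi' f'g').
rewrite -derive1E (differentiation_under_integral mB Ia fi' df' (fun=> normr_ge0 _) gi' f'g').
apply: eq_Rintegral => y; rewrite inE => By.
by rewrite /= partial1of2E (derive_val (is_derive := df a y uav By)).
Qed.

End under_integral.

Section phase_calculus.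
Context {R : realType} (n : nat) (l : R).
Notation leb := (@lebesgue_measure R).
Notation V := 'rV[R]_n.

Lemma jcontinuous_fix_a (G : V -> R -> R) a : jcontinuous G -> continuous (G a).
Proof.
move=> cG s.
apply: (@cvg_comp _ _ _ (fun s => (a, s)) (fun p : V * R => G p.1 p.2) _ (nbhs (a, s))); last exact: (cG (a, s)).
exact: (cvg_pair (cvg_cst a) cvg_id).
Qed.

Lemma jcontinuous_fix_s (G : V -> R -> R) s : jcontinuous G -> continuous (G^~ s).
Proof.
move=> cG; suff h (a : V) : {for a, continuous (G^~ s)} by move=> a; exact: h.
apply: (@cvg_comp _ _ _ (fun a => (a, s)) (fun p : V * R => G p.1 p.2) _ (nbhs (a, s))); last exact: (cG (a, s)).
have h1 : x @[x --> a] --> a by exact: cvg_id.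
have h2 : s @[x --> a] --> s := @cvg_cst _ s V (nbhs a) (nbhs_filter a).
exact: (cvg_pair h1 h2).
Qed.

Lemma continuous_integrable_itv (g : R -> R) (a b : R) : continuous g ->
  leb.-integrable `[a, b] (EFin \o g).
Proof.
move=> cg; apply: continuous_compact_integrable; first exact: segment_compact.
exact: continuous_subspaceT.
Qed.

Lemma continuous_integrable_ball (g : V -> R) (r : R) : continuous g ->
  (lebesgue_rV n).-integrable [set a | `|a| <= r] (EFin \o g).
Proof.
move=> cg; have [|C _ gC] := @compact_continuous_bounded R _ g _ (@compact_rV_ball R n r).
  by move=> p _; exact: cg.
apply: measurable_bounded_integrable.
- exact: measurable_rV_ball.
- exact: lebesgue_rV_ball_lty.
- exact: measurable_funS (continuous_measurable_rV cg).
- exists C; split; first exact: num_real.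
  by move=> x Cx p pbox /=; apply: le_trans (ltW Cx); exact: gC.
Qed.

Lemma EFin_Rintegral d (T : measurableType d) (m : {measure set T -> \bar R}) (D : set T) (g : T -> R) :
  measurable D -> m.-integrable D (EFin \o g) ->
  ((\int[m]_(x in D) g x)%R)%:E = (\int[m]_(x in D) (g x)%:E)%E.
Proof. by move=> mD ig; rewrite /Rintegral fineK//; exact: integrable_fin_num. Qed.

Lemma phase_integral_as r (G : V -> R -> R) : jcontinuous G ->
  phase_integral l r G =
  \int[lebesgue_rV n]_(a in [set a | `|a| <= r]) \int[leb]_(s in `[0, l]) G a s.
Proof.
move=> cG; rewrite /phase_integral [LHS]/Rintegral /phase_measure.
have mI : measurable (`[0, l]%classic : set (measurableTypeR R)) by exact: measurable_itv.
rewrite (integral_setX12 (@measurable_rV_ball R n r) mI (phase_integrable l r cG)).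
congr fine; apply: eq_integral => a _; rewrite EFin_Rintegral//.
by apply: continuous_integrable_itv; exact: jcontinuous_fix_a.
Qed.

Lemma phase_integral_sa r (G : V -> R -> R) : jcontinuous G ->
  phase_integral l r G =
  \int[leb]_(s in `[0, l]) \int[lebesgue_rV n]_(a in [set a | `|a| <= r]) G a s.
Proof.
move=> cG; rewrite /phase_integral [LHS]/Rintegral /phase_measure.
have mI : measurable (`[0, l]%classic : set (measurableTypeR R)) by exact: measurable_itv.
rewrite (integral_setX21 (@measurable_rV_ball R n r) mI (phase_integrable l r cG)).
congr fine; apply: eq_integral => s _; rewrite EFin_Rintegral//.
- exact: measurable_rV_ball.
- by apply: continuous_integrable_ball; exact: jcontinuous_fix_s.
Qed.

Lemma phase_integral_ds0 r (H Hs : V -> R -> R) : 0 < l ->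
  jcontinuous Hs -> (forall a (s : R), is_derive s (1 : R) (H a) (Hs a s)) ->
  (forall a, H a l = H a 0) -> phase_integral l r Hs = 0.
Proof.
move=> l0 cHs dH Hl; rewrite phase_integral_as//.
rewrite (eq_Rintegral _ (g := cst 0)) => [|a _].
  by rewrite /Rintegral integral0.
rewrite /Rintegral (@continuous_FTC2 R (Hs a) (H a))//.
- by rewrite Hl -EFinB subrr.
- by apply: continuous_subspaceT; exact: jcontinuous_fix_a.
- have cH x : {for x, continuous (H a)}.
    by apply: differentiable_continuous; apply/derivable1_diffP; have [] := dH a x.
  split => [x _||]; first by have [] := dH a x.
  + exact: cvg_at_right_filter (cH 0).
  + exact: cvg_at_left_filter (cH l).
- by move=> x _; rewrite derive1E; have [] := dH a x.
Qed.

Lemma integral_compact_support r (g : V -> R) :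
  (forall a, r < `|a| -> g a = 0) ->
  \int[lebesgue_rV n]_(a in [set a | `|a| <= r]) g a = \int[lebesgue_rV n]_a g a.
Proof.
move=> g0; rewrite Rintegral_mkcond; congr Rintegral.
apply/funext => a; rewrite patchE; case: ifPn => // /negP.
by rewrite inE/= => /negP; rewrite -ltNge => /g0 ->.
Qed.

(** Translation invariance makes the integral of a directional derivative of a
    compactly supported function vanish. *)
Lemma integral_derive_eq0 r (e : V) (g g' : V -> R) : `|e| <= 1 ->
  continuous g -> continuous g' ->
  (forall a : V, is_derive a e g (g' a)) -> (forall a, r < `|a| -> g a = 0) ->
  \int[lebesgue_rV n]_(a in [set a | `|a| <= r]) g' a = 0.
Proof.
move=> e1 cg cg' dg g0.
have g'0 a : r < `|a| -> g' a = 0.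
  move=> ra; apply: (derive_locally_cst (c := 0) (dg a)).
  by apply: filterS (nbhs_lt_norm ra); exact: g0.
rewrite integral_compact_support//.
rewrite -(@integral_compact_support (r + 1)); last first.
  by move=> a ra; apply: g'0; apply: lt_trans ra; rewrite ltrDl.
pose B : set V := [set a | `|a| <= r + 1].
pose F h := \int[lebesgue_rV n]_(a in B) g (h *: e + a).
have dF (h : R) (a : V) : is_derive h (1 : R) (fun h => g (h *: e + a)) (g' (h *: e + a)).
  exact: is_derive_line.
have ctr (h : R) : continuous (fun a : V => h *: e + a).
  suff H (a : V) : {for a, continuous (fun a : V => h *: e + a)} by move=> a; exact: H.
  apply: (@continuousD _ _ _ (cst (h *: e)) id); [exact: cst_continuous|exact: cvg_id].
have Fcst h : `]-1, 1[%classic h -> F h = \int[lebesgue_rV n]_a g a.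
  rewrite /= in_itv/= => /andP[h1 h2]; rewrite /F integral_compact_support.
    rewrite /Rintegral -(integral_rV_translate (h *: e) (g := fun a => (g a)%:E)).
      by congr fine; apply: eq_integral => a _; rewrite addrC.
    by apply/measurable_EFinP; exact: continuous_measurable_rV.
  move=> a ra; apply: g0; rewrite -(ltrD2r 1) (lt_le_trans ra)//.
  rewrite -[a in leLHS](addKr (h *: e)) (le_trans (ler_normD _ _))// normrN addrC lerD//.
  rewrite normrZ (le_trans (ler_wpM2l _ e1))// mulr1.
  by rewrite ler_norml; apply/andP; split; exact: ltW.
have [C C0 g'C] : exists2 C : R, 0 <= C & forall a : V, `|g' a| <= C.
  have [|C C0 hC] := @compact_continuous_bounded R _ g' _ (@compact_rV_ball R n r).
    by move=> p _; exact: cg'.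
  exists C => // a; have [ar|ar] := leP `|a| r; first exact: hC.
  by rewrite g'0// normr0.
have dF0 : is_derive (0 : R) (1 : R) F (\int[lebesgue_rV n]_(a in B) g' (0 *: e + a)).
  apply: (@is_derive_under_integral _ _ _ _ (fun h a => g (h *: e + a))
    (fun h a => g' (h *: e + a)) B 0 (-1) 1 (cst C)).
  - exact: measurable_rV_ball.
  - by apply/andP; split; lra.
  - move=> h _; apply: (@continuous_integrable_ball (fun a => g (h *: e + a))) => a.
    by apply: (cvg_comp (fun a => h *: e + a) g); [exact: ctr|exact: cg].
  - by apply: (@continuous_integrable_ball (cst C) (r + 1)); exact: cst_continuous.
  - by move=> h a _ _ /=.
under eq_Rintegral do rewrite -[X in g' X]add0r -(scale0r e).
apply: (derive_locally_cst (c := \int[lebesgue_rV n]_a g a) dF0).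
near=> h; apply: Fcst; near: h.
by apply: near_in_itvoo; rewrite in_itv/=; apply/andP; split; lra.
Unshelve. all: by end_near. Qed.

Lemma phase_integral_da0 r k (G Gk : V -> R -> R) (z : R -> R) :
  jcontinuous G -> jcontinuous Gk -> continuous z ->
  (forall (a : V) s, is_derive a (delta_mx 0 k) (G^~ s) (Gk a s)) ->
  (forall a s, r < `|a| -> G a s = 0) ->
  phase_integral l r (fun a s => z s * Gk a s) = 0.
Proof.
move=> cG cGk cz dG G0; rewrite phase_integral_sa; last first.
  by move=> p; apply: cvgM; [apply: (cvg_comp snd z); [exact: cvg_snd|exact: cz]|exact: cGk].
rewrite (eq_Rintegral _ (g := cst 0)) => [|s _].
  by rewrite /Rintegral integral0.
rewrite RintegralZl; last 2 first.
- exact: measurable_rV_ball.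
- by apply: continuous_integrable_ball; exact: jcontinuous_fix_s.
rewrite (@integral_derive_eq0 r (delta_mx 0 k) (G^~ s) (Gk^~ s)) ?mulr0//.
- apply/rV_norm_leP => // i; rewrite mxE eqxx/=.
  by case: eqP => _ /=; rewrite ?normr0// normr1.
- exact: jcontinuous_fix_s.
- exact: jcontinuous_fix_s.
- by move=> a; exact: G0.
Qed.

Lemma phase_integral_dt r (G Gt : V -> R -> R -> R) (C t1 t2 t : R) :
  t1 < t < t2 ->
  (forall t, t1 < t < t2 -> jcontinuous (fun a s => G a s t)) ->
  (forall a s (t : R), t1 < t < t2 -> is_derive t (1 : R) (G a s) (Gt a s t)) ->
  (forall a s t, `|a| <= r -> 0 <= s <= l -> t1 < t < t2 -> `|Gt a s t| <= C) ->
  is_derive t 1 (fun t => phase_integral l r (fun a s => G a s t))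
    (phase_integral l r (fun a s => Gt a s t)).
Proof.
move=> tt cG dG GtC.
apply: (@is_derive_under_integral R _ _ (lebesgue_rV n \x leb)%E (fun t p => G p.1 p.2 t)
  (fun t p => Gt p.1 p.2 t) (phase_box l r) t t1 t2 (cst C)).
- exact: measurable_phase_box.
- exact: tt.
- by move=> u uu; exact: (@phase_integrable _ n l r (fun a s => G a s u) (cG u uu)).
- by move=> u p uu _; exact: dG.
- by apply: (@phase_integrable _ n l r (fun _ _ => C)); exact: cst_continuous.
- by move=> u [a s] uu [/= ar sl]; apply: GtC.
Qed.

Lemma phase_integralD r (G H : V -> R -> R) : jcontinuous G -> jcontinuous H ->
  phase_integral l r (fun a s => G a s + H a s) = phase_integral l r G + phase_integral l r H.
Proof.
move=> cG cH; apply: RintegralD.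
- exact: measurable_phase_box.
- exact: phase_integrable.
- exact: phase_integrable.
Qed.

Lemma phase_integralZ r (c : R) (G : V -> R -> R) : jcontinuous G ->
  phase_integral l r (fun a s => c * G a s) = c * phase_integral l r G.
Proof.
move=> cG; apply: RintegralZl.
- exact: measurable_phase_box.
- exact: phase_integrable.
Qed.

Lemma phase_integral_sum r (I : Type) (q : seq I) (G : I -> V -> R -> R) :
  (forall i, jcontinuous (G i)) ->
  phase_integral l r (fun a s => \sum_(i <- q) G i a s) = \sum_(i <- q) phase_integral l r (G i).
Proof.
move=> cG; have cS q' : jcontinuous (fun a s => \sum_(i <- q') G i a s).
  elim: q' => [|i q' IH].
    rewrite (_ : (fun _ _ => _) = (fun _ _ => 0)); first exact: cst_continuous.
    by apply/funext => a; apply/funext => s; rewrite big_nil.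
  rewrite (_ : (fun _ _ => _) = (fun a s => G i a s + \sum_(i <- q') G i a s)).
    by move=> p; apply: cvgD; [exact: cG|exact: IH].
  by apply/funext => a; apply/funext => s; rewrite big_cons.
elim: q => [|i q IH].
  rewrite big_nil (_ : (fun _ _ => _) = (fun _ _ => 0)).
    by rewrite /phase_integral /Rintegral integral0.
  by apply/funext => a; apply/funext => s; rewrite big_nil.
rewrite big_cons -IH -phase_integralD//.
by congr phase_integral; apply/funext => a; apply/funext => s; rewrite big_cons.
Qed.

Lemma le_phase_integral r (G H : V -> R -> R) : jcontinuous G -> jcontinuous H ->
  (forall a s, `|a| <= r -> 0 <= s <= l -> G a s <= H a s) ->
  phase_integral l r G <= phase_integral l r H.
Proof.
move=> cG cH GH; apply: le_Rintegral.
- exact: measurable_phase_box.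
- exact: phase_integrable.
- exact: phase_integrable.
- by move=> [a s] [/= ar sl]; apply: GH.
Qed.

End phase_calculus.

(** * Directional derivatives and joint continuity *)

Section directional.
Context {R : realType} (V : normedModType R).

Lemma is_derive_lineP (x v : V) (g : V -> R) (d : R) :
  is_derive x v g d <-> is_derive (0 : R) (1 : R) (fun h : R => g (h *: v + x)) d.
Proof.
have E : (fun k : R => k^-1 *: (((fun h => g (h *: v + x)) \o shift 0) (k *: 1) - g (0 *: v + x)))
    = (fun k => k^-1 *: ((g \o shift x) (k *: v) - g x)).
  by apply/funext => k /=; rewrite [k *: 1]mulr1 addr0 scale0r add0r.
split=> -[dg gd].
  split; first by rewrite /derivable E.
  by rewrite -gd /derive E.
split; first by move: dg; rewrite /derivable E.
by rewrite -gd /derive E.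
Qed.

Lemma is_derive_comp_dir (x v : V) (g : V -> R) (b : R -> R) (d b' : R) :
  is_derive (g x) (1 : R) b b' -> is_derive x v g d ->
  is_derive x v (fun y => b (g y)) (b' * d).
Proof.
move=> db /is_derive_lineP dg; apply/is_derive_lineP.
by apply: (@is_derive1_comp _ b); rewrite scale0r add0r.
Qed.

Lemma is_derive_mul (x v : V) (g h : V -> R) (dg dh : R) :
  is_derive x v g dg -> is_derive x v h dh ->
  is_derive x v (fun y => g y * h y) (dg * h x + g x * dh).
Proof.
move=> Dg Dh; have [D1 D2] := @is_deriveM _ _ g h x v dg dh Dg Dh.
split; first exact: D1.
rewrite [LHS]D2.
by rewrite addrC; congr (_ + _); rewrite mulrC.
Qed.

Lemma is_derive_add (x v : V) (g h : V -> R) (dg dh : R) :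
  is_derive x v g dg -> is_derive x v h dh ->
  is_derive x v (fun y => g y + h y) (dg + dh).
Proof. by move=> Dg Dh; exact: (@is_deriveD _ _ _ g h x v dg dh Dg Dh). Qed.

Lemma is_derive_sub (x v : V) (g h : V -> R) (dg dh : R) :
  is_derive x v g dg -> is_derive x v h dh ->
  is_derive x v (fun y => g y - h y) (dg - dh).
Proof.
by move=> Dg Dh; exact: (is_derive_add Dg (@is_deriveN _ _ _ h x v dh Dh)).
Qed.

Lemma is_derive_periodic (g g' : R -> R) (l : R) :
  (forall s, g (s + l) = g s) -> (forall s, is_derive s (1 : R) g (g' s)) ->
  forall s, g' (s + l) = g' s.
Proof.
move=> gl dg s; have [_ <-] := dg (s + l); have [_ <-] := dg s.
have E : (fun h : R => h^-1 *: ((g \o shift (s + l)) (h *: 1) - g (s + l)))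
    = (fun h : R => h^-1 *: ((g \o shift s) (h *: 1) - g s)).
  by apply/funext => h /=; rewrite gl addrA gl.
by rewrite /derive E.
Qed.

End directional.

Section positive_times.
Context {R : realType} {n : nat}.
Notation V := 'rV[R]_n.
Notation pcont := (@continuous_at_positive_times R n).

Lemma pcont_jcontinuous (W : V -> R -> R -> R) (t : R) : pcont W -> 0 < t ->
  jcontinuous (fun a s => W a s t).
Proof.
move=> cW t0; suff H (p : V * R) : {for p, continuous (fun p : V * R => W p.1 p.2 t)} by move=> p; exact: H.
apply: (@cvg_comp _ _ _ (fun p : V * R => (p, t)) (fun q : V * R * R => W q.1.1 q.1.2 q.2) _ (nbhs (p, t))).
  have h1 : x @[x --> p] --> p by exact: cvg_id.
  have h2 : t @[x --> p] --> t := @cvg_cst _ t (V * R)%type (nbhs p) (nbhs_filter p).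
  exact: (cvg_pair h1 h2).
by case: p => a s; exact: cW.
Qed.

Lemma pcont_bounded (W : V -> R -> R -> R) (r l t1 t2 : R) : pcont W -> 0 < t1 ->
  exists C, forall a s t, `|a| <= r -> 0 <= s <= l -> t1 <= t <= t2 -> `|W a s t| <= C.
Proof.
move=> cW t10.
have cK : compact ([set a : V | `|a| <= r] `*` `[0 : R, l]%classic `*` `[t1, t2]%classic).
  apply: compact_setX; last exact: segment_compact.
  by apply: compact_setX; [exact: compact_rV_ball|exact: segment_compact].
have [|C _ hC] := @compact_continuous_bounded R _ (fun q : V * R * R => W q.1.1 q.1.2 q.2) _ cK.
  move=> [[a s] t]; rewrite inE/= => -[_]; rewrite in_itv/= => /andP[t1t _].
  by apply: cW; exact: lt_le_trans t1t.
exists C => a s t ar sl tt; apply: (hC (a, s, t)); split => /=.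
  by split => //=; rewrite in_itv.
by rewrite in_itv.
Qed.

Lemma pcontD W1 W2 : pcont W1 -> pcont W2 -> pcont (fun a s t => W1 a s t + W2 a s t).
Proof. by move=> c1 c2 a s t t0; apply: cvgD; [exact: c1|exact: c2]. Qed.

Lemma pcontN W : pcont W -> pcont (fun a s t => - W a s t).
Proof. by move=> c1 a s t t0; apply: cvgN; exact: c1. Qed.

Lemma pcontM W1 W2 : pcont W1 -> pcont W2 -> pcont (fun a s t => W1 a s t * W2 a s t).
Proof. by move=> c1 c2 a s t t0; apply: cvgM; [exact: c1|exact: c2]. Qed.

Lemma pcont_comp (b : R -> R) W : continuous b -> pcont W -> pcont (fun a s t => b (W a s t)).
Proof.
move=> cb cW a s t t0.
by apply: (cvg_comp (fun q : V * R * R => W q.1.1 q.1.2 q.2) b); [exact: cW|exact: cb].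
Qed.

Lemma pcont_cst c : pcont (fun _ _ _ => c).
Proof. by move=> a s t _; exact: cst_continuous. Qed.

Lemma pcont_s (g : R -> R) : continuous g -> pcont (fun _ s _ => g s).
Proof.
move=> cg a s t _.
apply: (cvg_comp (fun q : V * R * R => q.1.2) g); last exact: cg.
by apply: (cvg_comp fst snd); [exact: cvg_fst|exact: cvg_snd].
Qed.

Lemma pcont_t (g : R -> R) : continuous g -> pcont (fun _ _ t => g t).
Proof.
move=> cg a s t _.
by apply: (cvg_comp (fun q : V * R * R => q.2) g); [exact: cvg_snd|exact: cg].
Qed.

Lemma pcont_a (g : V -> R) : continuous g -> pcont (fun a _ _ => g a).
Proof.
move=> cg a s t _.
apply: (cvg_comp (fun q : V * R * R => q.1.1) g); last exact: cg.
by apply: (cvg_comp fst fst); [exact: cvg_fst|exact: cvg_fst].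
Qed.

Lemma pcont_sum (I : Type) (r : seq I) (P : pred I) (W : I -> V -> R -> R -> R) :
  (forall i, pcont (W i)) -> pcont (fun a s t => \sum_(i <- r | P i) W i a s t).
Proof.
move=> cW; elim: r => [|i r IH].
  rewrite (_ : (fun _ _ _ => _) = (fun _ _ _ => 0)); first exact: pcont_cst.
  by apply/funext => a; apply/funext => s; apply/funext => t; rewrite big_nil.
rewrite (_ : (fun _ _ _ => _) = (fun a s t => (if P i then W i a s t else 0) + \sum_(i <- r | P i) W i a s t)).
  by apply: pcontD => //; case: (P i) => //; exact: pcont_cst.
by apply/funext => a; apply/funext => s; apply/funext => t; rewrite big_cons; case: (P i); rewrite ?add0r.
Qed.

End positive_times.

(** * The weighted conservation law *)

Section fokker_planck.
Context {R : realType} (n : nat) (eps l : R) (z : R -> 'rV[R]_n).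
Notation V := 'rV[R]_n.
Notation leb := (@lebesgue_measure R).
Notation pcont := (@continuous_at_positive_times R n).
Variable f : V -> R -> R -> R.
Hypothesis l_gt0 : 0 < l.
Hypothesis z_cont : forall k, continuous (fun s => z s 0 k).
Hypothesis f_per : forall a s t, 0 < t -> f a (s + l) t = f a s t.
Hypothesis f_reg : regular_at_positive_times f.
Hypothesis f_eq : forall a s t, 0 < t ->
  d_t f a s t + \sum_(k < n) z s 0 k * d_a k f a s t = eps ^+ 2 / 2 * d_s (d_s f) a s t.

Let cf : pcont f. Proof. case: f_reg => _ [c1 c2 c3 c4 c5]; exact: c1. Qed.
Let cft : pcont (d_t f). Proof. case: f_reg => _ [c1 c2 c3 c4 c5]; exact: c2. Qed.
Let cfa k : pcont (d_a k f). Proof. case: f_reg => _ [c1 c2 c3 c4 c5]; exact: c3. Qed.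
Let cfs : pcont (d_s f). Proof. case: f_reg => _ [c1 c2 c3 c4 c5]; exact: c4. Qed.
Let cfss : pcont (d_s (d_s f)). Proof. case: f_reg => _ [c1 c2 c3 c4 c5]; exact: c5. Qed.

Let dft a s (t : R) : 0 < t -> is_derive t (1 : R) (f a s) (d_t f a s t).
Proof.
move=> t0; case: f_reg => /(_ a s t t0)[D _ _ _] _; split; first exact: D.
by rewrite /d_t derive1E.
Qed.
Let dfa k (a : V) s t : 0 < t -> is_derive a (delta_mx 0 k) (fun a => f a s t) (d_a k f a s t).
Proof. move=> t0; case: f_reg => /(_ a s t t0)[_ D _ _] _; split; [exact: D|by []]. Qed.
Let dfs a (s : R) t : 0 < t -> is_derive s (1 : R) (fun s => f a s t) (d_s f a s t).
Proof.
move=> t0; case: f_reg => /(_ a s t t0)[_ _ D _] _; split; first exact: D.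
by rewrite /d_s derive1E.
Qed.
Let dfss a (s : R) t : 0 < t -> is_derive s (1 : R) (fun s => d_s f a s t) (d_s (d_s f) a s t).
Proof.
move=> t0; case: f_reg => /(_ a s t t0)[_ _ _ D] _; split; first exact: D.
by rewrite /d_s derive1E.
Qed.

Section energy_identity.
Variables (u ut us uss : V -> R -> R -> R) (ua : 'I_n -> V -> R -> R -> R).
Hypotheses (cu : pcont u) (cut : pcont ut) (cus : pcont us) (cuss : pcont uss)
  (cua : forall k, pcont (ua k)).
Hypothesis dut : forall a s (t : R), 0 < t -> is_derive t (1 : R) (u a s) (ut a s t).
Hypothesis dua : forall k (a : V) s t, 0 < t ->
  is_derive a (delta_mx 0 k) (fun a => u a s t) (ua k a s t).
Hypothesis dus : forall a (s : R) t, 0 < t ->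
  is_derive s (1 : R) (fun s => u a s t) (us a s t).
Hypothesis duss : forall a (s : R) t, 0 < t ->
  is_derive s (1 : R) (fun s => us a s t) (uss a s t).
Hypothesis u_per : forall a s t, 0 < t -> u a (s + l) t = u a s t.
Variables (b b' b'' : R -> R).
Hypothesis db : forall x, is_derive x (1 : R) b (b' x).
Hypothesis db' : forall x, is_derive x (1 : R) b' (b'' x).
Hypothesis cb'' : continuous b''.
Variables (r t2 : R).
Hypothesis supp : forall a s t, r < `|a| -> 0 < t < t2 -> u a s t * b (f a s t) = 0.

Let cderiv (g g' : R -> R) : (forall x, is_derive x (1 : R) g (g' x)) -> continuous g.
Proof.
by move=> dg x; apply: differentiable_continuous; apply/derivable1_diffP; have [] := dg x.
Qed.

Let cb : continuous b. Proof. exact: cderiv db. Qed.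
Let cb' : continuous b'. Proof. exact: cderiv db'. Qed.

(** What a weight [u] and a nonlinearity [b] leave of the equation: the backward
    generator acts on [u], and the second derivative of [b] produces a dissipation,
    which has a sign when [b] is convex. *)
Definition energy_rate a s t :=
  (ut a s t + \sum_(k < n) z s 0 k * ua k a s t + eps ^+ 2 / 2 * uss a s t) * b (f a s t)
  - eps ^+ 2 / 2 * (u a s t * b'' (f a s t) * (d_s f a s t * d_s f a s t)).

Let Gt a s t := ut a s t * b (f a s t) + u a s t * (b' (f a s t) * d_t f a s t).
Let Ga k a s t := ua k a s t * b (f a s t) + u a s t * (b' (f a s t) * d_a k f a s t).
Let H a s t := u a s t * (b' (f a s t) * d_s f a s t) - us a s t * b (f a s t).
Let Hs a s t := (us a s t * (b' (f a s t) * d_s f a s t) +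
   u a s t * (b'' (f a s t) * d_s f a s t * d_s f a s t + b' (f a s t) * d_s (d_s f) a s t))
  - (uss a s t * b (f a s t) + us a s t * (b' (f a s t) * d_s f a s t)).

Let GtE a s t : 0 < t ->
  Gt a s t = energy_rate a s t + (- \sum_(k < n) z s 0 k * Ga k a s t + eps ^+ 2 / 2 * Hs a s t).
Proof.
move=> t0; have E := f_eq a s t0.
have -> : \sum_(k < n) z s 0 k * Ga k a s t =
   (\sum_(k < n) z s 0 k * ua k a s t) * b (f a s t) +
   u a s t * b' (f a s t) * \sum_(k < n) z s 0 k * d_a k f a s t.
  rewrite mulr_suml mulr_sumr -big_split; apply: eq_bigr => k _ /=; rewrite /Ga; ring.
rewrite /Gt /energy_rate /Hs.
have -> : d_t f a s t = eps ^+ 2 / 2 * d_s (d_s f) a s t - \sum_(k < n) z s 0 k * d_a k f a s t.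
  by rewrite -E addrK.
ring.
Qed.

Let cbf : pcont (fun a s t => b (f a s t)). Proof. exact: pcont_comp cb cf. Qed.
Let cb'f : pcont (fun a s t => b' (f a s t)). Proof. exact: pcont_comp cb' cf. Qed.
Let cb''f : pcont (fun a s t => b'' (f a s t)). Proof. exact: pcont_comp cb'' cf. Qed.
Let cz k : pcont (fun _ s _ => z s 0 k). Proof. exact: (pcont_s (z_cont (k := k))). Qed.
Let ceps : pcont (fun _ _ _ => eps ^+ 2 / 2). Proof. exact: pcont_cst. Qed.

Let cGt : pcont Gt.
Proof. exact: (pcontD (pcontM cut cbf) (pcontM cu (pcontM cb'f cft))). Qed.
Let cGa k : pcont (Ga k).
Proof. exact: (pcontD (pcontM (@cua k) cbf) (pcontM cu (pcontM cb'f (@cfa k)))). Qed.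

Lemma pcont_energy_rate : pcont energy_rate.
Proof.
have cS : pcont (fun a s t => \sum_(k < n) z s 0 k * ua k a s t).
  exact: (@pcont_sum _ _ _ _ _ (fun k a s t => z s 0 k * ua k a s t) (fun k => pcontM (@cz k) (@cua k))).
exact: (pcontD (pcontM (pcontD (pcontD cut cS) (pcontM ceps cuss)) cbf)
  (pcontN (pcontM ceps (pcontM (pcontM cu cb''f) (pcontM cfs cfs))))).
Qed.

Let cHs : pcont Hs.
Proof.
exact: (pcontD (pcontD (pcontM cus (pcontM cb'f cfs))
   (pcontM cu (pcontD (pcontM (pcontM cb''f cfs) cfs) (pcontM cb'f cfss))))
  (pcontN (pcontD (pcontM cuss cbf) (pcontM cus (pcontM cb'f cfs))))).
Qed.

Let dG a s (t : R) : 0 < t -> is_derive t (1 : R) (fun t => u a s t * b (f a s t)) (Gt a s t).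
Proof.
by move=> t0; exact: (is_derive_mul (dut a s t0) (is_derive_comp_dir (db _) (dft a s t0))).
Qed.

Let dGa k (a : V) s t : 0 < t ->
  is_derive a (delta_mx 0 k) (fun a => u a s t * b (f a s t)) (Ga k a s t).
Proof.
by move=> t0; exact: (is_derive_mul (dua k a s t0) (is_derive_comp_dir (db _) (dfa k a s t0))).
Qed.

Let dH a (s : R) t : 0 < t -> is_derive s (1 : R) (fun s => H a s t) (Hs a s t).
Proof.
move=> t0.
have D1 := is_derive_comp_dir (db' _) (dfs a s t0).
have D2 := is_derive_comp_dir (db _) (dfs a s t0).
exact: (is_derive_sub (is_derive_mul (dus a s t0) (is_derive_mul D1 (dfss a s t0)))
  (is_derive_mul (duss a s t0) D2)).
Qed.

Let H_per a t : 0 < t -> H a l t = H a 0 t.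
Proof.
move=> t0; have E s : f a (s + l) t = f a s t by exact: f_per.
have Es := is_derive_periodic E (fun s => dfs a s t0).
have U := is_derive_periodic (fun s => u_per a s t0) (fun s => dus a s t0).
by rewrite /H -[l]add0r E Es U u_per.
Qed.

(** Multiplying the equation by u b'(f) gives a conservation law: up to
    divergences in a and s, which integrate to zero by compact support in a and
    periodicity in s, only [energy_rate] is left. *)
Lemma energy_identity t : 0 < t < t2 ->
  is_derive t (1 : R) (fun t => phase_integral l r (fun a s => u a s t * b (f a s t)))
    (phase_integral l r (fun a s => energy_rate a s t)).
Proof.
move=> /andP[t0 tt2].
have jc W : pcont W -> jcontinuous (fun a s => W a s t).
  by move=> cW; exact: (pcont_jcontinuous cW t0).
have cG := pcontM cu cbf.
have cSum : pcont (fun a s t => \sum_(k < n) z s 0 k * Ga k a s t).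
  exact: (@pcont_sum _ _ _ _ _ (fun k a s t => z s 0 k * Ga k a s t) (fun k => pcontM (@cz k) (@cGa k))).
have cN : pcont (fun a s t => (-1) * \sum_(k < n) z s 0 k * Ga k a s t).
  exact: (pcontM (@pcont_cst R n (-1)) cSum).
have cE : pcont (fun a s t => eps ^+ 2 / 2 * Hs a s t) by exact: (pcontM ceps cHs).
have Ga0 k : phase_integral l r (fun a s => z s 0 k * Ga k a s t) = 0.
  apply: (@phase_integral_da0 _ n l r k (fun a s => u a s t * b (f a s t))).
  - exact: jc cG.
  - exact: (jc _ (@cGa k)).
  - exact: z_cont.
  - by move=> a s; exact: dGa.
  - by move=> a s ra; apply: supp => //; rewrite t0 tt2.
have Hs0 : phase_integral l r (fun a s => Hs a s t) = 0.
  apply: (@phase_integral_ds0 _ n l r (fun a s => H a s t)).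
  - exact: l_gt0.
  - exact: jc cHs.
  - by move=> a s; exact: dH.
  - by move=> a; exact: H_per.
have sum0 : phase_integral l r (fun a s => \sum_(k < n) z s 0 k * Ga k a s t) = 0.
  rewrite phase_integral_sum; first by rewrite big1.
  by move=> k; exact: (jc _ (pcontM (@cz k) (@cGa k))).
have <- : phase_integral l r (fun a s => Gt a s t) =
    phase_integral l r (fun a s => energy_rate a s t).
  rewrite (_ : (fun a s => Gt a s t) = (fun a s => energy_rate a s t +
    ((-1) * (\sum_(k < n) z s 0 k * Ga k a s t) + eps ^+ 2 / 2 * Hs a s t))); last first.
    by apply/funext => a; apply/funext => s; rewrite GtE// mulN1r.
  rewrite phase_integralD; last 2 first.
  - exact: jc pcont_energy_rate.
  - exact: (jc _ (pcontD cN cE)).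
  rewrite [X in _ + X]phase_integralD; last 2 first.
  - exact: (jc _ cN).
  - exact: (jc _ cE).
  rewrite [X in _ + (X + _)]phase_integralZ; last exact: jc cSum.
  rewrite [X in _ + (_ + X)]phase_integralZ; last exact: jc cHs.
  by rewrite sum0 Hs0 !mulr0 !addr0.
have [C hC] := @pcont_bounded R n Gt r l (t / 2) t2 cGt ltac:(lra).
apply: (@phase_integral_dt _ n l r (fun a s t => u a s t * b (f a s t)) Gt C (t / 2) t2).
- by apply/andP; split; lra.
- by move=> t' /andP[h1 _]; apply: (pcont_jcontinuous cG); lra.
- by move=> a s t' /andP[h1 _]; apply: dG; lra.
- by move=> a s t' ar sl /andP[h1 h2]; apply: hC => //; rewrite !ltW.
Qed.

End energy_identity.
End fokker_planck.

(** * Support, mass and positivity of the solution *)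

Section auxiliary_functions.
Context {R : realType}.

(** A [C^1] function that vanishes exactly on the half-line [x <= 0], used to cut
    off in position. *)
Definition pos_sqr (x : R) : R := Num.max x 0 ^+ 2.

Lemma pos_sqr_ge0 x : 0 <= pos_sqr x.
Proof. exact: sqr_ge0. Qed.

Lemma is_derive_pos_sqr (x : R) : is_derive x (1 : R) pos_sqr (2 * Num.max x 0).
Proof.
have [x0|x0|->] := ltgtP x 0.
- have hn : nbhs x [set y : R | y < 0] by apply: open_nbhs_nbhs; split; [exact: open_lt|exact: x0].
  rewrite mulr0; apply: (@near_eq_is_derive _ _ _ (cst 0)).
  near=> y; rewrite /pos_sqr max_r ?expr0n//; near: y.
  by apply: filterS hn => y /= /ltW.
- have hn : nbhs x [set y : R | 0 < y] by apply: open_nbhs_nbhs; split; [exact: open_gt|exact: x0].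
  have D : is_derive x (1 : R) (fun y : R => y ^+ 2) (2 * x).
    have [D1 D2] := @is_deriveX _ _ (@id R) 2 x 1 1 (is_derive_id x (1 : R)).
    split; first exact: D1.
    by rewrite [LHS]D2 /= expr1 [_ *: _]mulr1.
  have E : \forall y \near x, y ^+ 2 = pos_sqr y.
    by apply: filterS hn => y /= y0; rewrite /pos_sqr max_l// ltW.
  exact: (@near_eq_is_derive _ _ _ (fun y : R => y ^+ 2) pos_sqr x 1 _ E D).
- rewrite mulr0.
  have cv : h^-1 *: ((pos_sqr \o shift 0) (h *: 1) - pos_sqr 0) @[h --> 0^'] --> (0 : R).
    have n0 : `|h| @[h --> (0 : R)^'] --> (0 : R).
      by apply/cvgrPdist_lt => e e0; near=> h; rewrite sub0r normrN normr_id; near: h; exact: dnbhs0_lt.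
    apply: (@squeeze_cvgr _ _ _ _ (fun h : R => - `|h|) (fun h : R => `|h|)).
    + near=> h; rewrite -ler_norml /= addr0 [h *: 1]mulr1 /pos_sqr maxxx expr0n subr0.
      rewrite [_ *: _]/(_ * _) normrM normfV.
      have h0 : h != 0 by near: h; exact: nbhs_dnbhs_neq.
      rewrite ler_pdivrMl ?normr_gt0// normrX -expr2 lerXn2r ?nnegrE//.
      by rewrite /Num.max; case: ifP => // _; rewrite normr0.
    + by have := cvgN n0; rewrite oppr0; exact.
    + exact: n0.
  split; first by apply/cvg_ex; exists 0.
  exact: (cvg_lim _ cv).
Unshelve. all: by end_near. Qed.

(** A smooth convex approximation of the absolute value that vanishes at 0, with
    its first two derivatives. *)
Definition smooth_abs (d x : R) : R := Num.sqrt (d ^+ 2 + x ^+ 2) - d.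
Definition smooth_abs' (d x : R) : R := x / Num.sqrt (d ^+ 2 + x ^+ 2).
Definition smooth_abs'' (d x : R) : R := d ^+ 2 / Num.sqrt (d ^+ 2 + x ^+ 2) ^+ 3.

Section smooth_abs.
Variable d : R.
Hypothesis d0 : 0 < d.

Let q x : 0 < d ^+ 2 + x ^+ 2.
Proof. by rewrite ltr_pwDl ?exprn_gt0// sqr_ge0. Qed.

Let S0 x : 0 < Num.sqrt (d ^+ 2 + x ^+ 2). Proof. by rewrite sqrtr_gt0. Qed.

Let dS (x : R) : is_derive x (1 : R) (fun x => Num.sqrt (d ^+ 2 + x ^+ 2)) (smooth_abs' d x).
Proof.
have D : is_derive x (1 : R) (fun x => d ^+ 2 + x ^+ 2) (2 * x).
  rewrite -[2 * x]add0r; apply: is_derive_add.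
  have [D1 D2] := @is_deriveX _ _ (@id R) 2 x 1 1 (is_derive_id x (1 : R)).
  split; first exact: D1.
  by rewrite [LHS]D2 /= expr1 [_ *: _]mulr1.
have := @is_derive_comp_dir R R x 1 (fun x => d ^+ 2 + x ^+ 2) Num.sqrt _ _ (is_derive1_sqrt (q x)) D.
move=> H; apply: (is_derive_eq H); rewrite /smooth_abs'; field.
by rewrite gt_eqF.
Qed.

Lemma is_derive_smooth_abs (x : R) : is_derive x (1 : R) (smooth_abs d) (smooth_abs' d x).
Proof.
rewrite -[smooth_abs' d x]subr0.
exact: (is_derive_sub (dS x) (is_derive_cst d x (1 : R))).
Qed.

Lemma is_derive_smooth_abs' (x : R) : is_derive x (1 : R) (smooth_abs' d) (smooth_abs'' d x).
Proof.
have DV : is_derive x (1 : R) (fun x => (Num.sqrt (d ^+ 2 + x ^+ 2))^-1)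
    (- (Num.sqrt (d ^+ 2 + x ^+ 2)) ^- 2 * smooth_abs' d x).
  have N0 : Num.sqrt (d ^+ 2 + x ^+ 2) != 0 by rewrite gt_eqF.
  exact: (@is_deriveV _ (fun x => Num.sqrt (d ^+ 2 + x ^+ 2)) x _ 1 N0 (dS x)).
have H := is_derive_mul (is_derive_id x (1 : R)) DV.
apply: (is_derive_eq H); rewrite /smooth_abs'' /smooth_abs' /=.
have E := sqr_sqrtr (ltW (q x)); have := S0 x.
move: E; set S := Num.sqrt _ => E S_gt0.
have -> : d ^+ 2 = S ^+ 2 - x ^+ 2 by rewrite E addrK.
by field; rewrite gt_eqF.
Qed.

Lemma continuous_smooth_abs'' : continuous (smooth_abs'' d).
Proof.
suff H (x : R) : {for x, continuous (smooth_abs'' d)} by move=> x; exact: H.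
have cS : {for x, continuous (fun x : R => Num.sqrt (d ^+ 2 + x ^+ 2))}.
  by apply: differentiable_continuous; apply/derivable1_diffP; have [] := dS x.
have cV : {for x, continuous (fun x : R => (Num.sqrt (d ^+ 2 + x ^+ 2))^-1)}.
  by apply: cvgV; [rewrite gt_eqF|exact: cS].
have -> : smooth_abs'' d = (fun x : R => d ^+ 2 * ((Num.sqrt (d ^+ 2 + x ^+ 2))^-1 *
    ((Num.sqrt (d ^+ 2 + x ^+ 2))^-1 * (Num.sqrt (d ^+ 2 + x ^+ 2))^-1))).
  by apply/funext => y; rewrite /smooth_abs'' -exprVn; congr (_ * _); rewrite !exprS expr0 mulr1.
apply: (@continuousM _ _ (cst (d ^+ 2))); first exact: cst_continuous.
by apply: continuousM => //; apply: continuousM.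
Qed.

Lemma smooth_abs''_ge0 x : 0 <= smooth_abs'' d x.
Proof. by rewrite divr_ge0 ?exprn_ge0 ?sqr_ge0 ?sqrtr_ge0// ltW. Qed.

Lemma smooth_abs0 : smooth_abs d 0 = 0.
Proof. by rewrite /smooth_abs expr0n addr0 sqrtr_sqr gtr0_norm ?subrr. Qed.

Lemma smooth_abs_ge0 x : 0 <= smooth_abs d x.
Proof.
rewrite subr_ge0 -[leLHS]gtr0_norm// -sqrtr_sqr ler_sqrt//.
  by rewrite lerDl sqr_ge0.
exact: ltW.
Qed.

Lemma smooth_abs_gt0 x : x != 0 -> 0 < smooth_abs d x.
Proof.
move=> x0; rewrite subr_gt0 -[ltLHS]gtr0_norm// -sqrtr_sqr ltr_sqrt//.
by rewrite ltrDl exprn_even_gt0.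
Qed.

Lemma smooth_abs_le x : smooth_abs d x <= `|x|.
Proof.
have E : `|x| + d = Num.sqrt ((`|x| + d) ^+ 2) by rewrite sqrtr_sqr [RHS]ger0_norm// addr_ge0// ltW.
rewrite lerBlDr E ler_sqrt ?sqr_ge0//.
rewrite sqrrD -normrX (ger0_norm (sqr_ge0 x)).
have : 0 <= `|x| * d by rewrite mulr_ge0// ltW.
lra.
Qed.

Lemma le_smooth_abs x : `|x| - d <= smooth_abs d x.
Proof.
by rewrite lerD2r -sqrtr_sqr ler_sqrt ?(ltW (q x))// lerDr sqr_ge0.
Qed.

End smooth_abs.
End auxiliary_functions.

Section phase_integral_eq0.
Context {R : realType} (n : nat) (l : R).
Notation leb := (@lebesgue_measure R).
Notation V := 'rV[R]_n.

Let box (a : V) (d : R) : set V := [set v | forall i, a 0 i - d < v 0 i <= a 0 i + d].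

Let mbox a d : measurable (box a d).
Proof.
rewrite (_ : box a d = \bigcap_(i in [set: 'I_n])
    (setT `&` rV_coord i @^-1` `]a 0 i - d, a 0 i + d]%classic)).
  by apply: fin_bigcap_measurable => // i _; exact: measurable_rV_coord.
apply/seteqP; split => v /= H i.
  by move=> _; split => //=; rewrite in_itv/= H.
by have [//|_] := H i; rewrite /= in_itv.
Qed.

(** Where [G] is positive it is positive on a small box inside the phase box, and
    boxes have positive measure. *)
Lemma phase_integral_eq0 r (G : V -> R -> R) a s : jcontinuous G ->
  (forall a s, 0 <= G a s) -> phase_integral l r G = 0 ->
  `|a| < r -> 0 <= s < l -> G a s = 0.
Proof.
move=> cG G0 I0 ar /andP[s0 sl].
have [//|Gas] := eqVneq (G a s) 0; exfalso.
have Gp : 0 < G a s by rewrite lt_neqAle eq_sym Gas G0.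
have iG := phase_integrable l r cG.
have nb : nbhs (a, s) [set p : V * R | 0 < G p.1 p.2].
  exact: (@cvgr_gt _ _ _ _ _ _ (cG (a, s)) _ Gp).
have [e e0 he] : exists2 e : R, 0 < e & ball (a, s) e `<=` [set p : V * R | 0 < G p.1 p.2].
  by have /nbhs_ballP[e e0 he] := nb; exists e.
pose d := Num.min (e / 2) (Num.min ((r - `|a|)) ((l - s)) / 2).
have d0 : 0 < d by rewrite !lt_min divr_gt0//= divr_gt0// lt_min !subr_gt0 ar sl.
have de : d < e.
  have : d <= e / 2 by rewrite ge_min lexx.
  lra.
have dr : d < r - `|a|.
  have : d <= Num.min ((r - `|a|)) ((l - s)) / 2 by rewrite ge_min lexx orbT.
  have : Num.min (r - `|a|) (l - s) <= r - `|a| by rewrite ge_min lexx.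
  lra.
have dl : d < l - s.
  have : d <= Num.min ((r - `|a|)) ((l - s)) / 2 by rewrite ge_min lexx orbT.
  have : Num.min (r - `|a|) (l - s) <= l - s by rewrite ge_min lexx orbT.
  lra.
pose Q : set (V * measurableTypeR R) := box a d `*` `]s, s + d]%classic.
have mI : measurable (`]s, s + d]%classic : set (measurableTypeR R)) by exact: measurable_itv.
have Qbox : Q `<=` phase_box l r.
  move=> [v x] [/= va]; rewrite /= in_itv/= => /andP[x1 x2]; split => /=.
    apply/rV_norm_leP => [|i]; first by rewrite (le_trans (normr_ge0 a))// ltW.
    have /andP[v1 v2] := va i; have := le_coord_norm a i.
    rewrite !ler_norml => /andP[a1 a2]; apply/andP; split; lra.
  by rewrite in_itv/=; apply/andP; split; lra.
have QG p : Q p -> 0 < G p.1 p.2.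
  case: p => v x [/= va]; rewrite /= in_itv/= => /andP[x1 x2].
  apply: (he (v, x)); split => /=.
    rewrite -ball_normE/=; apply/rV_norm_ltP => // i; rewrite !mxE.
    have /andP[v1 v2] := va i; rewrite ltr_norml; apply/andP; split; lra.
  by rewrite /ball/= ltr_norml; apply/andP; split; lra.
have muQ : (0 < (lebesgue_rV n \x leb)%E Q)%E.
  rewrite product_measure1E; [|exact: mbox|exact: mI].
  have bE : box a d = [set v : V | forall i, (\row_i (a 0 i - d)) 0 i < v 0 i <= (\row_i (a 0 i + d)) 0 i].
    by apply/seteqP; split => v /= h i; have := h i; rewrite !mxE.
  have lE : lebesgue_rV n (box a d) = (\prod_i ((\row_i (a 0 i + d)) 0 i - (\row_i (a 0 i - d)) 0 i))%:E.
    by rewrite bE lebesgue_rV_box// => i; rewrite !mxE; lra.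
  rewrite [X in (X * _)%E]lE.
  rewrite [X in (_ * X)%E](lebesgue_measure_itv `]s, (s + d)]) /= lte_fin ltrDl d0 -EFinB -EFinM lte_fin.
  apply: mulr_gt0; last by rewrite addrAC subrr add0r.
  by apply: prodr_gt0 => i _; rewrite !mxE; lra.
have : (\int[phase_measure (n := n)]_(p in phase_box l r) `|(G p.1 p.2)%:E|)%E = 0%E.
  rewrite (eq_integral (fun p : V * measurableTypeR R => (G p.1 p.2)%:E)); last first.
    by move=> p _; rewrite gee0_abs// lee_fin.
  rewrite -[LHS]fineK; last exact: (integrable_fin_num (@measurable_phase_box R n l r) iG).
  by congr EFin; exact: I0.
have mG := measurable_int _ iG.
move/(ae_eq_integral_abs _ (@measurable_phase_box R n l r) mG) => -[N [mN N0 sub]].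
have QN : Q `<=` N.
  move=> p Qp; apply: sub => /= /(_ (Qbox _ Qp)) [] E.
  by have := QG p Qp; rewrite E ltxx.
have : ((lebesgue_rV n \x leb)%E Q <= (lebesgue_rV n \x leb)%E N)%E.
  by apply: le_measure => //; rewrite inE//; exact: measurableX.
by rewrite leNgt [X in (X < _)%E]N0 muQ.
Qed.

End phase_integral_eq0.

Section initial_trace.
Context {R : realType} (n : nat) (l : R).
Notation leb := (@lebesgue_measure R).
Notation V := 'rV[R]_n.
Variables (f0 : V -> R -> R) (f : V -> R -> R -> R).
Hypothesis mf0 : measurable_fun setT (fun p : V * R => f0 p.1 p.2).
Hypothesis cf : continuous_at_positive_times f.
Variable r : R.
Hypothesis trace : (\int[lebesgue_rV n]_(a in [set a | (`|a| <= r)%R])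
  \int[leb]_(s in `[0%R, l]) (`|f a s t - f0 a s|)%:E)%E @[t --> 0^'+] --> 0%E.

(** The initial condition in the form in which it is used: integrals controlled
    by the distance of f to its initial value vanish in the limit. *)
Lemma initial_trace C (g : R -> V * R -> R) : 0 <= C ->
  (forall t, 0 < t -> (phase_measure (n := n)).-integrable (phase_box l r) (EFin \o g t)) ->
  (forall t p, 0 < t -> phase_box l r p -> `|g t p| <= C * `|f p.1 p.2 t - f0 p.1 p.2|) ->
  \int[phase_measure (n := n)]_(p in phase_box l r) g t p @[t --> 0^'+] --> 0.
Proof.
move=> C0 ig gC.
have /(fine_cvgP _)[fin cv] := trace.
set F := (fun t => \int[lebesgue_rV n]_(a in [set a | (`|a| <= r)%R])
  \int[leb]_(s in `[0%R, l]) (`|f a s t - f0 a s|)%:E)%E in fin cv.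
have mI : measurable (`[0, l]%classic : set (measurableTypeR R)) by exact: measurable_itv.
have key t : 0 < t -> F t \is a fin_num ->
    `|\int[phase_measure (n := n)]_(p in phase_box l r) g t p| <= C * fine (F t).
  move=> t0 Ft; rewrite -lee_fin EFin_normr_Rintegral//; last 2 first.
  - exact: measurable_phase_box.
  - exact: ig.
  rewrite EFinM fineK//.
  have mD : measurable_fun (phase_box l r) (fun p : V * measurableTypeR R => (`|f p.1 p.2 t - f0 p.1 p.2|)%:E).
    apply: measurable_funTS; apply/measurable_EFinP; apply: measurableT_comp => //.
    apply: measurable_funB; last exact: mf0.
    exact: (jcontinuous_measurable (pcont_jcontinuous cf t0)).
  have -> : F t = (\int[phase_measure (n := n)]_(p in phase_box l r) (`|f p.1 p.2 t - f0 p.1 p.2|)%:E)%E.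
    rewrite /phase_measure.
    rewrite (@ge0_integral_setX12 _ _ _ _ R (lebesgue_rV n) leb _ _ (@measurable_rV_ball R n r) mI _ mD)//.
  rewrite -ge0_integralZl//; last exact: measurable_phase_box.
  apply: le_trans (le_abse_integral _ _ _) _.
  - exact: measurable_phase_box.
  - by have := measurable_int _ (ig t t0).
  apply: ge0_le_integral.
  - exact: measurable_phase_box.
  - by move=> p _; exact: abse_ge0.
  - by apply: measurableT_comp => //; have := measurable_int _ (ig t t0).
  - by apply: emeasurable_funM => //.
  - by move=> p pb; rewrite -EFinM lee_fin; exact: gC.
apply: norm_cvg0.
apply: (@squeeze_cvgr _ _ _ _ (cst 0) (fun t => C * fine (F t))).
- near=> t; rewrite normr_ge0/=; apply: key; first by near: t; exact: nbhs_right_gt.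
  by near: t.
- exact: cvg_cst.
- by rewrite -[X in _ --> X](mulr0 C); apply: cvgM; [exact: cvg_cst|exact: cv].
Unshelve. all: by end_near. Qed.

End initial_trace.

Section preliminaries.
Context {R : realType}.

(** One representative [s'] serves all [l]-periodic functions at once. *)
Lemma period_reduce (l s : R) : 0 < l -> exists s', 0 <= s' < l /\
  forall g : R -> R, (forall x, g (x + l) = g x) -> g s = g s'.
Proof.
move=> l0; pose m := Num.floor (s / l); exists (s - m%:~R * l); split.
  have /andP[] := floor_itv (s / l).
  rewrite -/m ler_pdivlMr// ltr_pdivrMr// intrD mulrDl mul1r => m1 m2.
  by apply/andP; split; lra.
move=> g gl.
have gn x (k : nat) : g (x + k%:R * l) = g x.
  elim: k => [|k IH]; first by rewrite mul0r addr0.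
  by rewrite -[k.+1%:R]natr1 mulrDl mul1r addrA gl.
case: m => k.
  by rewrite -[in LHS](subrK (k%:R * l) s) gn.
rewrite NegzE mulrNz mulNr opprK; exact/esym/gn.
Qed.

Lemma le_of_derive_le0 (J J' : R -> R) (T : R) :
  (forall t, 0 < t < T -> is_derive t (1 : R) J (J' t)) ->
  (forall t, 0 < t < T -> J' t <= 0) ->
  forall x y, 0 < x -> x <= y -> y < T -> J y <= J x.
Proof.
move=> dJ J0 x y x0 xy yT.
have dJ' u : u \in `[x, y] -> is_derive u (1 : R) J (J' u).
  rewrite in_itv/= => /andP[u1 u2]; apply: dJ; apply/andP; split; lra.
apply: (@ler0_derive1_nincr R J x y) => //.
- by move=> u /subset_itv_oo_cc /dJ' [].
- move=> u uxy; have [_ E] := dJ' u (subset_itv_oo_cc uxy).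
  rewrite derive1E E; apply: J0.
  by move: uxy; rewrite in_itv/= => /andP[u1 u2]; apply/andP; split; lra.
- by apply: derivable_within_continuous => u /dJ' [].
Qed.

Lemma is_derive_sumf (V : normedModType R) (x v : V) (m : nat) (h : 'I_m -> V -> R) (dh : 'I_m -> R) :
  (forall i, is_derive x v (h i) (dh i)) ->
  is_derive x v (fun y => \sum_(i < m) h i y) (\sum_(i < m) dh i).
Proof.
move=> D; have [D1 D2] := is_derive_sum D.
have E : (\sum_(i < m) h i) = (fun y => \sum_(i < m) h i y).
  by apply/funext => y; rewrite fct_sumE.
by rewrite -E; split.
Qed.

Lemma is_derive_coord n (a v : 'rV[R]_n) j : is_derive a v (fun a : 'rV[R]_n => a 0 j) (v 0 j).
Proof.
apply/is_derive_lineP.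
have D : is_derive (0 : R) (1 : R) (fun h : R => h * v 0 j + a 0 j) (1 * v 0 j + 0 * 0 + 0).
  apply: is_derive_add.
  exact: (is_derive_mul (is_derive_id (0 : R) (1 : R)) (is_derive_cst (v 0 j) (0 : R) (1 : R))).
rewrite mul1r mulr0 !addr0 in D.
by rewrite (_ : (fun h : R => _) = (fun h : R => h * v 0 j + a 0 j))//; apply/funext => h; rewrite !mxE.
Qed.

Lemma is_derive_continuous (g g' : R -> R) : (forall x, is_derive x (1 : R) g (g' x)) -> continuous g.
Proof.
by move=> dg x; apply: differentiable_continuous; apply/derivable1_diffP; have [] := dg x.
Qed.

Lemma is_derive_fsqr (V : normedModType R) (x v : V) (g : V -> R) (d : R) :
  is_derive x v g d -> is_derive x v (fun y => g y ^+ 2) (2 * g x * d).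
Proof.
move=> D; have := is_derive_mul D D.
rewrite (_ : d * g x + g x * d = 2 * g x * d); last by ring.
by [].
Qed.

End preliminaries.

Section conservation.
Context {R : realType} (n : nat) (eps l M : R) (z : R -> 'rV[R]_n).
Notation V := 'rV[R]_n.
Notation leb := (@lebesgue_measure R).
Notation pcont := (@continuous_at_positive_times R n).
Notation PI := (phase_integral l).
Variables (f0 : V -> R -> R) (f : V -> R -> R -> R).
Hypothesis l_gt0 : 0 < l.
Hypothesis z_cont : forall k, continuous (fun s => z s 0 k).
Hypothesis M_gt0 : 0 < M.
Hypothesis zM : forall s, \sum_(k < n) `|z s 0 k| <= M.
Hypothesis f_sol : fokker_planck_solution eps l z f0 f.
Hypothesis mf0 : measurable_fun setT (fun p : V * R => f0 p.1 p.2).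

Let f_per : forall a s t, 0 < t -> f a (s + l) t = f a s t. Proof. by case: f_sol. Qed.
Let f_reg : regular_at_positive_times f. Proof. by case: f_sol. Qed.
Let f_eq : forall a s t, 0 < t ->
  d_t f a s t + \sum_(k < n) z s 0 k * d_a k f a s t = eps ^+ 2 / 2 * d_s (d_s f) a s t.
Proof. by case: f_sol. Qed.
Let cf : pcont f. Proof. by case: f_reg => _ [c _ _ _ _]; exact: c. Qed.
Let trace r : (\int[lebesgue_rV n]_(a in [set a | (`|a| <= r)%R])
  \int[leb]_(s in `[0%R, l]) (`|f a s t - f0 a s|)%:E)%E @[t --> 0^'+] --> 0%E.
Proof. by case: f_sol. Qed.

Let c0 := @pcont_cst R n 0.
Let d0 (V' : normedModType R) (x v : V') := is_derive_cst (0 : R) x v.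

Section support.
Variables (c : V) (r : R).
Hypothesis f0_eq0 : forall a s, `|a - c| < r -> f0 a s = 0.

Let S (a : V) : R := \sum_(k < n) (a 0 k - c 0 k) ^+ 2.
Let rho (t : R) : R := (r - M * t) ^+ 2.
(** The squared Euclidean distance is used because it is smooth; the Euclidean ball
    of radius [r - M t] lies in the ball of the sup norm of the same radius. *)
Let w (a : V) (s t : R) : R := pos_sqr (rho t - S a).
Let wt (a : V) (s t : R) : R := 2 * Num.max (rho t - S a) 0 * (2 * (r - M * t) * (0 - (0 * t + M * 1)) - 0).
Let wa k (a : V) (s t : R) : R :=
  2 * Num.max (rho t - S a) 0 * (0 - \sum_(j < n) 2 * (a 0 j - c 0 j) * ((delta_mx 0 k : V) 0 j - 0)).

Let cSa : pcont (fun a _ _ => S a).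
Proof.
apply: (@pcont_sum _ _ _ _ _ (fun k a _ _ => (a 0 k - c 0 k) ^+ 2)) => k.
have cc : pcont (fun a _ _ => a 0 k - c 0 k).
  by apply: (pcontD (pcont_a _) (@pcont_cst R n (- c 0 k))); exact: coord_continuous.
have csq : continuous (fun x : R => x ^+ 2).
  exact: is_derive_continuous (fun x : R => is_derive_fsqr (is_derive_id x (1 : R))).
exact: (pcont_comp csq cc).
Qed.

Let drho (t : R) : is_derive t (1 : R) rho (2 * (r - M * t) * (0 - (0 * t + M * 1))).
Proof.
exact: (is_derive_fsqr (is_derive_sub (is_derive_cst r t (1 : R))
  (is_derive_mul (is_derive_cst M t (1 : R)) (is_derive_id t (1 : R))))).
Qed.

Let crho : pcont (fun _ _ t => rho t).
Proof. exact: pcont_t (is_derive_continuous drho). Qed.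

Let cpos : continuous (@pos_sqr R). Proof. exact: is_derive_continuous (@is_derive_pos_sqr R). Qed.

Let cmax : continuous (fun x : R => 2 * Num.max x 0).
Proof.
suff H (x : R) : {for x, continuous (fun x : R => 2 * Num.max x 0)} by move=> x; exact: H.
apply: (@continuousM _ _ (cst 2)); first exact: cst_continuous.
by apply: continuous_max; [exact: cvg_id|exact: cst_continuous].
Qed.

Let cdiff : pcont (fun a _ t => rho t - S a).
Proof. exact: pcontD crho (pcontN cSa). Qed.

Let cw : pcont w. Proof. exact: pcont_comp cpos cdiff. Qed.

Let cwt : pcont wt.
Proof.
apply: (pcontM (pcont_comp cmax cdiff)).
have cl : pcont (fun _ _ t => r - M * t).
  by apply: (@pcont_t _ _ (fun t => r - M * t)); apply: is_derive_continuous => t;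
     exact: (is_derive_sub (is_derive_cst r t (1 : R))
       (is_derive_mul (is_derive_cst M t (1 : R)) (is_derive_id t (1 : R)))).
have cl2 : pcont (fun _ _ t => 0 - (0 * t + M * 1)).
  apply: (@pcont_t _ _ (fun t => 0 - (0 * t + M * 1))).
  rewrite (_ : (fun _ => _) = cst (- M)); first exact: cst_continuous.
  by apply/funext => t; rewrite mul0r mulr1 !add0r.
exact: (pcontD (pcontM (pcontM (@pcont_cst R n 2) cl) cl2) (@pcont_cst R n (- 0))).
Qed.

Let cwa k : pcont (wa k).
Proof.
apply: (pcontM (pcont_comp cmax cdiff)).
apply: (pcontD c0 (pcontN _)).
apply: (@pcont_sum _ _ _ _ _ (fun j a _ _ => 2 * (a 0 j - c 0 j) * ((delta_mx 0 k : V) 0 j - 0))) => j.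
apply: (@pcont_a _ _ (fun a => 2 * (a 0 j - c 0 j) * ((delta_mx 0 k : V) 0 j - 0))).
suff H (a : V) : {for a, continuous (fun a : V => 2 * (a 0 j - c 0 j) * ((delta_mx 0 k : V) 0 j - 0))} by move=> a; exact: H.
apply: (@continuousM _ _ (fun a : V => 2 * (a 0 j - c 0 j)) (cst ((delta_mx 0 k : V) 0 j - 0))); last exact: cst_continuous.
apply: (@continuousM _ _ (cst 2)); first exact: cst_continuous.
apply: (@continuousB _ _ _ _ (cst (c 0 j))); last exact: cst_continuous.
exact: coord_continuous.
Qed.

Let dwt (a : V) s (t : R) : 0 < t -> is_derive t (1 : R) (w a s) (wt a s t).
Proof.
move=> _; exact: (is_derive_comp_dir (is_derive_pos_sqr _)
  (is_derive_sub (drho t) (is_derive_cst (S a) t (1 : R)))).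
Qed.

Let dwa k (a : V) s t : 0 < t -> is_derive a (delta_mx 0 k) (fun a => w a s t) (wa k a s t).
Proof.
move=> _.
have dS : is_derive a (delta_mx 0 k) S (\sum_(j < n) 2 * (a 0 j - c 0 j) * ((delta_mx 0 k : V) 0 j - 0)).
  apply: is_derive_sumf => j.
  exact: (is_derive_fsqr (is_derive_sub (is_derive_coord a (delta_mx 0 k) j)
    (is_derive_cst (c 0 j) a (delta_mx 0 k)))).
exact: (is_derive_comp_dir (is_derive_pos_sqr _)
  (is_derive_sub (is_derive_cst (rho t) a (delta_mx 0 k)) dS)).
Qed.

Let w0_out (a : V) s t : 0 <= r - M * t <= `|a - c| -> w a s t = 0.
Proof.
move=> /andP[rt ra]; rewrite /w /pos_sqr max_r ?expr0n// subr_le0 /rho.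
have [E|[k E]] : `|a - c| = 0 \/ exists k, `|a - c| = `|a 0 k - c 0 k|.
  have [->|N0] := eqVneq `|a - c| 0; [by left|right].
  have [[i k] /= E] := mx_norm_neq0 N0; exists k.
  by rewrite [LHS]E !mxE ord1.
  rewrite E in ra; have -> : r - M * t = 0 by apply/eqP; rewrite eq_le ra rt.
  by rewrite expr0n; apply: sumr_ge0 => k _; exact: sqr_ge0.
apply: (@le_trans _ _ ((a 0 k - c 0 k) ^+ 2)).
  by rewrite -[leRHS]real_normK ?num_real// -E lerXn2r// nnegrE.
by rewrite /S (bigD1 k)//= lerDl; apply: sumr_ge0 => j _; exact: sqr_ge0.
Qed.

Let w_ge0 a s t : 0 <= w a s t. Proof. exact: pos_sqr_ge0. Qed.

(** The ball shrinks at speed [M], which bounds the speed of the particles, so that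
    along a trajectory the weight cannot grow. *)
Let drift_le0 a s t : 0 <= r - M * t -> wt a s t + \sum_(k < n) z s 0 k * wa k a s t <= 0.
Proof.
move=> rt.
have -> : \sum_(k < n) z s 0 k * wa k a s t =
  2 * Num.max (rho t - S a) 0 * (- 2 * \sum_(k < n) z s 0 k * (a 0 k - c 0 k)).
  rewrite mulr_sumr mulr_sumr; apply: eq_bigr => k _; rewrite /wa.
  rewrite (bigD1 k)//= !mxE !eqxx /= big1 ?addr0; first by ring.
  by move=> j jk; rewrite !mxE (negPf jk) andbF subr0 mulr0.
rewrite /wt -mulrDr.
have [h|h] := leP (rho t - S a) 0; first by rewrite mulr0 mul0r.
apply: mulr_ge0_le0; first by rewrite mulr_ge0// ltW.
have hk k : `|a 0 k - c 0 k| <= r - M * t.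
  rewrite -[leRHS]ger0_norm// -ler_sqr ?nnegrE// !real_normK ?num_real//.
  apply: le_trans (ltW (_ : S a < rho t)); last by rewrite -subr_gt0.
  by rewrite /S (bigD1 k)//= lerDl; apply: sumr_ge0 => j _; exact: sqr_ge0.
have : - \sum_(k < n) z s 0 k * (a 0 k - c 0 k) <= M * (r - M * t).
  apply: (@le_trans _ _ (\sum_(k < n) `|z s 0 k| * (r - M * t))).
    rewrite -sumrN; apply: ler_sum => k _.
    rewrite (le_trans (ler_norm _))// normrN normrM; apply: ler_wpM2l => //.
  by rewrite -mulr_suml ler_wpM2r.
lra.
Qed.

(** Mass travels in position at speed at most M: a smooth weight supported in
    the shrinking ball of radius r - M t about c decreases along the flow. *)
Lemma domain_of_dependence t : 0 < t -> M * t < r -> forall s, f c s t = 0.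
Proof.
move=> t0 tr.
pose T := r / M.
have tT : t < T by rewrite ltr_pdivlMr// mulrC.
have inT x : x < T -> 0 < r - M * x by rewrite ltr_pdivlMr// mulrC subr_gt0.
pose b := smooth_abs (1 : R); pose R0 := `|c| + r.
have supp a s x : R0 < `|a| -> 0 < x < T -> w a s x * b (f a s x) = 0.
  move=> Ra /andP[x0 xT]; rewrite w0_out ?mul0r// ltW ?inT//=.
  have : `|a| <= `|a - c| + `|c| by rewrite -{1}(subrK c a) ler_normD.
  rewrite /R0 in Ra; have := mulr_gt0 M_gt0 x0; lra.
have jG : pcont (fun a s x => w a s x * b (f a s x)).
  exact: pcontM cw (pcont_comp (is_derive_continuous (is_derive_smooth_abs ltr01)) cf).
pose rate := energy_rate eps z f w wt (fun _ _ _ => 0) wa b (smooth_abs'' 1).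
have EI x : 0 < x < T -> is_derive x (1 : R) (fun x => PI R0 (fun a s => w a s x * b (f a s x)))
    (PI R0 (fun a s => rate a s x)).
  apply: (energy_identity l_gt0 z_cont f_per f_reg f_eq cw cwt c0 c0 cwa dwt dwa
    _ (fun _ _ _ _ => d0 _ _) (fun _ _ _ _ => erefl) (is_derive_smooth_abs ltr01)
    (is_derive_smooth_abs' ltr01) (continuous_smooth_abs'' ltr01) supp).
  by move=> a s x' _; exact: is_derive_cst.
have jrate : pcont rate.
  exact: (pcont_energy_rate (eps := eps) z_cont f_reg cw cwt c0 cwa (is_derive_smooth_abs ltr01) (continuous_smooth_abs'' ltr01)).
have rate_le0 x : 0 < x < T -> PI R0 (fun a s => rate a s x) <= 0.
  move=> /andP[x0 xT]; rewrite -[leRHS](_ : PI R0 (fun (_ : V) (_ : R) => 0) = 0); last first.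
    by rewrite /phase_integral /Rintegral integral0.
  apply: le_phase_integral.
  - exact: (pcont_jcontinuous jrate x0).
  - exact: cst_continuous.
  move=> a s _ _; rewrite /rate /energy_rate mulr0 addr0 subr_le0.
  apply: (@le_trans _ _ 0).
    apply: mulr_le0_ge0; last exact: smooth_abs_ge0.
    by apply: drift_le0; rewrite ltW// inT.
  apply: mulr_ge0; first by rewrite divr_ge0// sqr_ge0.
  apply: mulr_ge0; last by rewrite -expr2 sqr_ge0.
  by rewrite mulr_ge0// smooth_abs''_ge0.
have mono := le_of_derive_le0 EI rate_le0.
have J_ge0 x : 0 < x -> 0 <= PI R0 (fun a s => w a s x * b (f a s x)).
  by move=> x0; apply: Rintegral_ge0 => p _; rewrite mulr_ge0 ?w_ge0 ?smooth_abs_ge0.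
have w_le a s x : 0 < x < T -> w a s x <= r ^+ 4.
  move=> /andP[x0 xT]; have rM := inT _ xT.
  have rr : r - M * x <= r by have := mulr_gt0 M_gt0 x0; lra.
  have rhor : rho x <= r ^+ 2 by rewrite /rho lerXn2r// nnegrE ltW// (lt_le_trans rM).
  have S0 : 0 <= S a by apply: sumr_ge0 => k _; exact: sqr_ge0.
  rewrite /w /pos_sqr (_ : r ^+ 4 = (r ^+ 2) ^+ 2); last by rewrite -exprM.
  rewrite lerXn2r ?nnegrE ?sqr_ge0 ?le_max ?lexx ?orbT//.
  by rewrite ge_max sqr_ge0 andbT; lra.
have T0 : 0 < T by exact: lt_trans tT.
have r0 : 0 < r by rewrite (lt_trans _ tr)// mulr_gt0.
pose g x := if x < T then (fun p : V * R => w p.1 p.2 x * b (f p.1 p.2 x)) else (fun=> 0).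
have J_cvg : \int[phase_measure (n := n)]_(p in phase_box l R0) g x p @[x --> 0^'+] --> 0.
  apply: (initial_trace mf0 cf (@trace R0) (C := r ^+ 4)).
  - by rewrite exprn_ge0// ltW.
  - move=> x x0; rewrite /g; case: ifP => _.
      exact: (phase_integrable l R0 (pcont_jcontinuous jG x0)).
    by apply: (@phase_integrable R n l R0 (fun _ _ => 0)); exact: cst_continuous.
  - move=> x [a s] x0 _; rewrite /g; case: ifPn => xT /=; last first.
      by rewrite normr0 mulr_ge0// exprn_ge0// ltW.
    have [ar|ar] := leP r `|a - c|.
      rewrite w0_out ?mul0r ?normr0 ?mulr_ge0 ?exprn_ge0 ?(ltW r0)//.
      rewrite (ltW (inT _ xT))/= (le_trans _ ar)//.
      by have := mulr_gt0 M_gt0 x0; lra.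
    rewrite (f0_eq0 s ar) subr0 normrM ger0_norm ?w_ge0// ger0_norm ?smooth_abs_ge0//.
    apply: ler_pM; rewrite ?w_ge0 ?smooth_abs_ge0 ?smooth_abs_le//.
    by apply: w_le; rewrite x0.
(* The energy tends to 0 at the initial time and does not increase. *)
have Jt0 : PI R0 (fun a s => w a s t * b (f a s t)) = 0.
  apply/eqP; rewrite eq_le J_ge0// andbT.
  apply: (cvgr_to_ge J_cvg).
  near=> x.
  have x0 : 0 < x by near: x; exact: nbhs_right_gt.
  have xt : x < t by near: x; exact: nbhs_right_lt.
  rewrite /g (lt_trans xt tT); apply: (mono x t) => //; exact: ltW.
move=> s; have [s' [s'l s's]] := period_reduce s l_gt0.
rewrite (s's (f c ^~ t)); last by move=> x; exact: f_per.
have : w c s' t * b (f c s' t) = 0.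
  apply: (phase_integral_eq0 (pcont_jcontinuous jG t0) _ Jt0 _ s'l).
    by move=> a x; rewrite mulr_ge0 ?w_ge0 ?smooth_abs_ge0.
  by rewrite /R0 ltrDl.
move/eqP; rewrite mulf_eq0 => /orP[|].
  rewrite /w /pos_sqr (_ : S c = 0); last first.
    by rewrite /S big1// => k _; rewrite subrr expr0n.
  rewrite subr0 max_l ?sqr_ge0// -exprM expf_eq0/=.
  by rewrite gt_eqF// inT.
by apply: contraTeq => /(smooth_abs_gt0 ltr01); rewrite lt_neqAle eq_sym => /andP[].
Unshelve. all: by end_near. Qed.

End support.

Variable R0 : R.
Hypothesis f0_supp : forall a s, R0 < `|a| -> f0 a s = 0.
Hypothesis f0_ge0 : forall a s, 0 <= f0 a s.
Hypothesis f0_mass :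
  (\int[lebesgue_rV n]_a \int[leb]_(s in `[0%R, l]) (f0 a s)%:E = 1)%E.

Lemma solution_support a s t : 0 < t -> R0 + M * t < `|a| -> f a s t = 0.
Proof.
move=> t0 ta; apply: (@domain_of_dependence a (`|a| - R0)) => //; last by rewrite ltrBrDl.
move=> a' s' aa'; apply: f0_supp.
have : `|a| <= `|a' - a| + `|a'|.
  by rewrite distrC -{1}(subrK a' a) ler_normD.
lra.
Qed.

Section mass.
Variables (r t : R).
Hypotheses (t0 : 0 < t) (tr : R0 + M * t < r).

Let T := (r - R0) / M.
Let tT : t < T. Proof. by rewrite ltr_pdivlMr// mulrC ltrBrDl. Qed.
Let T0 : 0 < T. Proof. exact: lt_trans tT. Qed.

Let f_out a s x : r < `|a| -> 0 < x < T -> f a s x = 0.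
Proof.
move=> ra /andP[x0]; rewrite ltr_pdivlMr// mulrC ltrBrDl => xT.
by apply: solution_support => //; exact: lt_trans ra.
Qed.

Let mf0' : measurable_fun (phase_box l r) (fun p : V * measurableTypeR R => (f0 p.1 p.2)%:E).
Proof. by apply: measurable_funTS; apply/measurable_EFinP; exact: mf0. Qed.

Let I0 : (\int[phase_measure (n := n)]_(p in phase_box l r) (f0 p.1 p.2)%:E = 1)%E.
Proof.
have mI : measurable (`[0, l]%classic : set (measurableTypeR R)) by exact: measurable_itv.
rewrite (@ge0_integral_setX12 _ _ _ _ R (lebesgue_rV n) leb _ _ (@measurable_rV_ball R n r) mI _ mf0'); last first.
  by move=> p; rewrite lee_fin.
rewrite -f0_mass integral_mkcond; apply: eq_integral => a _.
rewrite patchE; case: ifPn => // /negP; rewrite inE/= => /negP; rewrite -ltNge => ra.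
apply/esym; apply: integral0_eq => s _; rewrite f0_supp//.
by apply: lt_trans ra; apply: le_lt_trans tr; rewrite lerDl mulr_ge0// ltW.
Qed.

Let if0 : (phase_measure (n := n)).-integrable (phase_box l r) (fun p => (f0 p.1 p.2)%:E).
Proof.
apply/integrableP; split; first exact: mf0'.
rewrite (eq_integral (fun p : V * measurableTypeR R => (f0 p.1 p.2)%:E)) ?I0 ?ltry//.
by move=> p _; rewrite gee0_abs// lee_fin.
Qed.

Let RI0 : \int[phase_measure (n := n)]_(p in phase_box l r) f0 p.1 p.2 = 1.
Proof. by rewrite /Rintegral I0. Qed.

Let one : V -> R -> R -> R := fun _ _ _ => 1.
Let c1 : pcont one. Proof. exact: pcont_cst. Qed.

Let rate_one b'' a s x b : energy_rate eps z f one (fun _ _ _ => 0) (fun _ _ _ => 0)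
    (fun _ _ _ _ => 0) b b'' a s x =
  - (eps ^+ 2 / 2 * (b'' (f a s x) * (d_s f a s x * d_s f a s x))).
Proof.
rewrite /energy_rate /one big1 ?mulr0 ?addr0 ?mul0r ?add0r => [|k _]; last by rewrite mulr0.
by rewrite mul1r.
Qed.

Let PI_le0 (G : V -> R -> R) : (forall a s, G a s <= 0) -> PI r G <= 0.
Proof.
move=> G0; rewrite /phase_integral /Rintegral fine_le0// integralE integral0_eq => [|p _].
  by rewrite sub0e oppe_le0 integral_ge0.
by rewrite funeposE; apply: max_r; rewrite lee_fin.
Qed.

(** For convex [b] the dissipation makes the integral of [b(f)] decrease in time. *)
Let convex_decay (b b' b'' : R -> R) : (forall x, is_derive x (1 : R) b (b' x)) ->
  (forall x, is_derive x (1 : R) b' (b'' x)) -> continuous b'' -> b 0 = 0 ->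
  (forall x, 0 <= b'' x) -> forall x y, 0 < x -> x <= y -> y < T ->
  PI r (fun a s => b (f a s y)) <= PI r (fun a s => b (f a s x)).
Proof.
move=> db db' cb'' b0 b''0.
have supp a s x : r < `|a| -> 0 < x < T -> one a s x * b (f a s x) = 0.
  by move=> ra xT; rewrite f_out// b0 mulr0.
have EI x (xT : 0 < x < T) := energy_identity l_gt0 z_cont f_per f_reg f_eq c1 c0 c0 c0 (fun=> c0)
  (fun a s t _ => is_derive_cst (1 : R) t (1 : R)) (fun k a s t _ => is_derive_cst (1 : R) a (delta_mx 0 k))
  (fun a s t _ => is_derive_cst (1 : R) s (1 : R)) (fun a s t _ => d0 s (1 : R)) (fun _ _ _ _ => erefl)
  db db' cb'' supp xT.
have Eone x : PI r (fun a s => one a s x * b (f a s x)) = PI r (fun a s => b (f a s x)).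
  by congr phase_integral; apply/funext => a; apply/funext => s; rewrite /one mul1r.
move=> x y x0 xy yT; rewrite -!Eone.
apply: (le_of_derive_le0 EI _ x0 xy yT) => u _; apply: PI_le0 => a s.
rewrite [leLHS]rate_one oppr_le0 mulr_ge0 ?divr_ge0 ?sqr_ge0//.
by rewrite mulr_ge0// -expr2 sqr_ge0.
Qed.

(** Both [x] and [- x] are convex, so the mass is constant, and the initial trace
    gives its value. *)
Lemma solution_mass : PI r (fun a s => f a s t) = 1.
Proof.
have le x y : 0 < x -> x <= y -> y < T -> PI r (fun a s => f a s y) <= PI r (fun a s => f a s x).
  apply: (convex_decay (fun x => is_derive_id x (1 : R)) (fun x => is_derive_cst (1 : R) x (1 : R))) => //.
  exact: cst_continuous.
have ge x y : 0 < x -> x <= y -> y < T -> PI r (fun a s => f a s x) <= PI r (fun a s => f a s y).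
  move=> x0 xy yT; rewrite -lerN2.
  have EN u : 0 < u -> - PI r (fun a s => f a s u) = PI r (fun a s => 0 - f a s u).
    move=> u0; rewrite -mulN1r -phase_integralZ; last exact: (pcont_jcontinuous cf u0).
    by congr phase_integral; apply/funext => a; apply/funext => s; rewrite mulN1r sub0r.
  rewrite !EN//; last exact: lt_le_trans xy.
  apply: (convex_decay (b := fun x => 0 - x) (b' := fun=> 0 - 1) (b'' := fun=> 0)) => //.
  - exact: cst_continuous.
  - by rewrite subrr.
have J_cvg : \int[phase_measure (n := n)]_(p in phase_box l r) (f p.1 p.2 x - f0 p.1 p.2) @[x --> 0^'+] --> 0.
  apply: (initial_trace mf0 cf (@trace r) ler01).
  - move=> x x0.
    rewrite (_ : _ \o _ = (fun p => (f p.1 p.2 x)%:E) \- (fun p => (f0 p.1 p.2)%:E))%E//.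
    apply: integrableB => //; first exact: measurable_phase_box.
    exact: (phase_integrable l r (pcont_jcontinuous cf x0)).
  - by move=> x p x0 _; rewrite mul1r.
apply/eqP; rewrite -subr_eq0; apply/eqP.
have near_eq : \forall x \near 0^'+,
    \int[phase_measure (n := n)]_(p in phase_box l r) (f p.1 p.2 x - f0 p.1 p.2) =
    PI r (fun a s => f a s t) - 1.
  near=> x.
  have x0 : 0 < x by near: x; exact: nbhs_right_gt.
  have xt : x <= t by apply: ltW; near: x; exact: nbhs_right_lt.
  rewrite RintegralB.
  - rewrite RI0; congr (_ - _); apply/eqP; rewrite eq_le; apply/andP; split.
      exact: ge.
    exact: le.
  - exact: measurable_phase_box.
  - exact: (phase_integrable l r (pcont_jcontinuous cf x0)).
  - exact: if0.
apply/eqP; rewrite eq_le; apply/andP; split.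
  apply: (cvgr_to_ge J_cvg); near=> x; rewrite le_eqVlt; apply/orP; left; apply/eqP; apply/esym.
  by near: x.
apply: (cvgr_to_le J_cvg); near=> x; rewrite le_eqVlt; apply/orP; left; apply/eqP.
by near: x.
Unshelve. all: by end_near. Qed.

(** Convex decay for smooth approximations of the absolute value: the L^1 norm does
    not exceed its initial value, the mass. *)
Let abs_le1 : PI r (fun a s => `|f a s t|) <= 1.
Proof.
have cabs : pcont (fun a s x => `|f a s x|) by exact: (pcont_comp (@norm_continuous _ R) cf).
have cone : jcontinuous (fun (_ : V) (_ : R) => 1 : R) by exact: cst_continuous.
have vol_ge0 : 0 <= PI r (fun (_ : V) (_ : R) => 1) by apply: Rintegral_ge0.
have J_cvg : \int[phase_measure (n := n)]_(p in phase_box l r) (`|f p.1 p.2 x| - f0 p.1 p.2) @[x --> 0^'+] --> 0.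
  apply: (initial_trace mf0 cf (@trace r) ler01).
  - move=> x x0.
    rewrite (_ : _ \o _ = (fun p => (`|f p.1 p.2 x|)%:E) \- (fun p => (f0 p.1 p.2)%:E))%E//.
    apply: integrableB => //; first exact: measurable_phase_box.
    exact: (phase_integrable l r (pcont_jcontinuous cabs x0)).
  - move=> x p x0 _; rewrite mul1r -{1}[f0 _ _]ger0_norm//.
    exact: ler_dist_dist.
apply/ler_addgt0Pr => e e0.
(* The approximation errs by at most [d], which costs [d] times the volume. *)
pose d := e / (PI r (fun (_ : V) (_ : R) => 1) + 1).
have d_gt0 : 0 < d by rewrite divr_gt0// ltr_pwDr.
have cb : pcont (fun a s x => smooth_abs d (f a s x)).
  exact: pcont_comp (is_derive_continuous (is_derive_smooth_abs d_gt0)) cf.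
have decay := convex_decay (is_derive_smooth_abs d_gt0) (is_derive_smooth_abs' d_gt0)
  (continuous_smooth_abs'' d_gt0) (smooth_abs0 d_gt0) (smooth_abs''_ge0 d_gt0).
have J_le1 : PI r (fun a s => smooth_abs d (f a s t)) <= 1.
  rewrite -subr_le0; apply: (cvgr_to_ge J_cvg); near=> x.
  have x0 : 0 < x by near: x; exact: nbhs_right_gt.
  have xt : x <= t by apply: ltW; near: x; exact: nbhs_right_lt.
  rewrite RintegralB; last 3 first.
  - exact: measurable_phase_box.
  - exact: (phase_integrable l r (pcont_jcontinuous cabs x0)).
  - exact: if0.
  rewrite RI0 lerD2r (le_trans (decay x t x0 xt tT))//.
  apply: (@le_phase_integral _ n l r (fun a s => smooth_abs d (f a s x)) (fun a s => `|f a s x|)).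
  - exact: (pcont_jcontinuous cb x0).
  - exact: (pcont_jcontinuous cabs x0).
  - by move=> a s _ _; exact: smooth_abs_le.
apply: (@le_trans _ _ (PI r (fun a s => smooth_abs d (f a s t) + d * 1))).
  apply: le_phase_integral.
  - exact: (pcont_jcontinuous cabs t0).
  - have cbd : pcont (fun a s x => smooth_abs d (f a s x) + d * 1).
      by apply: pcontD cb _; exact: pcont_cst.
    exact: (pcont_jcontinuous cbd t0).
  - by move=> a s _ _; rewrite mulr1 -lerBlDr; exact: le_smooth_abs.
rewrite phase_integralD; last 2 first.
- exact: (pcont_jcontinuous cb t0).
- exact: cst_continuous.
rewrite lerD// phase_integralZ// /d mulrAC ler_pdivrMr ?ltr_pwDr//.
by rewrite ler_wpM2l ?lerDl// ltW.
Unshelve. all: by end_near. Qed.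

(** The function [|f| - f] is nonnegative and its integral is at most [1 - 1]. *)
Lemma solution_ge0_in a s : `|a| < r -> 0 <= s < l -> 0 <= f a s t.
Proof.
move=> ar sl.
have cabs : pcont (fun a s x => `|f a s x|) by exact: (pcont_comp (@norm_continuous _ R) cf).
have cN : pcont (fun a s x => `|f a s x| - f a s x) by exact: (pcontD cabs (pcontN cf)).
have ge0 a' s' : 0 <= `|f a' s' t| - f a' s' t by rewrite subr_ge0 ler_norm.
have I_eq0 : PI r (fun a s => `|f a s t| - f a s t) = 0.
  apply/eqP; rewrite eq_le; apply/andP; split; last by apply: Rintegral_ge0.
  rewrite /phase_integral RintegralB; last 3 first.
  - exact: measurable_phase_box.
  - exact: (phase_integrable l r (pcont_jcontinuous cabs t0)).
  - exact: (phase_integrable l r (pcont_jcontinuous cf t0)).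
  rewrite -/(phase_integral l r (fun a s => `|f a s t|)) -/(phase_integral l r (fun a s => f a s t)).
  by rewrite solution_mass subr_le0 abs_le1.
have /eqP := phase_integral_eq0 (pcont_jcontinuous cN t0) ge0 I_eq0 ar sl.
by rewrite subr_eq0 => /eqP <-.
Qed.

End mass.

Lemma solution_ge0 a s t : 0 < t -> 0 <= f a s t.
Proof.
move=> t0; have [s' [s'l s's]] := period_reduce s l_gt0.
rewrite (s's (f a ^~ t)); last by move=> x; exact: f_per.
apply: (@solution_ge0_in (Num.max `|a| (R0 + M * t) + 1)) => //.
- by rewrite ltr_pwDr// le_max lexx orbT.
- by rewrite ltr_pwDr// le_max lexx.
Qed.

End conservation.

(** * Gaussian integrals *)

Lemma integrable_mulr (R : realType) d (T : measurableType d) (m : {measure set T -> \bar R})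
    (D : set T) (mD : measurable D) (k : R) (g : T -> R) :
  m.-integrable D (EFin \o g) -> m.-integrable D (EFin \o (fun x => k * g x)).
Proof.
move=> ig; rewrite (_ : _ \o _ = (fun x => k%:E * (EFin \o g) x)%E)//.
exact: integrableZl.
Qed.

Section gaussian_line.
Context {R : realType}.
Notation leb := (@lebesgue_measure R).

Definition gaus (p x : R) : R := expR (- (p * x ^+ 2)).

Lemma gaus_gt0 p x : 0 < gaus p x. Proof. exact: expR_gt0. Qed.

Lemma is_derive_gaus (p x : R) : is_derive x (1 : R) (gaus p) (- (2 * p * x) * gaus p x).
Proof.
have D : is_derive x (1 : R) (fun x : R => 0 - p * x ^+ 2) (0 - (0 * x ^+ 2 + p * (2 * x * 1))).
  exact: (is_derive_sub (is_derive_cst (0 : R) x (1 : R)) (is_derive_mul (is_derive_cst p x (1 : R))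
    (is_derive_fsqr (is_derive_id x (1 : R))))).
have D' := @is_derive_comp_dir R R x 1 (fun x : R => 0 - p * x ^+ 2) expR _ _ (is_derive_expR _) D.
have -> : gaus p = (fun x => expR (0 - p * x ^+ 2)) by apply/funext => y; rewrite sub0r.
by apply: (is_derive_eq D'); ring.
Qed.

Lemma continuous_gaus p : continuous (gaus p).
Proof. exact: is_derive_continuous (is_derive_gaus p). Qed.

Lemma measurable_gaus p : measurable_fun [set: measurableTypeR R] (gaus p).
Proof. exact: continuous_measurable_fun (@continuous_gaus p). Qed.

Lemma integral_gaus p : 0 < p -> (\int[leb]_x (gaus p x)%:E = (Num.sqrt (pi / p))%:E)%E.
Proof.
move=> p0; have s0 : 0 < Num.sqrt p by rewrite sqrtr_gt0.
have := @ge0_integral_affine R (Num.sqrt p) 0 (fun x => (gauss_fun x)%:E) s0.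
rewrite integralT_gauss => H.
rewrite (eq_integral (fun x : measurableTypeR R => (gauss_fun (Num.sqrt p * x + 0))%:E)); last first.
  by move=> x _; rewrite addr0 /gauss_fun exprMn sqr_sqrtr// ltW.
rewrite H; last 2 first.
- by apply/measurable_EFinP; exact: measurable_gauss_fun.
- by move=> x; rewrite lee_fin gauss_fun_ge0.
by rewrite -EFinM sqrtrM ?pi_ge0// sqrtrV ?ltW// mulrC.
Qed.

Lemma gaus_integrable p : 0 < p -> leb.-integrable setT (fun x => (gaus p x)%:E).
Proof.
move=> p0; apply/integrableP; split.
  by apply/measurable_EFinP; exact: measurable_gaus.
rewrite (eq_integral (fun x : measurableTypeR R => (gaus p x)%:E)) ?integral_gaus ?ltry//.
by move=> x _; rewrite gee0_abs// lee_fin ltW// gaus_gt0.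
Qed.

Lemma gaus_dominated (p C : R) (g : R -> R) : 0 < p -> continuous g ->
  (forall x, `|g x| <= C * gaus p x) -> leb.-integrable setT (EFin \o g).
Proof.
move=> p0 cg gC.
have iC : leb.-integrable setT (fun x => (C%:E * (gaus p x)%:E)%E).
  by apply: integrableZl => //; exact: gaus_integrable.
apply: (le_integrable measurableT _ _ iC).
  by apply/measurable_EFinP; exact: (continuous_measurable_fun cg).
move=> x _; rewrite /= lee_fin; apply: le_trans (gC x) (ler_norm _).
Qed.

Lemma mul_gaus_le p x : 0 < p -> (1 + `|x|) * gaus (2 * p) x <= (2 + p^-1) * gaus p x.
Proof.
move=> p0.
have -> : gaus (2 * p) x = gaus p x * gaus p x by rewrite /gaus -expRD; congr expR; ring.
rewrite mulrA ler_pM2r ?gaus_gt0//.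
rewrite /gaus expRN ler_pdivrMr ?expR_gt0//.
apply: (@le_trans _ _ ((2 + p^-1) * (1 + p * x ^+ 2))); last first.
  by rewrite ler_wpM2l ?expR_ge1Dx// addr_ge0// invr_ge0 ltW.
rewrite mulrDr mulr1 mulrDl mulKf ?gt_eqF//.
have h1 : `|x| <= 1 + x ^+ 2.
  rewrite -[x ^+ 2]real_normK ?num_real//.
  have := sqr_ge0 (`|x| - 1); rewrite sqrrB1; have := normr_ge0 x; set y := `|x| => y0; rewrite mulr2n; nra.
have h2 : 0 <= p * x ^+ 2 by rewrite mulr_ge0 ?sqr_ge0// ltW.
have h3 : 0 <= p^-1 by rewrite invr_ge0 ltW.
lra.
Qed.

(** A domination that is uniform in small translations. *)
Lemma gaus_shift p x h : 0 < p -> `|h| <= 1 -> gaus p (h + x) <= expR p * gaus (p / 2) x.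
Proof.
move=> p0 h1; rewrite /gaus -expRD ler_expR.
have h2 : h ^+ 2 <= 1 by rewrite -[h ^+ 2]real_normK ?num_real// exprn_ile1.
have : 0 <= p * (2 * h + x) ^+ 2 by rewrite mulr_ge0 ?sqr_ge0// ltW.
have : 0 <= p * (1 - h ^+ 2) by rewrite mulr_ge0 ?(ltW p0) ?subr_ge0.
nra.
Qed.

Lemma integral_line_translate (h : R) (g : R -> \bar R) :
  measurable_fun [set: measurableTypeR R] g ->
  (\int[leb]_x g (h + x)%R = \int[leb]_x g x)%E.
Proof.
move=> mg.
have tr (f : R -> \bar R) : measurable_fun [set: R] f -> (forall x, 0 <= f x)%E ->
    (\int[leb]_x f (h + x)%R = \int[leb]_x f x)%E.
  move=> mf f0; have := ge0_integral_affine h ltr01 mf f0.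
  by rewrite invr1 mul1e => <-; apply: eq_integral => x _; rewrite mul1r addrC.
rewrite integralE [in RHS]integralE; congr (_ - _)%E.
  by rewrite -(tr _ (measurable_funepos mg) (funepos_ge0 _)); apply: eq_integral => x _; rewrite !funeposE.
by rewrite -(tr _ (measurable_funeneg mg) (funeneg_ge0 _)); apply: eq_integral => x _; rewrite !funenegE.
Qed.

(** By translation invariance the integral of [F (h + x)] in [x] does not depend on
    [h]; its derivative at [h = 0] is the integral of [F']. *)
Lemma integral_derive_line_eq0 (F F' : R -> R) (p C : R) : 0 < p ->
  (forall x, is_derive x (1 : R) F (F' x)) -> continuous F' ->
  (forall x, `|F x| <= C * gaus p x) -> (forall x, `|F' x| <= C * gaus p x) ->
  \int[leb]_x F' x = 0.
Proof.
move=> p0 dF cF' FC F'C.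
have C0 : 0 <= C by have := le_trans (normr_ge0 _) (FC 0); rewrite pmulr_lge0// gaus_gt0.
have cF := is_derive_continuous dF.
have mF : measurable_fun [set: measurableTypeR R] (fun x => (F x)%:E).
  by apply/measurable_EFinP; exact: (continuous_measurable_fun cF).
pose J h := \int[leb]_x F (h + x).
have Jcst h : J h = \int[leb]_x F x.
  by rewrite /J /Rintegral (integral_line_translate h mF).
have ctr (h : R) : continuous (fun x : R => h + x).
  by move=> x; apply: (@continuousD _ _ _ (cst h) id); [exact: cst_continuous|exact: cvg_id].
have shift_le (h x : R) (K : R -> R) : -1 < h < 1 -> (forall x, `|K x| <= C * gaus p x) ->
    `|K (h + x)| <= C * expR p * gaus (p / 2) x.
  move=> /andP[h1 h2] KC; apply: (le_trans (KC _)); rewrite -mulrA ler_wpM2l// gaus_shift//.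
  by rewrite ler_norml; apply/andP; split; exact: ltW.
have p20 : 0 < p / 2 by rewrite divr_gt0.
have dJ : is_derive (0 : R) (1 : R) J (\int[leb]_x F' (0 + x)).
  have dFh (h x : R) : is_derive h (1 : R) (fun h => F (h + x)) (F' (h + x)).
    have D := @is_derive_comp_dir R R h 1 (fun h : R => h + x) F _ _ (dF (h + x)) (is_derive_add (is_derive_id h (1 : R)) (is_derive_cst x h (1 : R))).
    by apply: (is_derive_eq D); rewrite addr0 mulr1.
  apply: (@is_derive_under_integral R _ _ leb (fun h x => F (h + x))
    (fun h x => F' (h + x)) setT 0 (-1) 1 (fun x => C * expR p * gaus (p / 2) x)).
  - exact: measurableT.
  - by apply/andP; split; lra.
  - move=> h h1; apply: (gaus_dominated p20 (C := C * expR p)).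
      by move=> x; apply: (cvg_comp (fun x => h + x) F); [exact: ctr|exact: cF].
    by move=> x; exact: shift_le.
  - exact: (integrable_mulr measurableT (C * expR p) (gaus_integrable p20)).
  - by move=> h x h1 _; exact: shift_le.
have -> : \int[leb]_x F' x = \int[leb]_x F' (0 + x) by apply: eq_Rintegral => x _; rewrite add0r.
apply: (derive_locally_cst (c := \int[leb]_x F x) dJ).
by apply/nbhs_ballP; exists 1 => //= h _; exact: Jcst.
Qed.

Lemma continuousMf (g h : R -> R) : continuous g -> continuous h -> continuous (fun x => g x * h x).
Proof. by move=> cg ch x; apply: (@continuousM _ _ g h); [exact: cg|exact: ch]. Qed.

Lemma continuousDf (g h : R -> R) : continuous g -> continuous h -> continuous (fun x => g x + h x).
Proof. by move=> cg ch x; apply: (@continuousD _ _ _ g h); [exact: cg|exact: ch]. Qed.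

Lemma continuous_affine (c x0 : R) : continuous (fun x : R => c * x + x0).
Proof.
apply: (@continuousDf (fun x => c * x) (cst x0)); last exact: cst_continuous.
apply: (@continuousMf (cst c) id); first exact: cst_continuous.
by move=> x; exact: cvg_id.
Qed.

Lemma normr_sin_le1 (x : R) : `|sin x| <= 1.
Proof. by rewrite ler_norml sin_geN1 sin_le1. Qed.

Lemma normr_cos_le1 (x : R) : `|cos x| <= 1.
Proof. by rewrite ler_norml cos_geN1 cos_le1. Qed.

Lemma is_derive_affine (a b x : R) : is_derive x (1 : R) (fun x => a * x + b) a.
Proof.
have D := is_derive_add (is_derive_mul (is_derive_cst a x (1 : R)) (is_derive_id x (1 : R)))
  (is_derive_cst b x (1 : R)).
by apply: (is_derive_eq D); rewrite mul0r mulr1 add0r addr0.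
Qed.

(** The Fourier transform of a Gaussian solves a linear first-order equation,
    since multiplication by x is exchanged with differentiation. *)
Lemma integral_cos_gaus (q xi c : R) : 0 < q ->
  \int[leb]_x (cos (xi * x + c) * gaus (q / 2) x) =
  Num.sqrt (2 * pi / q) * expR (- (xi ^+ 2 / (2 * q))) * cos c.
Proof.
move=> q0; pose p := q / 4; have p0 : 0 < p by rewrite divr_gt0.
have q20 : 0 < q / 2 by rewrite divr_gt0.
have qp : q / 2 = 2 * p by rewrite /p; field.
have gp x : gaus (q / 2) x <= (2 + p^-1) * gaus p x.
  rewrite qp; apply: le_trans (mul_gaus_le x p0); rewrite [leRHS]mulrDl mul1r lerDl.
  by rewrite mulr_ge0// ltW// gaus_gt0.
have xgp x : `|x| * gaus (q / 2) x <= (2 + p^-1) * gaus p x.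
  rewrite qp; apply: le_trans (mul_gaus_le x p0); rewrite [leRHS]mulrDl mul1r lerDr.
  by rewrite ltW// gaus_gt0.
have K0 : 0 < 2 + p^-1 by rewrite addr_gt0// invr_gt0.
set K := 2 + p^-1 in gp xgp K0.
have ccos (y : R) : continuous (fun x : R => cos (y * x + c)).
  by move=> x; apply: (cvg_comp (fun x => y * x + c) cos); [exact: continuous_affine|exact: continuous_cos].
have csin (y : R) : continuous (fun x : R => sin (y * x + c)).
  by move=> x; apply: (cvg_comp (fun x => y * x + c) sin); [exact: continuous_affine|exact: continuous_sin].
have cg := @continuous_gaus (q / 2).
have cid : continuous (@id R) by move=> x; exact: cvg_id.
pose I y := \int[leb]_x (cos (y * x + c) * gaus (q / 2) x).
pose Sx y x := x * (sin (y * x + c) * gaus (q / 2) x).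
have Sx_le y x : `|Sx y x| <= K * gaus p x.
  rewrite /Sx normrM normrM (ger0_norm (ltW (gaus_gt0 _ _))); apply: le_trans (xgp x).
  by rewrite ler_wpM2l// ler_piMl ?normr_sin_le1// ltW// gaus_gt0.
have cos_le y x : `|cos (y * x + c) * gaus (q / 2) x| <= K * gaus p x.
  rewrite normrM (ger0_norm (ltW (gaus_gt0 _ _))); apply: le_trans (gp x).
  by rewrite ler_piMl ?normr_cos_le1// ltW// gaus_gt0.
have sin_le y x : `|sin (y * x + c) * gaus (q / 2) x| <= K * gaus p x.
  rewrite normrM (ger0_norm (ltW (gaus_gt0 _ _))); apply: le_trans (gp x).
  by rewrite ler_piMl ?normr_sin_le1// ltW// gaus_gt0.
have cSx y : continuous (Sx y) by apply: continuousMf => //; exact: continuousMf.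
have iSx y : leb.-integrable setT (EFin \o Sx y) by exact: (gaus_dominated p0 (@cSx y) (@Sx_le y)).
have icos y : leb.-integrable setT (EFin \o (fun x => cos (y * x + c) * gaus (q / 2) x)).
  by apply: (gaus_dominated p0 _ (@cos_le y)); exact: continuousMf.
have dI (y : R) : is_derive y (1 : R) I (\int[leb]_x (- Sx y x)).
  apply: (@is_derive_under_integral R _ _ leb (fun y x => cos (y * x + c) * gaus (q / 2) x)
    (fun y x => - Sx y x) setT y (y - 1) (y + 1) (fun x => K * gaus p x)).
  - exact: measurableT.
  - by apply/andP; split; lra.
  - by move=> y' _; exact: icos.
  - move=> y' x _ _.
    have D := @is_derive_comp_dir R R y' 1 (fun y => x * y + c) cos _ _ (is_derive_cos _) (is_derive_affine x c y').
    have D2 := is_derive_mul D (is_derive_cst (gaus (q / 2) x) y' (1 : R)).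
    rewrite (_ : (fun y => cos (y * x + c) * gaus (q / 2) x) = (fun y => cos (x * y + c) * cst (gaus (q / 2) x) y)).
      by apply: (is_derive_eq D2); rewrite /Sx /= mulr0 addr0 (mulrC x y'); ring.
    by apply/funext => u; rewrite (mulrC u).
  - exact: (integrable_mulr measurableT K (gaus_integrable p0)).
  - by move=> y' x _ _; rewrite normrN; exact: Sx_le.
(* The integrand of [y I - q S] is the derivative of [sin (y x + c)] times the
   Gaussian. *)
have parts y : y * I y = q * \int[leb]_x Sx y x.
  apply/eqP; rewrite -subr_eq0; apply/eqP.
  rewrite -RintegralZl// -RintegralZl// -RintegralB//.
  - apply: (@integral_derive_line_eq0 (fun x => sin (y * x + c) * gaus (q / 2) x) _ p (K * (1 + `|y| + q)) p0).
    + move=> x.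
      have D := @is_derive_comp_dir R R x 1 (fun x => y * x + c) sin _ _ (is_derive_sin _) (is_derive_affine y c x).
      apply: (is_derive_eq (is_derive_mul D (is_derive_gaus (q / 2) x))).
      by rewrite /Sx; field.
    + apply: (@continuousDf (fun x => y * (cos (y * x + c) * gaus (q / 2) x)) (fun x => - (q * Sx y x))).
        by apply: (@continuousMf (cst y)); [exact: cst_continuous|exact: continuousMf].
      move=> x; apply: (@continuousN _ _ _ (fun x => q * Sx y x)).
      by apply: (@continuousMf (cst q)); [exact: cst_continuous|exact: cSx].
    + move=> x; apply: (le_trans (sin_le y x)); rewrite ler_pM2r ?gaus_gt0//.
      by rewrite ler_peMr ?(ltW K0)// -addrA lerDl addr_ge0// ltW.
    + move=> x; apply: (le_trans (ler_normB _ _)).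
      have -> : K * (1 + `|y| + q) * gaus p x = K * gaus p x + `|y| * (K * gaus p x) + q * (K * gaus p x) by ring.
      rewrite -addrA; apply: (@le_trans _ _ (`|y| * (K * gaus p x) + q * (K * gaus p x))).
        rewrite !normrM (ger0_norm (ltW q0)); apply: lerD.
          by rewrite ler_wpM2l// -normrM cos_le.
        by rewrite ler_wpM2l ?(ltW q0)// -[X in X <= _]/(`|x| * _) -!normrM; exact: Sx_le.
      by rewrite lerDr mulr_ge0 ?(ltW K0)// ltW// gaus_gt0.
  - exact: (integrable_mulr measurableT y (icos y)).
  - exact: (integrable_mulr measurableT q (iSx y)).
have dI' (y : R) : is_derive y (1 : R) I (- (y / q) * I y).
  apply: (is_derive_eq (dI y)).
  under eq_Rintegral do rewrite -mulN1r.
  rewrite RintegralZl//.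
  have -> : \int[leb]_x Sx y x = y * I y / q by rewrite parts mulrC mulKf ?gt_eqF.
  ring.
pose W y := I y * expR (y ^+ 2 / (2 * q)).
have dW (y : R) : is_derive y (1 : R) W 0.
  have D := is_derive_mul (is_derive_fsqr (is_derive_id y (1 : R))) (is_derive_cst ((2 * q)^-1) y (1 : R)).
  have D2 := @is_derive_comp_dir R R y 1 (fun y => y ^+ 2 * cst ((2 * q)^-1) y) expR _ _ (is_derive_expR _) D.
  apply: (is_derive_eq (is_derive_mul (dI' y) D2)).
  rewrite /=; field; rewrite gt_eqF//.
have W0 := @is_derive_0_is_cst R W xi 0 dW.
have I0 : I 0 = Num.sqrt (2 * pi / q) * cos c.
  rewrite /I; under eq_Rintegral do rewrite mul0r add0r.
  rewrite RintegralZl//; last exact: gaus_integrable.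
  rewrite /Rintegral integral_gaus//= mulrC; congr (Num.sqrt _ * _); field.
  by rewrite gt_eqF.
rewrite /W expr0n mul0r expR0 mulr1 I0 in W0.
by rewrite expRN mulrAC -W0 mulrK// unitfE gt_eqF// expR_gt0.
Qed.

End gaussian_line.

Section rV_iterated.
Local Open Scope ereal_scope.
Context {R : realType} (n : nat).
Notation leb := (@lebesgue_measure R).

Lemma ge0_integral_rVS_prod (g : 'rV[R]_n.+1 -> \bar R) :
  measurable_fun setT g -> (forall v, 0 <= g v) ->
  \int[lebesgue_rV n.+1]_v g v = \int[leb \x lebesgue_rV n]_p (g \o @rV_cons R n) p.
Proof.
move=> mg g0.
have mc : measurable_fun [set: measurableTypeR R * 'rV[R]_n] (@rV_cons R n).
  exact: measurable_rV_cons.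
by rewrite -(@ge0_integral_pushforward _ _ _ _ R _ mc (leb \x lebesgue_rV n) setT g).
Qed.

Lemma ge0_integral_rVS21 (g : 'rV[R]_n.+1 -> \bar R) :
  measurable_fun setT g -> (forall v, 0 <= g v) ->
  \int[lebesgue_rV n.+1]_v g v = \int[lebesgue_rV n]_v \int[leb]_x g (rV_cons (x, v)).
Proof.
move=> mg g0; rewrite ge0_integral_rVS_prod//.
exact: (@fubini_tonelli2 _ _ _ _ R leb (lebesgue_rV n) (g \o @rV_cons R n)
  (measurable_comp_rV_cons mg) (fun=> g0 _)).
Qed.

Lemma integral_rVS21 (g : 'rV[R]_n.+1 -> \bar R) :
  (lebesgue_rV n.+1).-integrable setT g ->
  \int[lebesgue_rV n.+1]_v g v = \int[lebesgue_rV n]_v \int[leb]_x g (rV_cons (x, v)).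
Proof.
move=> ig; have mg := measurable_int _ ig.
have mgc := measurable_comp_rV_cons mg.
have igc : (leb \x lebesgue_rV n).-integrable setT (g \o @rV_cons R n).
  apply/integrableP; split; first exact: mgc.
  have /integrableP[_] := ig.
  rewrite ge0_integral_rVS_prod//.
  by apply: measurableT_comp => //.
transitivity (\int[leb \x lebesgue_rV n]_p (g \o @rV_cons R n) p).
  rewrite integralE [RHS]integralE; congr (_ - _).
    rewrite ge0_integral_rVS_prod; last 2 first.
    - exact: measurable_funepos.
    - by move=> v; exact: funepos_ge0.
    by apply: eq_integral => v _; rewrite /= !funeposE.
  rewrite ge0_integral_rVS_prod; last 2 first.
  - exact: measurable_funeneg.
  - by move=> v; exact: funeneg_ge0.
  by apply: eq_integral => v _; rewrite /= !funenegE.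
by rewrite -(integral21_prod_meas1 igc).
Qed.

End rV_iterated.

Lemma continuous_sumf (R : realType) (T : topologicalType) (I : Type) (r : seq I)
    (f : I -> T -> R) (x : T) : (forall i, {for x, continuous (f i)}) ->
  {for x, continuous (fun y => \sum_(i <- r) f i y)}.
Proof.
move=> cf; elim: r => [|i r IH].
  rewrite (_ : (fun y => _) = cst 0); first exact: cst_continuous.
  by apply/funext => y; rewrite big_nil.
rewrite (_ : (fun y => _) = (fun y => f i y + \sum_(i <- r) f i y)).
  by apply: (@continuousD _ _ _ (f i)); [exact: cf|exact: IH].
by apply/funext => y; rewrite big_cons.
Qed.

Section quadratic_forms.
Context {R : realType}.

Definition qform n (Q : 'M[R]_n) (x y : 'rV[R]_n) : R := (x *m Q *m y^T) 0 0.

Definition posdef n (Q : 'M[R]_n) := Q^T = Q /\ forall x, x != 0 -> 0 < qform Q x x.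

Lemma qformE n (Q : 'M[R]_n) x y : qform Q x y = \sum_i \sum_j x 0 i * Q i j * y 0 j.
Proof.
rewrite /qform mxE exchange_big; apply: eq_bigr => j _ /=.
by rewrite !mxE mulr_suml.
Qed.

Lemma continuous_qformr n (Q : 'M[R]_n) x : continuous (fun y => qform Q x y).
Proof.
suff H (y : 'rV[R]_n) : {for y, continuous (fun y => qform Q x y)} by move=> y; exact: H.
have -> : (fun y => qform Q x y) = (fun y => \sum_j (x *m Q) 0 j * y 0 j).
  by apply/funext => z; rewrite /qform mxE; apply: eq_bigr => j _; rewrite [z^T _ _]mxE.
apply: (@continuous_sumf R 'rV[R]_n _ _ (fun j y => (x *m Q) 0 j * y 0 j)) => j.
apply: (@continuousM _ _ (cst ((x *m Q) 0 j)) (fun y : 'rV[R]_n => y 0 j)).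
  exact: cst_continuous.
exact: coord_continuous.
Qed.

Lemma continuous_qform_diag n (Q : 'M[R]_n) : continuous (fun x => qform Q x x).
Proof.
suff H (x : 'rV[R]_n) : {for x, continuous (fun x => qform Q x x)} by move=> x; exact: H.
have -> : (fun x => qform Q x x) = (fun x => \sum_i \sum_j x 0 i * Q i j * x 0 j).
  by apply/funext => z; rewrite qformE.
apply: (@continuous_sumf R 'rV[R]_n _ _ (fun i x => \sum_j x 0 i * Q i j * x 0 j)) => i.
apply: (@continuous_sumf R 'rV[R]_n _ _ (fun j x => x 0 i * Q i j * x 0 j)) => j.
apply: (@continuousM _ _ (fun x : 'rV[R]_n => x 0 i * Q i j) (fun x : 'rV[R]_n => x 0 j)).
  apply: (@continuousM _ _ (fun x : 'rV[R]_n => x 0 i) (cst (Q i j))).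
    exact: coord_continuous.
  exact: cst_continuous.
exact: coord_continuous.
Qed.

Section schur.
Variables (n : nat) (Q : 'M[R]_n.+1).

Definition pivot : R := Q 0 0.
Definition pivot_row : 'rV[R]_n := \row_j Q 0 (lift ord0 j).
Definition schur : 'M[R]_n :=
  \matrix_(i, j) (Q (lift ord0 i) (lift ord0 j) - pivot_row 0 i * pivot_row 0 j / pivot).

Hypothesis Qpos : posdef Q.

Lemma pivot_gt0 : 0 < pivot.
Proof.
have [_ /(_ (delta_mx 0 0))] := Qpos.
rewrite qformE (bigD1 0)//= (bigD1 0)//= !mxE !eqxx/= mul1r mulr1.
rewrite big1 ?addr0 => [|j j0]; last by rewrite !mxE/= (negPf j0) mulr0.
rewrite big1 ?addr0 => [|i i0]; last first.
  by rewrite big1// => j _; rewrite !mxE/= (negPf i0) !mul0r.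
apply; apply/eqP => /matrixP/(_ 0 0)/eqP; rewrite !mxE !eqxx/=.
by rewrite oner_eq0.
Qed.

Let dot (y : 'rV[R]_n) := \sum_j pivot_row 0 j * y 0 j.

(** Completing the square in the first coordinate leaves the Schur complement of the
    pivot on the other coordinates. *)
Lemma qform_schur (h x : R) (k y : 'rV[R]_n) :
  qform Q (rV_cons (h, k)) (rV_cons (x, y)) =
  pivot * (h + dot k / pivot) * (x + dot y / pivot) + qform schur k y.
Proof.
have p0 : pivot != 0 by rewrite gt_eqF// pivot_gt0.
have Qs i j : Q i j = Q j i by have [QT _] := Qpos; rewrite -{1}QT mxE.
rewrite qformE big_ord_recl big_ord_recl !rV_cons0.
under eq_bigr => j _ do rewrite rV_consS.
under [X in _ + X]eq_bigr => i _.
  rewrite big_ord_recl rV_consS rV_cons0.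
  under eq_bigr => j _ do rewrite rV_consS.
  over.
rewrite big_split /= qformE.
have -> : \sum_(i < n) h * Q 0 (lift ord0 i) * y 0 i = h * dot y.
  by rewrite mulr_sumr; apply: eq_bigr => i _; rewrite !mxE mulrA.
have -> : \sum_(i < n) k 0 i * Q (lift ord0 i) 0 * x = dot k * x.
  by rewrite mulr_suml; apply: eq_bigr => i _; rewrite !mxE Qs; ring.
have -> : \sum_(i < n) \sum_(j < n) k 0 i * schur i j * y 0 j =
   \sum_(i < n) \sum_(j < n) k 0 i * Q (lift ord0 i) (lift ord0 j) * y 0 j - dot k * dot y / pivot.
  rewrite [dot k * dot y / pivot](_ : _ =
     \sum_(i < n) \sum_(j < n) k 0 i * (pivot_row 0 i * pivot_row 0 j / pivot) * y 0 j).
    rewrite -sumrB; apply: eq_bigr => i _; rewrite -sumrB; apply: eq_bigr => j _.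
    by rewrite [schur i j]mxE; ring.
  rewrite mulr_suml mulr_suml; apply: eq_bigr => i _.
  by rewrite mulr_sumr mulr_suml; apply: eq_bigr => j _; ring.
rewrite -/pivot; set A := \sum_(i < n) _; field.
exact: p0.
Qed.

Lemma posdef_schur : posdef schur.
Proof.
have p0 : pivot != 0 by rewrite gt_eqF// pivot_gt0.
have Qs i j : Q i j = Q j i by have [QT _] := Qpos; rewrite -{1}QT mxE.
split; first by apply/matrixP => i j; rewrite !mxE Qs; congr (_ - _); ring.
move=> y y0; have [_ /(_ (rV_cons (- (dot y / pivot), y)))] := Qpos.
rewrite qform_schur addNr mulr0 add0r; apply.
apply: contra_neq y0 => /matrixP E; apply/rowP => i.
by have := E 0 (lift ord0 i); rewrite rV_consS !mxE.
Qed.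

(** One step of Gaussian elimination. *)
Lemma det_schur : \det Q = pivot * \det schur.
Proof.
have p0 : pivot != 0 by rewrite gt_eqF// pivot_gt0.
have Qs i j : Q i j = Q j i by have [QT _] := Qpos; rewrite -{1}QT mxE.
pose U : 'M[R]_(1 + n) := block_mx (1%:M) ((- pivot^-1) *: pivot_row) 0 (1%:M).
pose A : 'M[R]_(1 + n) := block_mx (pivot%:M : 'M[R]_1) pivot_row pivot_row^T
    (\matrix_(i, j) Q (lift ord0 i) (lift ord0 j)).
have QE : Q = A.
  have Arr i j : A (rshift 1 i) (rshift 1 j) = Q (lift ord0 i) (lift ord0 j).
    by rewrite block_mxEdr mxE.
  have Arl i j : A (rshift 1 i) (lshift n j) = Q (lift ord0 i) ord0.
    by rewrite block_mxEdl !mxE Qs.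
  have Alr i j : A (lshift n i) (rshift 1 j) = Q ord0 (lift ord0 j).
    by rewrite block_mxEur ord1 !mxE.
  have All i j : A (lshift n i) (lshift n j) = Q ord0 ord0.
    by rewrite block_mxEul !ord1 !mxE eqxx mulr1n.
  apply/matrixP => i j.
  have e0 : ord0 = lshift n (ord0 : 'I_1) by apply/val_inj.
  have eS k : lift ord0 k = rshift 1 k by apply/val_inj.
  have [i' ->|->] := unliftP ord0 i; have [j' ->|->] := unliftP ord0 j.
  - by rewrite -Arr !eS.
  - by rewrite -(Arl i' ord0) eS -e0.
  - by rewrite -(Alr ord0 j') eS -e0.
  - by rewrite -(All ord0 ord0) -e0.
have UE : \det U = 1 by rewrite det_ublock !det1 mulr1.
have -> : \det Q = \det (A *m U) by rewrite det_mulmx UE mulr1 QE.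
rewrite /A /U mulmx_block !mulmx1 !mulmx0 !addr0.
rewrite mul_scalar_mx scalerA mulrN mulfV// scaleN1r addNr det_lblock det_scalar1; congr (_ * \det _).
apply/matrixP => i j; rewrite !mxE big_ord1 !mxE; field.
exact: p0.
Qed.

End schur.
End quadratic_forms.

Section gaussian_rV.
Context {R : realType}.
Notation leb := (@lebesgue_measure R).

Lemma continuous_expR_qform n (Q : 'M[R]_n) : continuous (fun x => expR (- (qform Q x x / 2))).
Proof.
suff H (x : 'rV[R]_n) : {for x, continuous (fun x => expR (- (qform Q x x / 2)))} by move=> x; exact: H.
apply: (cvg_comp (fun x : 'rV[R]_n => - (qform Q x x / 2)) expR); last exact: continuous_expR.
apply: (@continuousN _ _ _ (fun x : 'rV[R]_n => qform Q x x / 2)).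
apply: (@continuousM _ _ (fun x : 'rV[R]_n => qform Q x x) (cst 2^-1)).
  exact: continuous_qform_diag.
exact: cst_continuous.
Qed.

Lemma measurable_expR_qform n (Q : 'M[R]_n) :
  measurable_fun setT (fun x : 'rV[R]_n => (expR (- (qform Q x x / 2)))%:E).
Proof.
by apply/measurable_EFinP; exact: continuous_measurable_rV (@continuous_expR_qform _ Q).
Qed.

Lemma posdef_det_gt0 n (Q : 'M[R]_n) : posdef Q -> 0 < \det Q.
Proof.
elim: n Q => [|n IH] Q Qpos; first by rewrite det_mx00.
by rewrite det_schur// mulr_gt0 ?pivot_gt0// IH//; exact: posdef_schur.
Qed.

(** The first coordinate is integrated first: after completing the square it is a
    translated one-dimensional Gaussian, and the Schur complement remains. *)
Lemma integral_expR_qform n (Q : 'M[R]_n) : posdef Q ->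
  (\int[lebesgue_rV n]_x (expR (- (qform Q x x / 2)))%:E = (Num.sqrt ((2 * pi) ^+ n / \det Q))%:E)%E.
Proof.
elim: n Q => [|n IH] Q Qpos.
  rewrite /= integral_dirac//; last first.
    exact: (measurable_expR_qform Q).
  rewrite diracT mul1e det_mx00 expr0 divr1 sqrtr1 qformE big_ord0 mul0r oppr0.
  by rewrite expR0.
have q0 := pivot_gt0 Qpos; have Spos := posdef_schur Qpos.
have dS0 := posdef_det_gt0 Spos.
rewrite ge0_integral_rVS21; last 2 first.
- exact: (measurable_expR_qform Q).
- by move=> v; rewrite lee_fin expR_ge0.
have q20 : 0 < pivot Q / 2 by rewrite divr_gt0.
transitivity (\int[lebesgue_rV n]_y ((Num.sqrt (2 * pi / pivot Q))%:E *
    (expR (- (qform (schur Q) y y / 2)))%:E))%E.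
  apply: eq_integral => y _.
  set m := (\sum_j pivot_row Q 0 j * y 0 j) / pivot Q.
  transitivity (\int[leb]_x ((expR (- (qform (schur Q) y y / 2)))%:E * (gaus (pivot Q / 2) (1 * x + m))%:E))%E.
    apply: eq_integral => x _; rewrite (qform_schur Qpos) -EFinM /gaus -expRD; congr (expR _)%:E.
    by rewrite mul1r -/m; field.
  have mF : measurable_fun [set: measurableTypeR R] (fun x => (gaus (pivot Q / 2) (1 * x + m))%:E).
    apply/measurable_EFinP; apply: (continuous_measurable_fun (f := fun x => gaus (pivot Q / 2) (1 * x + m))).
    by move=> x; apply: (cvg_comp (fun x => 1 * x + m) (gaus (pivot Q / 2))); [exact: continuous_affine|exact: continuous_gaus].
  rewrite (ge0_integralZl leb measurableT mF); last 2 first.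
  - by move=> x _; rewrite lee_fin ltW// gaus_gt0.
  - by rewrite lee_fin expR_ge0.
  rewrite (ge0_integral_affine m ltr01 (g := fun x => (gaus (pivot Q / 2) x)%:E)); last 2 first.
  - by apply/measurable_EFinP; exact: measurable_gaus.
  - by move=> x; rewrite lee_fin ltW// gaus_gt0.
  rewrite integral_gaus// invr1 mul1e muleC; congr (_%:E * _)%E; congr Num.sqrt.
  by field; rewrite gt_eqF.
rewrite (ge0_integralZl (lebesgue_rV n) measurableT (measurable_expR_qform (schur Q))); last 2 first.
- by move=> x _; rewrite lee_fin expR_ge0.
- by rewrite lee_fin sqrtr_ge0.
rewrite IH// -EFinM -sqrtrM; last by rewrite divr_ge0 ?mulr_ge0 ?pi_ge0// ltW.
congr (Num.sqrt _)%:E; rewrite (det_schur Qpos) exprS; field.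
by rewrite !gt_eqF.
Qed.

Lemma expR_qform_integrable n (Q : 'M[R]_n) : posdef Q ->
  (lebesgue_rV n).-integrable setT (fun x => (expR (- (qform Q x x / 2)))%:E).
Proof.
move=> Qpos; apply/integrableP; split.
  exact: (measurable_expR_qform Q).
rewrite (eq_integral (fun x => (expR (- (qform Q x x / 2)))%:E)) ?integral_expR_qform ?ltry//.
by move=> x _; rewrite gee0_abs// lee_fin expR_ge0.
Qed.

Lemma integrable_cos_expR_qform n (Q : 'M[R]_n) (eta : 'rV[R]_n) (c : R) : posdef Q ->
  (lebesgue_rV n).-integrable setT (EFin \o (fun x => cos (qform Q eta x + c) * expR (- (qform Q x x / 2)))).
Proof.
move=> Qpos; apply: (le_integrable measurableT _ _ (expR_qform_integrable Qpos)).
  apply/measurable_EFinP; apply: continuous_measurable_rV.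
  suff H (x : 'rV[R]_n) : {for x, continuous (fun x => cos (qform Q eta x + c) * expR (- (qform Q x x / 2)))} by move=> x; exact: H.
  apply: (@continuousM _ _ (fun x => cos (qform Q eta x + c))); last exact: continuous_expR_qform.
  apply: (cvg_comp (fun x => qform Q eta x + c) cos); last exact: continuous_cos.
  apply: (@continuousD _ _ _ (fun x => qform Q eta x) (cst c)); last exact: cst_continuous.
  exact: continuous_qformr.
move=> x _ /=; rewrite lee_fin normrM ler_piMl ?normr_cos_le1//.
Qed.

(** Fourier transform of a centred Gaussian: integrating out one coordinate at a
    time replaces the matrix by its Schur complement. *)
Lemma integral_cos_expR_qform n (Q : 'M[R]_n) (eta : 'rV[R]_n) (c : R) : posdef Q ->
  \int[lebesgue_rV n]_x (cos (qform Q eta x + c) * expR (- (qform Q x x / 2))) =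
  Num.sqrt ((2 * pi) ^+ n / \det Q) * expR (- (qform Q eta eta / 2)) * cos c.
Proof.
elim: n Q eta c => [|n IH] Q eta c Qpos.
  rewrite /Rintegral /= integral_dirac//; last first.
    by have := integrable_cos_expR_qform eta c Qpos => /measurable_int.
  rewrite diracT mul1e det_mx00 expr0 divr1 sqrtr1 !qformE !big_ord0 mul0r oppr0.
  by rewrite /= expR0 add0r mulr1 !mul1r.
have q0 := pivot_gt0 Qpos; have Spos := posdef_schur Qpos.
have q20 : 0 < pivot Q / 2 by rewrite divr_gt0.
pose S := schur Q; pose q := pivot Q.
rewrite -(rV_unconsK eta); case: (rV_uncons eta) => h0 k {eta}.
set z := h0 + (\sum_j pivot_row Q 0 j * k 0 j) / q.
pose K := Num.sqrt (2 * pi / q) * expR (- ((q * z) ^+ 2 / (2 * q))).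
have iI := integrable_cos_expR_qform (rV_cons (h0, k)) c Qpos.
rewrite /Rintegral (integral_rVS21 iI).
transitivity (\int[lebesgue_rV n]_y (K * (cos (qform S k y + c) * expR (- (qform S y y / 2))))).
  rewrite /Rintegral; congr fine; apply: eq_integral => y _.
  set m := (\sum_j pivot_row Q 0 j * y 0 j) / q.
  pose e2 := expR (- (qform S y y / 2)); pose c' := qform S k y + c.
  pose G u := e2 * (cos (q * z * u + c') * gaus (q / 2) u).
  have cG0 : continuous (fun u => cos (q * z * u + c') * gaus (q / 2) u).
    apply: continuousMf; last exact: continuous_gaus.
    by move=> x; apply: (cvg_comp (fun x => q * z * x + c') cos); [exact: continuous_affine|exact: continuous_cos].
  have iG0 : leb.-integrable setT (EFin \o (fun u => cos (q * z * u + c') * gaus (q / 2) u)).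
    apply: (gaus_dominated q20 cG0 (C := 1)) => u.
    by rewrite normrM (ger0_norm (ltW (gaus_gt0 _ _))) ler_pM2r ?gaus_gt0 ?normr_cos_le1.
  have mG : measurable_fun [set: measurableTypeR R] (fun u => (G u)%:E).
    by have := integrable_mulr measurableT e2 iG0 => /measurable_int.
  transitivity (\int[leb]_x (G (m + x))%:E)%E.
    apply: eq_integral => x _; rewrite /= !(qform_schur Qpos) -/q -/S -/z -/m /G /e2 /c' /gaus.
    congr EFin; rewrite mulrCA -expRD; congr (cos _ * expR _); first by ring.
    by field.
  rewrite (integral_line_translate m mG).
  rewrite -(EFin_Rintegral measurableT (integrable_mulr measurableT e2 iG0)).
  rewrite RintegralZl// integral_cos_gaus// /K /e2 /c'; congr EFin; ring.
rewrite RintegralZl//; last exact: integrable_cos_expR_qform.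
rewrite IH// /K (det_schur Qpos) -/S -/q (qform_schur Qpos) -/q -/z.
have dS0 := posdef_det_gt0 Spos.
have -> : Num.sqrt ((2 * pi) ^+ n.+1 / (q * \det S)) = Num.sqrt (2 * pi / q) * Num.sqrt ((2 * pi) ^+ n / \det S).
  rewrite -sqrtrM; last by rewrite divr_ge0 ?mulr_ge0 ?pi_ge0// ltW.
  congr Num.sqrt; rewrite exprS; field; rewrite !gt_eqF//.
have -> : expR (- ((q * z * z + qform S k k) / 2)) = expR (- ((q * z) ^+ 2 / (2 * q))) * expR (- (qform S k k / 2)).
  by rewrite -expRD; congr expR; field; rewrite gt_eqF.
ring.
Qed.

End gaussian_rV.

(** * Continuity theorem for characteristic functions *)

Section dot_product.
Context {R : realType} (n : nat).
Notation V := 'rV[R]_n.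

Definition dotv (x y : V) : R := \sum_j x 0 j * y 0 j.

Lemma dotvC x y : dotv x y = dotv y x.
Proof. by apply: eq_bigr => j _; rewrite mulrC. Qed.

Lemma dotvBl x y z : dotv (x - y) z = dotv x z - dotv y z.
Proof. by rewrite /dotv -sumrB; apply: eq_bigr => j _; rewrite !mxE mulrBl. Qed.

Lemma dotvZl k x y : dotv (k *: x) y = k * dotv x y.
Proof. by rewrite /dotv mulr_sumr; apply: eq_bigr => j _; rewrite mxE mulrA. Qed.

Lemma qform_scalar c x y : qform (c%:M) x y = c * dotv x y.
Proof.
rewrite /qform mul_mx_scalar mxE /dotv mulr_sumr; apply: eq_bigr => j _.
by rewrite !mxE mulrA.
Qed.

Lemma dotv_ge0 x : 0 <= dotv x x.
Proof. by apply: sumr_ge0 => j _; rewrite -expr2 sqr_ge0. Qed.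

(** The norm of rows is the sup norm. *)
Lemma norm_le_dotv x : `|x| ^+ 2 <= dotv x x.
Proof.
have [->|N0] := eqVneq `|x| 0; first by rewrite expr0n dotv_ge0.
have [[i k] /= E] := mx_norm_neq0 N0.
rewrite [X in X ^+ 2]E ord1 real_normK ?num_real// /dotv (bigD1 k)//= -expr2 lerDl.
by apply: sumr_ge0 => j _; rewrite -expr2 sqr_ge0.
Qed.

Lemma posdef_scalar (c : R) : 0 < c -> posdef (c%:M : 'M[R]_n).
Proof.
move=> c0; split; first by rewrite tr_scalar_mx.
move=> x x0; rewrite qform_scalar mulr_gt0//.
by apply: lt_le_trans (norm_le_dotv x); rewrite exprn_gt0// normr_gt0.
Qed.

Lemma measurable_dotv d (T : measurableType d) (g h : T -> V) :
  measurable_fun setT g -> measurable_fun setT h ->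
  measurable_fun setT (fun x => dotv (g x) (h x)).
Proof.
move=> mg mh; apply: measurable_sum => j; apply: measurable_funM.
- exact: (measurableT_comp (measurable_rV_coord j) mg).
- exact: (measurableT_comp (measurable_rV_coord j) mh).
Qed.

Lemma measurable_rV_sub d (T : measurableType d) (g h : T -> V) :
  measurable_fun setT g -> measurable_fun setT h ->
  measurable_fun setT (fun x => g x - h x).
Proof.
move=> mg mh; apply/measurable_fun_rVP => i.
under eq_fun do rewrite !mxE; apply: measurable_funB.
- exact: (measurableT_comp (measurable_rV_coord i) mg).
- exact: (measurableT_comp (measurable_rV_coord i) mh).
Qed.

(** The Gaussian of covariance [c^-1], not normalised. *)
Definition heat (c : R) (x : V) : R := expR (- (c * dotv x x / 2)).

Lemma heat_gt0 c x : 0 < heat c x. Proof. exact: expR_gt0. Qed.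

Lemma heat_qform c x : heat c x = expR (- (qform (c%:M) x x / 2)).
Proof. by rewrite qform_scalar. Qed.

Lemma measurable_heat d (T : measurableType d) c (g : T -> V) :
  measurable_fun setT g -> measurable_fun setT (fun x => heat c (g x)).
Proof.
move=> mg; have md := measurable_dotv mg mg.
have E : (fun x => heat c (g x)) = expR \o (fun x => - (c / 2) * dotv (g x) (g x)).
  by apply/funext => x; rewrite /heat /=; congr expR; ring.
rewrite E; apply: measurableT_comp; first exact: (@measurable_expR R).
exact: (measurable_funM (measurable_cst (- (c / 2))) md).
Qed.

Definition heat_mass (c : R) : R := Num.sqrt ((2 * pi) ^+ n / c ^+ n).

Lemma heat_mass_gt0 c : 0 < c -> 0 < heat_mass c.
Proof. by move=> c0; rewrite sqrtr_gt0 divr_gt0 ?exprn_gt0 ?mulr_gt0 ?pi_gt0. Qed.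

Lemma integral_heat c : 0 < c ->
  (\int[lebesgue_rV n]_x (heat c x)%:E = (heat_mass c)%:E)%E.
Proof.
move=> c0; have := integral_expR_qform (@posdef_scalar c c0); rewrite det_scalar => <-.
by apply: eq_integral => x _; rewrite heat_qform.
Qed.

Lemma heat_integrable c : 0 < c -> (lebesgue_rV n).-integrable setT (fun x => (heat c x)%:E).
Proof.
move=> c0; have := expR_qform_integrable (@posdef_scalar c c0).
by apply: eq_integrable => // x _; rewrite heat_qform.
Qed.

(** The shift [s] covers the real and the imaginary part of the Fourier transform
    together. *)
Lemma integral_cos_heat c (x : V) (s : R) : 0 < c ->
  \int[lebesgue_rV n]_xi (cos (dotv x xi + s) * heat c xi) = heat_mass c * heat c^-1 x * cos s.
Proof.
move=> c0; have := integral_cos_expR_qform (c^-1 *: x) s (@posdef_scalar c c0).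
have dd : dotv (c^-1 *: x) (c^-1 *: x) = c^-1 * (c^-1 * dotv x x).
  by rewrite dotvZl dotvC dotvZl.
rewrite !qform_scalar det_scalar dd => E.
have -> : heat c^-1 x = expR (- (c * (c^-1 * (c^-1 * dotv x x)) / 2)).
  by rewrite /heat mulVKf ?gt_eqF.
rewrite /heat_mass -E; apply: eq_Rintegral => xi _.
by rewrite qform_scalar dotvZl mulVKf ?gt_eqF// heat_qform.
Qed.

End dot_product.

Section densities.
Context {R : realType} (n : nat).
Notation V := 'rV[R]_n.
Notation lam := (@lebesgue_rV R n).

Lemma density_integrable1 (p : V -> R) : probability_density p ->
  lam.-integrable setT (EFin \o p).
Proof.
move=> [mp p0 p1]; apply/integrableP; split; first exact/measurable_EFinP.
rewrite (eq_integral (EFin \o p)) => [|a _]; first by rewrite [ltLHS]p1 ltry.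
by rewrite /= ger0_norm.
Qed.

Lemma density_integrable (p u : V -> R) (B : R) : probability_density p ->
  measurable_fun setT u -> (forall a, `|u a| <= B) ->
  lam.-integrable setT (EFin \o (fun a => u a * p a)).
Proof.
move=> dp mu uB; have ip := density_integrable1 dp; have [mp p0 p1] := dp.
apply: (le_integrable measurableT _ _ (integrable_mulr measurableT B ip)).
  by apply/measurable_EFinP; exact: measurable_funM.
move=> a _; rewrite /= lee_fin !normrM ler_wpM2r//.
by apply: le_trans (uB a) (ler_norm _).
Qed.

Lemma density_Rintegral1 (p : V -> R) : probability_density p -> \int[lam]_a p a = 1.
Proof. by move=> [_ _ p1]; rewrite /Rintegral p1. Qed.

Lemma density_expect_le (p u : V -> R) (B : R) : probability_density p ->
  measurable_fun setT u -> (forall a, `|u a| <= B) -> `|\int[lam]_a (u a * p a)| <= B.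
Proof.
move=> dp mu uB; have iup := density_integrable dp mu uB.
apply: (le_trans (le_normr_Rintegral measurableT iup)).
have B0 : 0 <= B by apply: le_trans (uB 0).
have [mp p0 _] := dp.
have ip : lam.-integrable setT (EFin \o (fun a => B * p a)).
  by apply: (density_integrable (B := B) dp) => // a; rewrite ger0_norm.
have ip1 := density_integrable1 dp.
rewrite -[leRHS]mulr1 -(density_Rintegral1 dp) -RintegralZl//.
apply: le_Rintegral => //.
- exact: integrable_norm iup.
- by move=> a _; rewrite normrM (ger0_norm (p0 a)) ler_wpM2r.
Qed.

End densities.

Lemma normrB_max (R : realType) (x y : R) : `|x - y| <= (x - y) + 2 * Num.max (y - x) 0.
Proof.
have [h|h] := leP (y - x) 0.
  by rewrite mulr0 addr0 ger0_norm//; lra.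
by rewrite ltr0_norm; lra.
Qed.

Section dominated.
Context {R : realType} d (T : measurableType d) (m : {measure set T -> \bar R}).

Lemma Rdominated_cvg (f_ : nat -> T -> R) (f g : T -> R) :
  (forall k, measurable_fun setT (f_ k)) -> measurable_fun setT f ->
  (forall x, f_ k x @[k --> \oo] --> f x) -> m.-integrable setT (EFin \o g) ->
  (forall k x, `|f_ k x| <= g x) ->
  \int[m]_x f_ k x @[k --> \oo] --> \int[m]_x f x.
Proof.
move=> mf_ mf cf ig fg.
have c : (\int[m]_x (f_ k x)%:E)%E @[k --> \oo] --> (\int[m]_x (f x)%:E)%E.
  apply: (@dominated_cvg _ _ _ m setT measurableT (fun k x => (f_ k x)%:E) (fun x => (f x)%:E) (EFin \o g)).
  - by move=> k; apply/measurable_EFinP.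
  - by move=> x _; apply: cvg_EFin; [exact: nearW|exact: cf].
  - by [].
  - exact: ig.
  - by move=> k x _; rewrite /= lee_fin.
have if_ : m.-integrable setT (EFin \o f).
  apply: (le_integrable measurableT _ _ ig); first exact/measurable_EFinP.
  move=> x _; rewrite /= lee_fin (le_trans _ (ler_norm _))//.
  have cn : `|f_ k x| @[k --> \oo] --> `|f x| by apply: cvg_norm; exact: cf.
  by apply: (cvgr_to_le cn); exact: nearW.
apply: fine_cvg; rewrite fineK//; exact: integrable_fin_num.
Qed.

(** Scheffe: pointwise convergence of probability densities is convergence in L^1,
    because the negative part of the difference is dominated. *)
Lemma scheffe (P_ : nat -> T -> R) (P u : T -> R) (B : R) :
  (forall k, measurable_fun setT (P_ k)) -> measurable_fun setT P ->
  (forall k x, 0 <= P_ k x) -> (forall x, 0 <= P x) ->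
  (forall k, m.-integrable setT (EFin \o P_ k)) -> m.-integrable setT (EFin \o P) ->
  (forall k, \int[m]_x P_ k x = \int[m]_x P x) ->
  (forall x, P_ k x @[k --> \oo] --> P x) ->
  measurable_fun setT u -> (forall x, `|u x| <= B) ->
  \int[m]_x (u x * P_ k x) @[k --> \oo] --> \int[m]_x (u x * P x).
Proof.
move=> mP_ mP P_0 P0 iP_ iP eqm cP mu uB.
pose D k x := Num.max (P x - P_ k x) 0.
have mD k : measurable_fun setT (D k).
  by apply: measurable_maxr => //; exact: measurable_funB.
have D0 k x : 0 <= D k x by rewrite le_max lexx orbT.
have DP k x : `|D k x| <= P x.
  by rewrite ger0_norm// ge_max P0 andbT gerBl.
have cD x : D k x @[k --> \oo] --> (0 : R).
  have -> : (0 : R) = Num.max (P x - P x) 0 by rewrite subrr maxxx.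
  have cmx : continuous (fun y : R => Num.max y 0).
    by move=> y; apply: continuous_max; [exact: cvg_id|exact: cst_continuous].
  apply: (cvg_comp (fun k => P x - P_ k x) (fun y => Num.max y 0)); last exact: cmx.
  by apply: cvgB; [exact: cvg_cst|exact: cP].
have cI : \int[m]_x D k x @[k --> \oo] --> (0 : R).
  have := Rdominated_cvg mD (measurable_cst (0 : R)) cD iP DP.
  by rewrite [X in _ --> X](_ : _ = 0)// /Rintegral integral0.
have iD k : m.-integrable setT (EFin \o D k).
  apply: (le_integrable measurableT _ _ iP); first exact/measurable_EFinP.
  by move=> x _; rewrite /= lee_fin (le_trans (DP k x))// ler_norm.
have iu Q : m.-integrable setT (EFin \o Q) -> m.-integrable setT (EFin \o (fun x => u x * Q x)).
  move=> iQ; apply: (le_integrable measurableT _ _ (integrable_mulr measurableT B iQ)).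
    apply/measurable_EFinP; apply: measurable_funM => //.
    by apply/measurable_EFinP; exact: measurable_int iQ.
  move=> a _; rewrite /= lee_fin !normrM ler_wpM2r//.
  by apply: le_trans (uB a) (ler_norm _).
have B0 (x : T) : 0 <= B := le_trans (normr_ge0 _) (uB x).
have key k : `|\int[m]_x (u x * P_ k x) - \int[m]_x (u x * P x)| <= B * (2 * \int[m]_x D k x).
  rewrite -RintegralB//; [|exact: iu|exact: iu].
  have ib : m.-integrable setT (EFin \o (fun x => u x * P_ k x - u x * P x)).
    rewrite (_ : _ \o _ = (EFin \o (fun x => (u x * P_ k x)%R)) \- (EFin \o (fun x => (u x * P x)%R)))%E//.
    by apply: integrableB => //; exact: iu.
  apply: (le_trans (le_normr_Rintegral measurableT ib)).
  have iPP : m.-integrable setT (EFin \o (fun x => P_ k x - P x)).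
    rewrite (_ : _ \o _ = (EFin \o P_ k) \- (EFin \o P))%E//.
    exact: integrableB.
  have i2 : m.-integrable setT (EFin \o (fun x => (P_ k x - P x) + 2 * D k x)).
    rewrite (_ : _ \o _ = (EFin \o (fun x => (P_ k x - P x)%R)) \+ (EFin \o (fun x => (2 * D k x)%R)))%E//.
    by apply: integrableD => //; exact: integrable_mulr.
  have -> : 2 * \int[m]_x D k x = \int[m]_x ((P_ k x - P x) + 2 * D k x).
    rewrite RintegralD//; last exact: integrable_mulr.
    by rewrite RintegralB// eqm subrr add0r RintegralZl.
  rewrite -RintegralZl//; apply: le_Rintegral => //.
  - exact: integrable_norm ib.
  - exact: integrable_mulr.
  - move=> x _; rewrite -mulrBr normrM; apply: ler_pM => //.
    exact: normrB_max.
apply/subr_cvg0; apply: norm_cvg0.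
apply: (@squeeze_cvgr _ _ _ _ (cst 0) (fun k => B * (2 * \int[m]_x D k x))).
- by apply: nearW => k; rewrite normr_ge0/= key.
- exact: cvg_cst.
- rewrite -[X in _ --> X](mulr0 B); apply: cvgM; first exact: cvg_cst.
  by rewrite -[X in _ --> X](mulr0 2); apply: cvgM; [exact: cvg_cst|exact: cI].
Qed.

End dominated.

Section mollifier.
Context {R : realType} (n : nat).
Notation V := 'rV[R]_n.
Notation lam := (@lebesgue_rV R n).
Variable c : R.
Hypothesis c0 : 0 < c.

Definition heat_kernel (x : V) : R := (heat_mass n c)^-1 * heat c x.

Definition mollify (p : V -> R) (b : V) : R := \int[lam]_a (heat_kernel (b - a) * p a).

Let N0 : 0 < heat_mass n c. Proof. exact: heat_mass_gt0. Qed.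

Lemma heat_kernel_ge0 x : 0 <= heat_kernel x.
Proof. by rewrite mulr_ge0 ?invr_ge0 ?ltW// heat_gt0. Qed.

Lemma heat_kernel_le x : `|heat_kernel x| <= (heat_mass n c)^-1.
Proof.
rewrite ger0_norm ?heat_kernel_ge0// /heat_kernel ler_piMr ?invr_ge0 ?(ltW N0)//.
by rewrite /heat -[leRHS]expR0 ler_expR oppr_le0 divr_ge0// mulr_ge0 ?dotv_ge0// ltW.
Qed.

Lemma measurable_heat_kernel d (T : measurableType d) (g : T -> V) :
  measurable_fun setT g -> measurable_fun setT (fun x => heat_kernel (g x)).
Proof. by move=> mg; apply: measurable_funM => //; exact: measurable_heat. Qed.

Lemma integral_heat_kernel : (\int[lam]_x (heat_kernel x)%:E = 1)%E.
Proof.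
under eq_integral do rewrite EFinM.
rewrite ge0_integralZl//.
- by rewrite integral_heat// -EFinM mulVf// gt_eqF.
- by apply/measurable_EFinP; apply: measurable_heat; exact: measurable_id.
- by move=> x _; rewrite lee_fin ltW// heat_gt0.
- by rewrite lee_fin invr_ge0 ltW.
Qed.

Let msub : measurable_fun setT (fun z : V * V => z.2 - z.1).
Proof. by apply: measurable_rV_sub; [exact: measurable_snd|exact: measurable_fst]. Qed.

(** Fubini and translation invariance; a general kernel [h] is needed since both
    the heat kernel and its moment bound are convolved with densities. *)
Lemma integral_convolution (h p : V -> R) (H : R) : probability_density p ->
  measurable_fun setT h -> (forall x, 0 <= h x) -> (\int[lam]_x (h x)%:E = H%:E)%E ->
  (\int[lam \x lam]_z (h (z.2 - z.1) * p z.1)%:E = H%:E)%E.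
Proof.
move=> [mp p0 p1] mh h0 hH.
have mF : measurable_fun setT (fun z : V * V => (h (z.2 - z.1) * p z.1)%:E).
  apply/measurable_EFinP; apply: measurable_funM; first exact: measurableT_comp mh msub.
  exact: measurableT_comp mp measurable_fst.
rewrite fubini_tonelli1//; last by move=> z; rewrite lee_fin mulr_ge0.
rewrite /fubini_F /=.
transitivity (\int[lam]_a (H%:E * (p a)%:E))%E.
  apply: eq_integral => a _.
  transitivity (\int[lam]_b ((p a)%:E * (h (b - a))%:E))%E.
    by apply: eq_integral => b _; rewrite -EFinM mulrC.
  have mha : measurable_fun setT (fun b : V => (h (b - a))%:E).
    apply/measurable_EFinP; apply: (measurableT_comp mh).
    by apply: measurable_rV_sub => //; exact: measurable_id.
  rewrite (ge0_integralZl lam measurableT mha); last 2 first.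
  - by move=> x _; rewrite lee_fin.
  - by rewrite lee_fin.
  rewrite muleC; congr (_ * _)%E; rewrite -hH.
  have mh' : measurable_fun setT (fun x : V => (h x)%:E) by exact/measurable_EFinP.
  exact: (integral_rV_translate (- a) mh').
rewrite ge0_integralZl//.
- by rewrite p1 mule1.
- exact/measurable_EFinP.
- by move=> a _; rewrite lee_fin.
- by rewrite -hH integral_ge0// => x _; rewrite lee_fin.
Qed.

End mollifier.

Section mollify_theory.
Context {R : realType} (n : nat).
Notation V := 'rV[R]_n.
Notation lam := (@lebesgue_rV R n).
Variable c : R.
Hypothesis c0 : 0 < c.

Let N0 : 0 < heat_mass n c. Proof. exact: heat_mass_gt0. Qed.

Let mk (b : V) : measurable_fun setT (fun a : V => heat_kernel c (b - a)).
Proof. by apply: measurable_heat_kernel; apply: measurable_rV_sub => //; exact: measurable_id. Qed.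

Let msub : measurable_fun setT (fun z : V * V => z.2 - z.1).
Proof. by apply: measurable_rV_sub; [exact: measurable_snd|exact: measurable_fst]. Qed.

Let ik (p : V -> R) b : probability_density p ->
  lam.-integrable setT (EFin \o (fun a => heat_kernel c (b - a) * p a)).
Proof.
by move=> dp; apply: (density_integrable dp (mk b)) => a; exact: heat_kernel_le.
Qed.

Let mz (p : V -> R) : probability_density p ->
  measurable_fun setT (fun z : V * V => (heat_kernel c (z.2 - z.1) * p z.1)%:E).
Proof.
move=> [mp _ _]; apply/measurable_EFinP; apply: measurable_funM.
  exact: measurable_heat_kernel.
exact: measurableT_comp mp measurable_fst.
Qed.

Lemma mollify_EFin (p : V -> R) b : probability_density p ->
  (mollify c p b)%:E = (\int[lam]_a (heat_kernel c (b - a) * p a)%:E)%E.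
Proof. by move=> dp; rewrite /mollify (EFin_Rintegral measurableT (ik b dp)). Qed.

Lemma mollify_density (p : V -> R) : probability_density p -> probability_density (mollify c p).
Proof.
move=> dp; have [mp p0 p1] := dp.
have ge0 z : (0 <= (heat_kernel c (z.2 - z.1) * p z.1)%:E)%E.
  by rewrite lee_fin mulr_ge0// heat_kernel_ge0.
split.
- apply/measurable_EFinP; rewrite (_ : _ \o _ = fun b => (\int[lam]_a (heat_kernel c (b - a) * p a)%:E)%E).
    exact: (measurable_fun_fubini_tonelli_G (m1 := lam) _ (mz dp) ge0).
  by apply/funext => b; rewrite /= mollify_EFin.
- by move=> b; apply: Rintegral_ge0 => a _; rewrite mulr_ge0// heat_kernel_ge0.
- under eq_integral do rewrite mollify_EFin//.
  rewrite -(fubini_tonelli2 (m1 := lam) (m2 := lam) _ (mz dp) ge0).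
  apply: (integral_convolution dp).
  + by apply: measurable_heat_kernel; exact: measurable_id.
  + by move=> x; exact: heat_kernel_ge0.
  + exact: integral_heat_kernel.
Qed.

Let ci := c^-1.
Let ci0 : 0 < ci. Proof. by rewrite invr_gt0. Qed.
(** The normalising constant of Fourier inversion for the heat kernel. *)
Let kappa := (heat_mass n c)^-1 / heat_mass n ci.

(** A Gaussian is the Fourier transform of the Gaussian of inverse covariance. *)
Lemma heat_kernel_fourier (x : V) :
  heat_kernel c x = kappa * \int[lam]_xi (cos (dotv x xi) * heat ci xi).
Proof.
under eq_Rintegral do rewrite -[dotv _ _]addr0.
rewrite (integral_cos_heat x 0 ci0) cos0 mulr1 invrK /heat_kernel /kappa.
by rewrite -mulrA mulKf// gt_eqF// heat_mass_gt0.
Qed.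

Let F (p : V -> R) (b : V) (z : V * V) :=
  (cos (dotv z.2 z.1 + - dotv b z.2) * heat ci z.2 * p z.1)%:E.

Let iF p b : probability_density p -> (lam \x lam)%E.-integrable setT (F p b).
Proof.
move=> [mp p0 p1].
have mdot : measurable_fun setT (fun z : V * V => dotv z.2 z.1 + - dotv b z.2).
  apply: measurable_funB.
    by apply: measurable_dotv; [exact: measurable_snd|exact: measurable_fst].
  by apply: measurable_dotv; [exact: measurable_cst|exact: measurable_snd].
have mF : measurable_fun setT (F p b).
  apply/measurable_EFinP; apply: measurable_funM; last exact: measurableT_comp mp measurable_fst.
  apply: measurable_funM; last by apply: measurable_heat; exact: measurable_snd.
  apply: measurableT_comp mdot; exact: (continuous_measurable_fun (@continuous_cos R)).
have mhp : measurable_fun setT (fun z : V * V => (heat ci z.2 * p z.1)%:E).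
  apply/measurable_EFinP; apply: measurable_funM; last exact: measurableT_comp mp measurable_fst.
  by apply: measurable_heat; exact: measurable_snd.
have hp0 (z : V * V) : (0 <= (heat ci z.2 * p z.1)%:E)%E by rewrite lee_fin mulr_ge0// ltW// heat_gt0.
have ihp : (lam \x lam)%E.-integrable setT (fun z : V * V => (heat ci z.2 * p z.1)%:E).
  apply/integrableP; split => //.
  rewrite (eq_integral (fun z : V * V => (heat ci z.2 * p z.1)%:E)); last by move=> z _; rewrite gee0_abs.
  rewrite (fubini_tonelli2 (m1 := lam) (m2 := lam) _ mhp hp0).
  rewrite (eq_integral (fun xi => (heat ci xi)%:E)).
    by rewrite integral_heat// ltry.
  move=> xi _; transitivity (\int[lam]_a ((heat ci xi)%:E * (p a)%:E))%E.
    by apply: eq_integral => a _; rewrite EFinM.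
  rewrite ge0_integralZl//.
  - by rewrite p1 mule1.
  - exact/measurable_EFinP.
  - by move=> a _; rewrite lee_fin.
  - by rewrite lee_fin ltW// heat_gt0.
apply: (le_integrable measurableT mF _ ihp) => z _.
  rewrite /F /= lee_fin -mulrA normrM -[leRHS]mul1r ler_pM ?normr_cos_le1//.
Qed.

Let EB p b xi : probability_density p ->
  heat ci xi * \int[lam]_a (cos (dotv xi a + - dotv b xi) * p a) =
  fine (\int[lam]_a F p b (a, xi))%E.
Proof.
move=> dp.
have ia : lam.-integrable setT (EFin \o (fun a => cos (dotv xi a + - dotv b xi) * p a)).
  apply: (density_integrable (B := 1) dp); last by move=> a; exact: normr_cos_le1.
  apply: measurableT_comp; first exact: (continuous_measurable_fun (@continuous_cos R)).
  apply: measurable_funD; last exact: measurable_cst.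
  by apply: measurable_dotv; [exact: measurable_cst|exact: measurable_id].
rewrite -RintegralZl// /Rintegral; congr fine.
by apply: eq_integral => a _; rewrite /F /= mulrA (mulrC (heat _ _)).
Qed.

Lemma measurable_fourier p b : probability_density p -> measurable_fun setT
  (fun xi => heat ci xi * \int[lam]_a (cos (dotv xi a + - dotv b xi) * p a)).
Proof.
move=> dp; apply: (eq_measurable_fun (fun xi => fine (\int[lam]_a F p b (a, xi))%E)).
  by move=> xi _; rewrite EB.
exact: (measurableT_comp (@fine_measurable R setT measurableT) (measurable_fubini_G (m1 := lam) (m2 := lam) (iF b dp))).
Qed.

(** By Fubini the mollification of a density is determined by its characteristic
    function, integrated against a Gaussian. *)
Lemma mollify_fourier (p : V -> R) b : probability_density p ->
  mollify c p b = kappa * \int[lam]_xi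
    (heat ci xi * \int[lam]_a (cos (dotv xi a + - dotv b xi) * p a)).
Proof.
move=> dp; have [mp p0 p1] := dp.
have mcos (x : V) s : measurable_fun setT (fun xi : V => cos (dotv xi x + s)).
  apply: measurableT_comp; first exact: (continuous_measurable_fun (@continuous_cos R)).
  apply: measurable_funD; last exact: measurable_cst.
  by apply: measurable_dotv; [exact: measurable_id|exact: measurable_cst].
have i2 a : lam.-integrable setT (EFin \o (fun xi => cos (dotv xi a + - dotv b xi) * heat ci xi * p a)).
  rewrite (_ : _ \o _ = EFin \o (fun xi => p a * (cos (dotv xi (a - b) + 0) * heat ci xi))); last first.
    apply/funext => xi /=; congr EFin; rewrite mulrC; congr (_ * (cos _ * _)).
    by rewrite addr0 [RHS]dotvC dotvBl (dotvC a).
  apply: integrable_mulr => //.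
  apply: (le_integrable measurableT _ _ (heat_integrable n ci0)).
    apply/measurable_EFinP; apply: measurable_funM; last by apply: measurable_heat; exact: measurable_id.
    exact: mcos.
  move=> xi _; rewrite /= lee_fin normrM ler_piMl ?normr_cos_le1//.
have k0 : kappa != 0.
  by rewrite mulf_neq0// invr_eq0 gt_eqF// heat_mass_gt0.
have E0 a : heat_kernel c (b - a) * p a =
    kappa * \int[lam]_xi (cos (dotv xi a + - dotv b xi) * heat ci xi * p a).
  have ich : lam.-integrable setT (EFin \o (fun xi => cos (dotv (b - a) xi) * heat ci xi)).
    apply: (le_integrable measurableT _ _ (heat_integrable n ci0)).
      apply/measurable_EFinP; apply: measurable_funM; last by apply: measurable_heat; exact: measurable_id.
      have := mcos (b - a) 0; apply: eq_measurable_fun => xi _.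
      by rewrite addr0 dotvC.
    move=> xi _; rewrite /= lee_fin normrM ler_piMl ?normr_cos_le1//.
  rewrite heat_kernel_fourier -mulrA; congr (_ * _).
  rewrite -RintegralZr//; apply: eq_Rintegral => xi _.
  by rewrite dotvBl (dotvC a) -cosN opprB addrC.
have E1 : mollify c p b = kappa * \int[lam]_a \int[lam]_xi (cos (dotv xi a + - dotv b xi) * heat ci xi * p a).
  rewrite -[LHS](mulVKf k0); congr (_ * _).
  rewrite /mollify -RintegralZl//; last exact: ik.
  by apply: eq_Rintegral => a _; rewrite E0 mulKf.
rewrite E1; congr (_ * _).
have ia xi : lam.-integrable setT (EFin \o (fun a => cos (dotv xi a + - dotv b xi) * p a)).
  apply: (density_integrable (B := 1) dp); last by move=> a; exact: normr_cos_le1.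
  have := mcos xi (- dotv b xi); apply: eq_measurable_fun => a _.
  by rewrite dotvC.
have EA : (fun a => \int[lam]_xi (cos (dotv xi a + - dotv b xi) * heat ci xi * p a)) =
    (fun a => fine (\int[lam]_xi F p b (a, xi))%E) by [].
have -> : (fun xi => heat ci xi * \int[lam]_a (cos (dotv xi a + - dotv b xi) * p a)) =
    (fun xi => fine (\int[lam]_a F p b (a, xi))%E).
  by apply/funext => xi; exact: EB.
rewrite EA /Rintegral; congr fine.
transitivity (\int[lam]_a \int[lam]_xi F p b (a, xi))%E.
  by apply: eq_integral => a _; rewrite fineK//; exact: integrable_fin_num (i2 a).
rewrite (Fubini (iF b dp)); apply: eq_integral => xi _; rewrite fineK//.
apply: integrable_fin_num => //.
rewrite (_ : (fun a => F p b (a, xi)) = EFin \o (fun a => heat ci xi * (cos (dotv xi a + - dotv b xi) * p a))).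
  by apply: integrable_mulr => //; exact: ia.
by apply/funext => a; rewrite /F /= mulrA (mulrC (heat _ _)).
Qed.

Lemma mollify_cvg (p_ : nat -> V -> R) (q : V -> R) b :
  (forall k, probability_density (p_ k)) -> probability_density q ->
  (forall xi s, \int[lam]_a (cos (dotv xi a + s) * p_ k a) @[k --> \oo] -->
    \int[lam]_a (cos (dotv xi a + s) * q a)) ->
  mollify c (p_ k) b @[k --> \oo] --> mollify c q b.
Proof.
move=> dp dq H.
rewrite (funext (fun k => mollify_fourier b (dp k))) mollify_fourier//.
apply: cvgM; first exact: cvg_cst.
apply: (@Rdominated_cvg _ _ _ lam _ _ (heat ci)).
- by move=> k; exact: measurable_fourier.
- exact: measurable_fourier.
- by move=> xi; apply: cvgM; [exact: cvg_cst|exact: H].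
- exact: heat_integrable.
- move=> k xi; rewrite normrM gtr0_norm ?heat_gt0// ler_piMr//; first by rewrite ltW ?heat_gt0.
  apply: density_expect_le => //; last by move=> a; exact: normr_cos_le1.
  apply: measurableT_comp; first exact: (continuous_measurable_fun (@continuous_cos R)).
  apply: measurable_funD; last exact: measurable_cst.
  by apply: measurable_dotv; [exact: measurable_cst|exact: measurable_id].
Qed.

End mollify_theory.

Section smoothing_error.
Context {R : realType} (n : nat).
Notation V := 'rV[R]_n.
Notation lam := (@lebesgue_rV R n).
Variable c : R.
Hypothesis c0 : 0 < c.

Let N0 : 0 < heat_mass n c. Proof. exact: heat_mass_gt0. Qed.

(** A wider heat kernel that bounds [|x|] times the heat kernel; its mass, of order
    [c^(-1/2)], stands in for the first moment. *)
Definition moment_kernel (x : V) : R :=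
  (Num.sqrt c)^-1 * (heat_mass n c)^-1 * heat (c / 2) x.

Let a0 : 0 <= (Num.sqrt c)^-1 * (heat_mass n c)^-1.
Proof. by rewrite mulr_ge0// invr_ge0 ?sqrtr_ge0// ltW. Qed.

Lemma moment_kernel_ge0 x : 0 <= moment_kernel x.
Proof. by rewrite mulr_ge0// ltW// heat_gt0. Qed.

(** The inequality is [y <= 1 + y^2/4 <= exp (y^2/4)] for [y] the square root of [c]
    times [|x|]. *)
Lemma norm_heat_kernel_le (x : V) : `|x| * heat_kernel c x <= moment_kernel x.
Proof.
have s0 : 0 < Num.sqrt c by rewrite sqrtr_gt0.
have h1 : Num.sqrt c * `|x| <= expR (c * dotv x x / 4).
  have A : Num.sqrt c * `|x| <= 1 + (Num.sqrt c * `|x|) ^+ 2 / 4.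
    have := sqr_ge0 (Num.sqrt c * `|x| - 2); set y := (Num.sqrt c * `|x|).
    by rewrite (_ : (y - 2) ^+ 2 = 4 * (1 + y ^+ 2 / 4 - y)); [rewrite pmulr_rge0// subr_ge0|field].
  apply: (le_trans A); apply: le_trans (expR_ge1Dx _).
  rewrite lerD2l exprMn sqr_sqrtr ?(ltW c0)// ler_pM2r// ler_pM2l//.
  exact: norm_le_dotv.
have E : heat (c / 2) x = expR (c * dotv x x / 4) * heat c x.
  by rewrite /heat -expRD; congr expR; field.
rewrite /moment_kernel /heat_kernel E.
rewrite (_ : _ * (_ * heat c x) = (heat_mass n c)^-1 * heat c x * `|x|); last by rewrite mulrC.
rewrite (_ : _ * (_ * heat c x) = (heat_mass n c)^-1 * heat c x * ((Num.sqrt c)^-1 * expR (c * dotv x x / 4))); last first.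
  by ring.
rewrite ler_wpM2l//; first by rewrite mulr_ge0 ?invr_ge0 ?(ltW N0)// ltW// heat_gt0.
by rewrite ler_pdivlMl.
Qed.

Lemma measurable_moment_kernel : measurable_fun setT moment_kernel.
Proof.
apply: measurable_funM; first exact: measurable_cst.
by apply: measurable_heat; exact: measurable_id.
Qed.

Lemma integral_moment_kernel :
  (\int[lam]_x (moment_kernel x)%:E = ((Num.sqrt c)^-1 * Num.sqrt (2 ^+ n))%:E)%E.
Proof.
transitivity (\int[lam]_x (((Num.sqrt c)^-1 * (heat_mass n c)^-1)%:E * (heat (c / 2) x)%:E))%E.
  by apply: eq_integral => x _; rewrite EFinM.
have mh : measurable_fun setT (fun x : V => (heat (c / 2) x)%:E).
  by apply/measurable_EFinP; apply: measurable_heat; exact: measurable_id.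
rewrite ge0_integralZl//; last by move=> x _; rewrite lee_fin ltW// heat_gt0.
rewrite integral_heat ?divr_gt0// -EFinM; congr EFin.
rewrite -mulrA; congr (_ * _); apply: (mulfI (lt0r_neq0 N0)).
rewrite mulVKf ?gt_eqF// /heat_mass -sqrtrM; last first.
  by rewrite ltW// divr_gt0 ?exprn_gt0 ?mulr_gt0 ?pi_gt0.
congr Num.sqrt; rewrite expr_div_n invf_div.
by rewrite [RHS]mulrAC mulrA.
Qed.

Variables (p u : V -> R) (L B : R).
Hypothesis dp : probability_density p.
Hypothesis mu : measurable_fun setT u.
Hypothesis uB : forall a, `|u a| <= B.
Hypothesis L0 : 0 <= L.
Hypothesis uL : forall a b, `|u b - u a| <= L * `|b - a|.

Let msub : measurable_fun setT (fun z : V * V => z.2 - z.1).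
Proof. by apply: measurable_rV_sub; [exact: measurable_snd|exact: measurable_fst]. Qed.

Let G (z : V * V) := heat_kernel c (z.2 - z.1) * p z.1.

Let G0 z : 0 <= G z.
Proof. by have [_ p0 _] := dp; rewrite mulr_ge0// heat_kernel_ge0. Qed.

Let mG : measurable_fun setT G.
Proof.
have [mp _ _] := dp; apply: measurable_funM; first exact: measurable_heat_kernel.
exact: measurableT_comp mp measurable_fst.
Qed.

Let iG : (lam \x lam)%E.-integrable setT (EFin \o G).
Proof.
apply/integrableP; split; first exact/measurable_EFinP.
rewrite (eq_integral (EFin \o G)); last by move=> z _; rewrite gee0_abs// lee_fin.
rewrite (integral_convolution (H := 1) dp) ?ltry//.
- by apply: measurable_heat_kernel; exact: measurable_id.
- by move=> x; exact: heat_kernel_ge0.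
- exact: integral_heat_kernel.
Qed.

Let iuG (g : V * V -> V) : measurable_fun setT g ->
  (lam \x lam)%E.-integrable setT (EFin \o (fun z => u (g z) * G z)).
Proof.
move=> mg; apply: (le_integrable measurableT _ _ (integrable_mulr measurableT B iG)).
  apply/measurable_EFinP; apply: measurable_funM mG; exact: measurableT_comp mu mg.
move=> z _; rewrite /= lee_fin !normrM ler_wpM2r//.
exact: le_trans (uB _) (ler_norm _).
Qed.

Let E1 : \int[lam]_a (u a * p a) = \int[(lam \x lam)%E]_z (u z.1 * G z).
Proof.
rewrite /Rintegral; congr fine.
rewrite -(integral12_prod_meas1 (m1 := lam) (m2 := lam) (iuG measurable_fst)).
apply: eq_integral => a _.
have i1 : lam.-integrable setT (EFin \o (fun x : V => heat_kernel c (x - a))).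
  apply/integrableP; split.
    apply/measurable_EFinP; apply: measurable_heat_kernel.
    by apply: measurable_rV_sub; [exact: measurable_id|exact: measurable_cst].
  rewrite (eq_integral (fun x : V => (heat_kernel c (x - a))%:E)); last first.
    by move=> z _; rewrite gee0_abs// lee_fin heat_kernel_ge0.
  have mh : measurable_fun setT (fun x : V => (heat_kernel c x)%:E).
    by apply/measurable_EFinP; apply: measurable_heat_kernel; exact: measurable_id.
  by rewrite (integral_rV_translate (- a) mh) integral_heat_kernel// ltry.
transitivity (\int[lam]_b ((u a * p a)%:E * (heat_kernel c (b - a))%:E))%E; last first.
  by apply: eq_integral => b _; rewrite /G /= -EFinM; congr EFin; ring.
rewrite integralZl//.
have mh : measurable_fun setT (fun x : V => (heat_kernel c x)%:E).
  by apply/measurable_EFinP; apply: measurable_heat_kernel; exact: measurable_id.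
by rewrite (integral_rV_translate (- a) mh) integral_heat_kernel// mule1.
Qed.

Let E2 : \int[lam]_b (u b * mollify c p b) = \int[(lam \x lam)%E]_z (u z.2 * G z).
Proof.
rewrite /Rintegral; congr fine.
rewrite -(integral21_prod_meas1 (m1 := lam) (m2 := lam) (iuG measurable_snd)).
apply: eq_integral => b _; rewrite EFinM mollify_EFin//.
rewrite -integralZl//.
apply: (density_integrable dp) => [|a]; last exact: heat_kernel_le.
apply: measurable_heat_kernel.
by apply: measurable_rV_sub; [exact: measurable_cst|exact: measurable_id].
Qed.

(** Both integrals are integrals over pairs [(a, b)] against the same weight
    [heat_kernel c (b - a) * p a], in which [u] is taken at [b] and at [a]. *)
Lemma mollify_lipschitz :
  `|\int[lam]_b (u b * mollify c p b) - \int[lam]_a (u a * p a)| <=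
  L * ((Num.sqrt c)^-1 * Num.sqrt (2 ^+ n)).
Proof.
have [mp p0 p1] := dp.
rewrite E1 E2 -RintegralB//; [|exact: iuG measurable_snd|exact: iuG measurable_fst].
have idu : (lam \x lam)%E.-integrable setT (EFin \o (fun z => u z.2 * G z - u z.1 * G z)).
  have := integrableB measurableT (iuG measurable_snd) (iuG measurable_fst).
  by apply: eq_integrable.
apply: (le_trans (le_normr_Rintegral measurableT idu)).
have CM := integral_convolution dp measurable_moment_kernel moment_kernel_ge0 integral_moment_kernel.
have iM : (lam \x lam)%E.-integrable setT (EFin \o (fun z : V * V => moment_kernel (z.2 - z.1) * p z.1)).
  apply/integrableP; split.
    apply/measurable_EFinP; apply: measurable_funM; first exact: measurableT_comp measurable_moment_kernel msub.
    exact: measurableT_comp mp measurable_fst.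
  rewrite (eq_integral (EFin \o (fun z : V * V => moment_kernel (z.2 - z.1) * p z.1))).
    by rewrite CM ltry.
  by move=> z _; rewrite gee0_abs// lee_fin mulr_ge0// moment_kernel_ge0.
have -> : (Num.sqrt c)^-1 * Num.sqrt (2 ^+ n) =
    \int[(lam \x lam)%E]_z (moment_kernel (z.2 - z.1) * p z.1) by rewrite /Rintegral CM.
rewrite -RintegralZl//; apply: le_Rintegral => //.
- exact: integrable_norm idu.
- exact: integrable_mulr.
- move=> z _; rewrite -mulrBl normrM (ger0_norm (G0 z)) /G [leRHS]mulrA [leLHS]mulrA; apply: (ler_wpM2r (p0 z.1)).
  apply: (le_trans (y := L * (`|z.2 - z.1| * heat_kernel c (z.2 - z.1)))).
    by rewrite [leRHS]mulrA ler_wpM2r ?heat_kernel_ge0.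
  by rewrite ler_wpM2l// norm_heat_kernel_le.
Qed.

End smoothing_error.

Lemma lipschitz_continuous (R : realType) (V : normedModType R) (g : V -> R) (L : R) :
  0 <= L -> (forall a b, `|g b - g a| <= L * `|b - a|) -> continuous g.
Proof.
move=> L0 gL a; apply/cvgrPdist_le => e e0.
have d0 : 0 < e / (L + 1) by rewrite divr_gt0// ltr_wpDl.
have := @nbhsx_ballx _ V a _ d0; apply: filterS => b; rewrite -ball_normE /= => ab.
rewrite distrC; apply: (le_trans (gL a b)).
apply: (le_trans (y := (L + 1) * (e / (L + 1)))); last first.
  by rewrite mulrCA mulfV ?mulr1// gt_eqF// ltr_wpDl.
apply: ler_pM => //; first by rewrite lerDl.
by rewrite distrC ltW.
Qed.

Section inf_convolution.
Context {R : realType} (n : nat).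
Notation V := 'rV[R]_n.
Variables (u : V -> R) (M : R).
Hypothesis uM : forall a, `|u a| <= M.

(** The infimum of [u y + L |x - y|] over [y] is the largest [L]-Lipschitz function
    below [u]. *)
Let lo (L : R) (x : V) := [set u y + L * `|x - y| | y in setT].

Definition lipschitz_below (L : R) (x : V) : R := inf (lo L x).

Let has_inf_lo L x : 0 <= L -> has_inf (lo L x).
Proof.
move=> L0; split; first by exists (u x + L * `|x - x|); exists x.
exists (- M) => _ [y _ <-]; have /ler_normlP[h _] := uM y.
have : 0 <= L * `|x - y| by rewrite mulr_ge0.
by lra.
Qed.

Lemma lipschitz_below_le_at L x y : 0 <= L -> lipschitz_below L x <= u y + L * `|x - y|.
Proof. by move=> L0; apply: ge_inf; [exact: (has_inf_lo x L0).2|exists y]. Qed.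

Lemma lipschitz_below_le L x : 0 <= L -> lipschitz_below L x <= u x.
Proof.
by move=> L0; have := lipschitz_below_le_at x x L0; rewrite subrr normr0 mulr0 addr0.
Qed.

Lemma lipschitz_below_ge L x c : 0 <= L ->
  (forall y, c <= u y + L * `|x - y|) -> c <= lipschitz_below L x.
Proof.
move=> L0 h; apply: lb_le_inf; first exact: (has_inf_lo x L0).1.
by move=> _ [y _ <-].
Qed.

Lemma lipschitz_below_bounded L x : 0 <= L -> `|lipschitz_below L x| <= M.
Proof.
move=> L0; have /ler_normlP[_ h2] := uM x.
rewrite ler_norml; apply/andP; split; last exact: le_trans (lipschitz_below_le x L0) h2.
apply: lipschitz_below_ge => // y; have /ler_normlP[h _] := uM y.
have : 0 <= L * `|x - y| by rewrite mulr_ge0.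
by lra.
Qed.

Lemma lipschitz_belowP L a b : 0 <= L ->
  `|lipschitz_below L b - lipschitz_below L a| <= L * `|b - a|.
Proof.
move=> L0.
have key x y : lipschitz_below L x - L * `|x - y| <= lipschitz_below L y.
  apply: lipschitz_below_ge => // w; rewrite lerBlDr.
  apply: (le_trans (lipschitz_below_le_at x w L0)); rewrite -addrA lerD2l -mulrDr.
  by rewrite ler_wpM2l// [leRHS]addrC; exact: ler_distD.
have := key a b; have := key b a; rewrite (distrC a b) => h1 h2.
by rewrite ler_norml; apply/andP; split; lra.
Qed.

Lemma lipschitz_below_continuous L : 0 <= L -> continuous (lipschitz_below L).
Proof.
by move=> L0; apply: (lipschitz_continuous L0) => a b; exact: lipschitz_belowP.
Qed.

(** Points [y] near [x] are handled by continuity; at the others [L |x - y|] exceeds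
    the oscillation of [u] once [L] is large. *)
Lemma lipschitz_below_cvg x : {for x, continuous u} ->
  lipschitz_below k%:R x @[k --> \oo] --> u x.
Proof.
move=> /cvgrPdist_le cu; apply/cvgrPdist_le => e e0.
have /nbhs_ballP[d /= d0 hd] := cu e e0.
near=> k.
have k0 : 0 <= k%:R :> R by [].
rewrite ger0_norm ?subr_ge0 ?lipschitz_below_le// lerBlDr -lerBlDl.
apply: lipschitz_below_ge => // y.
have [h|h] := ltP `|x - y| d.
  have /ler_normlP[_] := hd y ltac:(by rewrite -ball_normE).
  have : 0 <= k%:R * `|x - y| by rewrite mulr_ge0.
  by move=> ? ?; lra.
have : 2 * M <= k%:R * `|x - y|.
  apply: (@le_trans _ _ (k%:R * d)); last by rewrite ler_wpM2l.
  rewrite -ler_pdivrMr//; near: k; exact: nbhs_infty_ger.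
have /ler_normlP[hy _] := uM y; have /ler_normlP[_ hx] := uM x.
by move=> ?; lra.
Unshelve. all: by end_near. Qed.

End inf_convolution.

Section levy.
Context {R : realType} (n : nat).
Notation V := 'rV[R]_n.
Notation lam := (@lebesgue_rV R n).
Variables (p_ : nat -> V -> R) (q : V -> R).
Hypothesis dp_ : forall k, probability_density (p_ k).
Hypothesis dq : probability_density q.
Hypothesis fourier_cvg : forall xi s, \int[lam]_a (cos (dotv xi a + s) * p_ k a) @[k --> \oo] -->
    \int[lam]_a (cos (dotv xi a + s) * q a).

(** Mollified densities converge pointwise, hence in L^1. *)
Lemma mollify_cvg_in_distribution c (u : V -> R) B : 0 < c ->
  measurable_fun setT u -> (forall a, `|u a| <= B) ->
  \int[lam]_a (u a * mollify c (p_ k) a) @[k --> \oo] --> \int[lam]_a (u a * mollify c q a).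
Proof.
move=> c0 mu uB.
have dm k := mollify_density c0 (dp_ k); have dm0 := mollify_density c0 dq.
apply: (scheffe (B := B)) => //.
- by move=> k; have [] := dm k.
- by have [] := dm0.
- by move=> k; have [] := dm k.
- by have [] := dm0.
- by move=> k; exact: density_integrable1.
- exact: density_integrable1.
- by move=> k; rewrite !density_Rintegral1.
- by move=> b; exact: mollify_cvg.
Qed.

Lemma lipschitz_cvg_in_distribution (u : V -> R) L B :
  measurable_fun setT u -> (forall a, `|u a| <= B) -> 0 <= L ->
  (forall a b, `|u b - u a| <= L * `|b - a|) ->
  \int[lam]_a (u a * p_ k a) @[k --> \oo] --> \int[lam]_a (u a * q a).
Proof.
move=> mu uB L0 uL; apply/cvgrPdist_le => e e0.
pose K : R := Num.sqrt (2 ^+ n).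
have K0 : 0 <= K by exact: sqrtr_ge0.
pose s := 3 * (L * K + 1) / e.
have LK : 0 < L * K + 1 by rewrite ltr_wpDl// mulr_ge0.
have s0 : 0 < s by rewrite divr_gt0// mulr_gt0.
have c0 : 0 < s ^+ 2 by rewrite exprn_gt0.
have small : L * ((Num.sqrt (s ^+ 2))^-1 * K) <= e / 3.
  rewrite sqrtr_sqr gtr0_norm// mulrCA -(ler_pM2l s0) mulVKf ?gt_eqF//.
  rewrite /s (_ : _ / e * (e / 3) = L * K + 1); last by field; rewrite gt_eqF.
  by rewrite lerDl.
have e3 : 0 < e / 3 by rewrite divr_gt0.
have /cvgrPdist_le/(_ _ e3) H := mollify_cvg_in_distribution c0 mu uB.
have Hq := mollify_lipschitz c0 dq mu uB L0 uL.
near=> k.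
have Hp := mollify_lipschitz c0 (dp_ k) mu uB L0 uL.
have Hk : `|\int[lam]_a (u a * mollify (s ^+ 2) q a) - \int[lam]_a (u a * mollify (s ^+ 2) (p_ k) a)| <= e / 3.
  by near: k.
move: (le_trans Hq small) (le_trans Hp small) Hk.
set x1 := \int[lam]_a (u a * q a); set x2 := \int[lam]_a (u a * p_ k a).
set y1 := \int[lam]_b _; set y2 := \int[lam]_b _.
move: x1 x2 y1 y2 => x1 x2 y1 y2; rewrite !ler_norml => /andP[? ?] /andP[? ?] /andP[? ?].
by apply/andP; split; lra.
Unshelve. all: by end_near. Qed.

Let continuous_liminf (u : V -> R) M e : continuous u -> (forall a, `|u a| <= M) -> 0 < e ->
  \forall k \near \oo, \int[lam]_a (u a * q a) - e <= \int[lam]_a (u a * p_ k a).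
Proof.
move=> cu uM e0; have e2 : 0 < e / 2 by rewrite divr_gt0.
have mL (j : nat) : measurable_fun setT (lipschitz_below u j%:R).
  by apply: continuous_measurable_rV; apply: (lipschitz_below_continuous uM).
have mu : measurable_fun setT u by exact: continuous_measurable_rV.
have [mq q0 q1] := dq.
have cL : \int[lam]_a (lipschitz_below u j%:R a * q a) @[j --> \oo] --> \int[lam]_a (u a * q a).
  apply: (@Rdominated_cvg _ _ _ lam _ _ (fun a => M * q a)).
  - by move=> j; apply: measurable_funM.
  - exact: measurable_funM.
  - move=> x; apply: cvgM; last exact: cvg_cst.
    by apply: (lipschitz_below_cvg uM); exact: cu.
  - exact: (integrable_mulr measurableT M (density_integrable1 dq)).
  - move=> j a; rewrite normrM (ger0_norm (q0 a)) ler_wpM2r//.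
    exact: lipschitz_below_bounded.
have /cvgrPdist_le/(_ _ e2)[j _ /(_ j (leqnn j)) hj] := cL.
have := lipschitz_cvg_in_distribution (mL j) (fun a => lipschitz_below_bounded uM a (ler0n R j))
  (ler0n R j) (fun a b => lipschitz_belowP uM a b (ler0n R j)).
move=> /cvgrPdist_le/(_ _ e2); apply: filterS => k hk.
have le : \int[lam]_a (lipschitz_below u j%:R a * p_ k a) <= \int[lam]_a (u a * p_ k a).
  apply: le_Rintegral => //.
  - exact: (density_integrable (dp_ k) (mL j) (fun a => lipschitz_below_bounded uM a (ler0n R j))).
  - exact: (density_integrable (dp_ k) mu uM).
  - move=> a _; have [_ pk0 _] := dp_ k; rewrite ler_wpM2r//.
    exact: (lipschitz_below_le uM).
move: hj hk le; rewrite /=; set x1 := \int[lam]_a _; set x2 := \int[lam]_a _.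
set x3 := \int[lam]_a _; set x4 := \int[lam]_a _.
move: x1 x2 x3 x4 => x1 x2 x3 x4; rewrite !ler_norml => /andP[? ?] /andP[? ?] ?.
by lra.
Qed.

(** Levy's continuity theorem. The characteristic functions determine the limits
    of the Gaussian mollifications; mollification moves the integral of a Lipschitz
    function little, uniformly in [k]; and a bounded continuous function is an
    increasing limit of Lipschitz functions, which gives one inequality, the other
    one coming from [- u]. *)
Lemma levy_continuity (u : V -> R) M : continuous u -> (forall a, `|u a| <= M) ->
  \int[lam]_a (u a * p_ k a) @[k --> \oo] --> \int[lam]_a (u a * q a).
Proof.
move=> cu uM; apply/cvgrPdist_le => e e0.
have cN : continuous (fun a => - u a).
  suff H (a : V) : {for a, continuous (fun a => - u a)} by move=> a; exact: H.
  exact: (continuousN (cu a)).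
have NM a : `|- u a| <= M by rewrite normrN.
have IN (r : V -> R) : probability_density r ->
    \int[lam]_a (- u a * r a) = - \int[lam]_a (u a * r a).
  move=> dr; rewrite -mulN1r -RintegralZl//.
    by apply: eq_Rintegral => a _; rewrite mulN1r mulNr.
  exact: (density_integrable dr (continuous_measurable_rV cu) uM).
near=> k.
have h1 : \int[lam]_a (u a * q a) - e <= \int[lam]_a (u a * p_ k a).
  by near: k; exact: continuous_liminf cu uM e0.
have : \int[lam]_a (- u a * q a) - e <= \int[lam]_a (- u a * p_ k a).
  by near: k; exact: continuous_liminf cN NM e0.
rewrite (IN _ dq) (IN _ (dp_ k)); move: h1.
set x1 := \int[lam]_a _; set x2 := \int[lam]_a _.
move: x1 x2 => x1 x2 h1 h2; rewrite ler_norml; apply/andP; split; lra.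
Unshelve. all: by end_near. Qed.

End levy.

(** * Analytic functions and periodic antiderivatives *)

Section analytic.
Context {R : realType}.

Let pow_slope (w z : R) n : 0 <= z -> z <= w -> n.+1%:R * z ^+ n * (w - z) <= w ^+ n.+1 - z ^+ n.+1.
Proof.
move=> z0 zw; elim: n => [|n IH]; first by rewrite !expr1 expr0 mulr1 mul1r.
rewrite (_ : w ^+ n.+2 - z ^+ n.+2 = (w - z) * w ^+ n.+1 + z * (w ^+ n.+1 - z ^+ n.+1)); last first.
  by rewrite !(exprS _ n.+1); ring.
have h1 : z * (n.+1%:R * z ^+ n * (w - z)) <= z * (w ^+ n.+1 - z ^+ n.+1) by rewrite ler_wpM2l.
have h2 : z ^+ n.+1 * (w - z) <= (w - z) * w ^+ n.+1.
  by rewrite mulrC ler_wpM2l ?subr_ge0// lerXn2r ?nnegrE// (le_trans z0).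
have E : n.+2%:R * z ^+ n.+1 * (w - z) = z ^+ n.+1 * (w - z) + z * (n.+1%:R * z ^+ n * (w - z)).
  by rewrite -(nat1r n.+1) (exprS z n); ring.
by rewrite E lerD.
Qed.

(** Inside the disc of convergence the derived series converges: by the mean value
    inequality [n.+1 z^n (w - z)] is at most [w^n.+1], for [z < w] in the disc. *)
Lemma is_cvg_pseries_diffs (c : R^nat) (x z : R) :
  cvgn (pseries c x) -> `|z| < `|x| -> cvgn (pseries (pseries_diffs c) z).
Proof.
move=> cx zx; pose w := (`|z| + `|x|) / 2.
have zw : `|z| < w by rewrite /w; lra.
have wx : w < `|x| by rewrite /w; lra.
have w0 : 0 <= w by exact: le_trans (ltW zw).
have cw : cvgn (pseries (fun i => `|c i|) w).
  by apply: is_cvg_pseries_inside_norm cx _; rewrite ger0_norm.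
have wz : 0 < w - `|z| by rewrite subr_gt0.
apply: normed_cvg.
apply: (@series_le_cvg _ _ (fun n => (w - `|z|)^-1 * (`|c n.+1| * w ^+ n.+1))) => [n|n|n|].
- exact: normr_ge0.
- by rewrite mulr_ge0 ?mulr_ge0 ?exprn_ge0// invr_ge0 ltW.
- rewrite /= /pseries_diffs !normrM normr_nat normrX ler_pdivlMl//.
  rewrite mulrC [n.+1%:R * _]mulrC -!mulrA.
  apply: ler_wpM2l => //; rewrite mulrA; apply: (le_trans (pow_slope n _ (ltW zw))) => //.
  by rewrite gerBl exprn_ge0.
- apply: (@is_cvg_seriesZ _ _ (w - `|z|)^-1).
  pose g i := `|c i| * w ^+ i.
  have -> : series (fun n => `|c n.+1| * w ^+ n.+1) = (fun n => series g n.+1 - g 0%N).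
    by apply/funext => n; rewrite /series /= (big_nat_recl n 0)//= addrC addKr.
  apply: is_cvgB; last exact: is_cvg_cst.
  have /cvg_ex[L cL] := cw; apply/cvg_ex; exists L.
  by rewrite (cvg_shiftS (series g)).
Qed.

Lemma is_derive_shift (f : R -> R) (x h d : R) :
  is_derive h (1 : R) (fun k => f (x + k)) d <-> is_derive (x + h) (1 : R) f d.
Proof.
have E : (fun k : R => k^-1 *: ((f \o shift (x + h)) (k *: 1) - f (x + h))) =
  (fun k => k^-1 *: (((fun k => f (x + k)) \o shift h) (k *: 1) - f (x + h))).
  by apply/funext => k /=; rewrite addrCA.
split=> -[D1 D2].
  by split; [rewrite /derivable E|rewrite -D2 /derive E].
by split; [rewrite /derivable -E|rewrite -D2 /derive E].
Qed.

(** Analyticity serves to differentiate [phi] twice; [derive1] alone says nothing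
    where the limit of difference quotients does not exist. *)
Lemma real_analytic_derive (f : R -> R) : real_analytic f ->
  (forall x, is_derive x (1 : R) f (derive1 f x)) /\ real_analytic (derive1 f).
Proof.
move=> fa.
have key x : exists (c : R^nat) (r : R), 0 < r /\
    forall h, `|h| < r -> [/\ is_derive (x + h) (1 : R) f (limn (pseries (pseries_diffs c) h)) &
      cvgn (pseries (pseries_diffs c) h)].
  have [c [r [r0 cf]]] := fa x; exists c, r; split => // h hr.
  pose K1 := (`|h| + r) / 2; pose K2 := (K1 + r) / 2; pose K3 := (K2 + r) / 2.
  have h0 : 0 <= `|h| by [].
  have cv k : `|k| < r -> cvgn (pseries c k) by move=> /cf ck; apply/cvg_ex; exists (f (x + k)).
  have K10 : `|K1| = K1 by rewrite ger0_norm// /K1; lra.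
  have K20 : `|K2| = K2 by rewrite ger0_norm// /K2 /K1; lra.
  have K30 : `|K3| = K3 by rewrite ger0_norm// /K3 /K2 /K1; lra.
  have c3 : cvgn (pseries c K3) by apply: cv; rewrite K30 /K3 /K2 /K1; lra.
  have d2 : cvgn (pseries (pseries_diffs c) K2).
    by apply: (is_cvg_pseries_diffs c3); rewrite K20 K30 /K3 /K2 /K1; lra.
  have d1 : cvgn (pseries (pseries_diffs (pseries_diffs c)) K1).
    by apply: (is_cvg_pseries_diffs d2); rewrite K20 K10 /K2 /K1; lra.
  have hK1 : `|h| < `|K1| by rewrite K10 /K1; lra.
  have c1 : cvgn (pseries c K1) by apply: cv; rewrite K10 /K1; lra.
  have d1' : cvgn (pseries (pseries_diffs c) K1).
    by apply: (is_cvg_pseries_inside d2); rewrite K20 K10 /K2 /K1; lra.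
  have D := pseries_snd_diffs c1 d1' d1 hK1.
  split; last exact: (is_cvg_pseries_inside d1' hK1).
  have D2 : is_derive h (1 : R) (fun k => f (x + k)) (limn (pseries (pseries_diffs c) h)).
    have N : \forall k \near h, limn (pseries c k) = f (x + k).
      have : \forall k \near h, `|k| < r.
        by apply: (@cvgr_lt _ _ _ _ _ _ (@norm_continuous _ _ h)).
      by apply: filterS => k kr; apply/cvg_lim => //; exact: cf.
    have [D3 D4] := D; split.
      exact: near_eq_derivable N D3.
    by rewrite -D4; apply: near_eq_derive; rewrite ?oner_eq0//; apply: filterS N => ? ->.
  exact: (iffLR (is_derive_shift f x h _) D2).
split => [x|x].
  have [c [r [r0 H]]] := key x; have [|D _] := H 0; first by rewrite normr0.
  by rewrite addr0 in D; have [D1 D2] := D; split => //; rewrite derive1E.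
have [c [r [r0 H]]] := key x; exists (pseries_diffs c), r; split => // h hr.
have [[_ D] cc] := H h hr.
by rewrite derive1E D.
Qed.

Lemma rV_analytic_derive n (g : R -> 'rV[R]_n) : rV_analytic g ->
  (forall k x, is_derive x (1 : R) (fun s => g s 0 k) (derive1 g x 0 k)) /\
  rV_analytic (derive1 g).
Proof.
move=> ga.
have E k x : derive1 g x 0 k = derive1 (fun s => g s 0 k) x.
  rewrite derive1E derive_mx.
    by rewrite mxE derive1E.
  apply/derivable_mxP => i j; rewrite ord1.
  by have [/(_ x)[]] := real_analytic_derive (ga j).
split=> [k x|k]; first by rewrite E; have [] := real_analytic_derive (ga k).
rewrite (_ : (fun s => _) = derive1 (fun s => g s 0 k)); last exact/funext.
by have [] := real_analytic_derive (ga k).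
Qed.

Lemma rV_analytic_continuous n (g : R -> 'rV[R]_n) k : rV_analytic g ->
  continuous (fun s => g s 0 k).
Proof. by move=> ga; exact: (is_derive_continuous (fun x => (rV_analytic_derive ga).1 k x)). Qed.

End analytic.

Section antiderivative.
Context {R : realType}.
Notation leb := (@lebesgue_measure R).
Implicit Types (F h : R -> R).

Lemma Rintegral_derive F h (a b : R) : a < b -> continuous h ->
  (forall s, is_derive s (1 : R) F (h s)) -> \int[leb]_(s in `[a, b]) h s = F b - F a.
Proof.
move=> ab ch dF; have cF := is_derive_continuous dF.
rewrite /Rintegral (@continuous_FTC2 R h F)//.
- exact: continuous_subspaceT.
- split => [x _||]; first by have [] := dF x.
  + exact: cvg_at_right_filter (cF a).
  + exact: cvg_at_left_filter (cF b).
- by move=> x _; rewrite derive1E; have [] := dF x.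
Qed.

(** The primitives [G N] based at [- N] agree where they are defined, so that near
    any given point the function equals one of them. *)
Lemma continuous_antiderivative h : continuous h ->
  exists F, forall s, is_derive s (1 : R) F (h s).
Proof.
move=> ch.
have ih (a b : R) : leb.-integrable `]a, b] (EFin \o h).
  apply: (integrableS _ _ _ (continuous_integrable_itv a b ch)); [exact: measurable_itv|exact: measurable_itv|].
  by apply: subset_itvr; rewrite bnd_simp.
pose G (N : nat) (s : R) := \int[leb]_(x in `](- N%:R), s]) h x - \int[leb]_(x in `](- N%:R), 0]) h x.
have GD N (s : R) : - N%:R < s -> is_derive s (1 : R) (G N) (h s).
  move=> Ns.
  have [D1 D2] := continuous_FTC1 (ltr_pwDr ltr01 (lexx s)) (ih (- N%:R) (s + 1)) Ns (@ch s).
  have DF : is_derive s (1 : R) (fun s : R => \int[leb]_(x in `](- N%:R), s]) h x) (h s).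
    by split; [exact: D1|rewrite -derive1E].
  have := is_derive_sub DF (is_derive_cst (\int[leb]_(x in `](- N%:R), 0]) h x) s (1 : R)).
  by rewrite subr0.
have GG (N M : nat) (s : R) : (N <= M)%N -> - N%:R <= s -> G M s = G N s.
  move=> NM Ns.
  have NM' : (BRight (- M%:R) <= BRight (- N%:R : R))%O by rewrite bnd_simp lerN2 ler_nat.
  have := @Rintegral_itvB _ h (BRight (- M%:R)) (BRight s) (- N%:R) (ih _ _) NM' Ns.
  have := @Rintegral_itvB _ h (BRight (- M%:R)) (BRight 0) (- N%:R) (ih _ _) NM' ltac:(by rewrite bnd_simp oppr_le0).
  by rewrite /G => <- <-; rewrite opprB addrA subrK.
pose N (s : R) : nat := (Num.truncn `|s|).+1.
have Ns (s : R) : - (N s)%:R <= s.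
  have := truncnS_gt `|s|; rewrite -/(N s) => h1.
  by have := ler_norm (- s); rewrite normrN lerNl => h2; apply: le_trans h2; rewrite lerN2 ltW.
exists (fun s : R => G (N s) s) => s.
pose M := (N s).+1.
have MD : is_derive s (1 : R) (G M) (h s).
  by apply: GD; apply: lt_le_trans (Ns s); rewrite ltrN2 ltr_nat.
have near_s : \forall y \near s, G M y = G (N y) y.
  have : \forall y \near s, `|y| < (N s)%:R.
    by apply: (@cvgr_lt _ _ _ _ _ _ (@norm_continuous _ _ s)); exact: truncnS_gt.
  apply: filterS => y ys; apply: GG; last exact: Ns.
  by rewrite /M ltnS; apply: ltnW; rewrite truncn_lt_nat.
have [D1 D2] := MD; split; first exact: near_eq_derivable near_s D1.
rewrite -D2; apply: near_eq_derive; apply: filterS near_s => y -> //.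
Qed.

(** A periodic continuous function of mean zero has a periodic second
    antiderivative: the mean of the first one can be normalised to zero. *)
Lemma periodic_double_antiderivative h l : 0 < l -> continuous h ->
  (forall s, h (s + l) = h s) -> \int[leb]_(s in `[0, l]) h s = 0 ->
  exists F2 F1, [/\ forall s, is_derive s (1 : R) F2 (F1 s),
    forall s, is_derive s (1 : R) F1 (h s), forall s, F2 (s + l) = F2 s &
    forall s, F1 (s + l) = F1 s].
Proof.
move=> l0 ch hl h0.
have per F g : (forall s, is_derive s (1 : R) F (g s)) -> continuous g ->
    (forall s, g (s + l) = g s) -> \int[leb]_(s in `[0, l]) g s = 0 ->
    forall s, F (s + l) = F s.
  move=> dF cg gl g0 s; apply/eqP; rewrite -subr_eq0; apply/eqP.
  have D x : is_derive x (1 : R) (fun y => F (y + l) - F y) 0.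
    have D1 : is_derive x (1 : R) (fun y => F (y + l)) (g x).
      have D2 : is_derive x (1 : R) (fun y => F (l + y)) (g x).
        by apply: (iffRL (is_derive_shift F l x (g x))); rewrite -(gl x) addrC; exact: dF.
      by rewrite (_ : (fun y => F (y + l)) = (fun y => F (l + y))); [|apply/funext => y; rewrite addrC].
    by rewrite -(subrr (g x)); apply: is_derive_sub.
  rewrite (is_derive_0_is_cst s 0 D) add0r.
  by rewrite -(Rintegral_derive l0 cg dF).
have [F dF] := continuous_antiderivative ch.
have cF := is_derive_continuous dF.
have Fl := per _ _ dF ch hl h0.
pose m := (\int[leb]_(s in `[0, l]) F s) / l.
pose F1 s := F s - m.
have dF1 s : is_derive s (1 : R) F1 (h s).
  by rewrite -[h s]subr0; apply: is_derive_sub; exact: is_derive_cst.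
have cF1 := is_derive_continuous dF1.
have F1l s : F1 (s + l) = F1 s by rewrite /F1 Fl.
have F10 : \int[leb]_(s in `[0, l]) F1 s = 0.
  rewrite RintegralB//; [|exact: continuous_integrable_itv|].
    have -> : \int[leb]_(s in `[0, l]) m = m * l.
      rewrite (@Rintegral_derive (fun s => m * s + 0) (cst m) 0 l l0 (@cst_continuous _ _ m) (is_derive_affine m 0)).
      by rewrite mulr0 !addr0 subr0.
    by rewrite /m divfK ?gt_eqF// subrr.
  by apply: continuous_integrable_itv; exact: cst_continuous.
have [F2 dF2] := continuous_antiderivative cF1.
by exists F2, F1; split => //; exact: per cF1 F1l F10.
Qed.

End antiderivative.

(** * The perturbed test function *)

Section elementary_bounds.
Context {R : realType}.

Lemma expR_sub1_le (y : R) : expR y - 1 <= y * expR y.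
Proof.
have := expR_ge1Dx (- y); rewrite -(ler_pM2r (expR_gt0 y)) -expRD addNr expR0.
by rewrite mulrDl mul1r mulNr => ?; lra.
Qed.

Lemma cos_lipschitz (x y : R) : `|cos x - cos y| <= `|x - y|.
Proof.
wlog xy : x y / x < y => [H|].
  have [xy|xy|->] := ltgtP x y; first exact: H.
    by rewrite distrC (distrC x); exact: H.
  by rewrite !subrr.
have [c _ E] := MVT xy (fun x _ => is_derive_cos x) (continuous_subspaceT (@continuous_cos R)).
rewrite distrC E (distrC x) normrM normrN ler_piMl//.
exact: normr_sin_le1.
Qed.

End elementary_bounds.

Section linear_form.
Context {R : realType} (n : nat).
Notation V := 'rV[R]_n.

Lemma continuous_dotv (xi : V) : continuous (dotv xi).
Proof.
suff H (a : V) : {for a, continuous (dotv xi)} by move=> a; exact: H.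
apply: continuous_sumf => j.
apply: (@continuousM _ _ (cst (xi 0 j)) (fun y : V => y 0 j)); first exact: cst_continuous.
exact: coord_continuous.
Qed.

Lemma is_derive_dotv (xi a : V) k : is_derive a (delta_mx 0 k) (dotv xi) (xi 0 k).
Proof.
have D := is_derive_sumf (fun j => is_derive_mul (is_derive_cst (xi 0 j) a (delta_mx 0 k))
  (is_derive_coord a (delta_mx 0 k) j)).
apply: (is_derive_eq D); rewrite (bigD1 k)//= big1 => [|j jk].
  by rewrite mul0r mxE !eqxx mulr1 add0r addr0.
by rewrite mul0r mxE eqxx (negPf jk) mulr0 addr0.
Qed.

Lemma dotv_norm_le (xi a : V) : `|dotv xi a| <= (\sum_j `|xi 0 j|) * `|a|.
Proof.
apply: (le_trans (ler_norm_sum _ _ _)); rewrite mulr_suml; apply: ler_sum => j _.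
by rewrite normrM ler_wpM2l// le_coord_norm.
Qed.

Lemma continuous_comp_phase (h : R -> R) (th c : R) (xi : V) : continuous h ->
  continuous (fun a => h (th * dotv xi a + c)).
Proof.
move=> ch; suff H (a : V) : {for a, continuous (fun a => h (th * dotv xi a + c))} by move=> a; exact: H.
apply: (@continuous_comp _ _ _ (fun a => th * dotv xi a + c) h); last exact: ch.
apply: (@continuousD _ _ _ (fun a => th * dotv xi a) (cst c)); last exact: cst_continuous.
apply: (@continuousM _ _ (cst th) (dotv xi)); first exact: cst_continuous.
exact: continuous_dotv.
Qed.

End linear_form.

Section test_function.
Context {R : realType} (n : nat) (eps : R) (z : R -> 'rV[R]_n).
Notation V := 'rV[R]_n.
Notation pcont := (@continuous_at_positive_times R n).
Hypothesis eps_gt0 : 0 < eps.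
Hypothesis z_cont : forall k, continuous (fun s => z s 0 k).
Variables (xi : V) (c q : R) (psi psi1 chi chi1 : R -> R).
Let g (s : R) := dotv xi (z s).
Let psi2 s := 2 / eps ^+ 2 * g s.
Let chi2 s := 2 / eps ^+ 2 * (psi s * g s + q / 2).
Hypothesis dpsi : forall s, is_derive s (1 : R) psi (psi1 s).
Hypothesis dpsi1 : forall s, is_derive s (1 : R) psi1 (psi2 s).
Hypothesis dchi : forall s, is_derive s (1 : R) chi (chi1 s).
Hypothesis dchi1 : forall s, is_derive s (1 : R) chi1 (chi2 s).
Variable th : R.

Let C (a : V) := cos (th * dotv xi a + c).
Let S (a : V) := sin (th * dotv xi a + c).
Let k := th ^+ 2 * q / 2.
Let e (t : R) := expR (k * t + 0).

(** Along the flow, [cos (th * dotv xi a + c)]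
    changes at rate [th], while the correctors [psi] and [chi], which solve
    [eps^2/2 psi'' = g] and [eps^2/2 chi'' = psi g + q/2] for the speed [g] of
    [dotv xi a], cancel the terms of order [th] and [th^2] up to the constant [q/2]
    that the exponential factor compensates. *)
Definition test_fun a s t := e t * (C a * (1 - th ^+ 2 * chi s) + th * psi s * S a).
Definition test_fun_t a s t := k * e t * (C a * (1 - th ^+ 2 * chi s) + th * psi s * S a).
Definition test_fun_a j a s t :=
  e t * (th * xi 0 j * (th * psi s * C a - S a * (1 - th ^+ 2 * chi s))).
Definition test_fun_s a s t := e t * (C a * (- (th ^+ 2 * chi1 s)) + th * psi1 s * S a).
Definition test_fun_ss a s t := e t * (C a * (- (th ^+ 2 * chi2 s)) + th * psi2 s * S a).

Let cg : continuous g.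
Proof.
move=> s; apply: (@continuous_sumf R R _ _ (fun j s => xi 0 j * z s 0 j)) => j.
by apply: (@continuousM _ _ (cst (xi 0 j)) (fun s => z s 0 j)); [exact: cst_continuous|exact: z_cont].
Qed.

(** The terms of order [th] and [th^2] cancel, which leaves [th^3]. *)
Lemma test_fun_generator a s t :
  test_fun_t a s t + \sum_(j < n) z s 0 j * test_fun_a j a s t + eps ^+ 2 / 2 * test_fun_ss a s t =
  e t * th ^+ 3 * (q / 2 * (psi s * S a - th * chi s * C a) + g s * chi s * S a).
Proof.
have -> : \sum_(j < n) z s 0 j * test_fun_a j a s t =
    g s * (e t * (th * (th * psi s * C a - S a * (1 - th ^+ 2 * chi s)))).
  by rewrite /g /dotv mulr_suml; apply: eq_bigr => j _; rewrite /test_fun_a; ring.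
rewrite /test_fun_ss /test_fun_t /k /chi2 /psi2; set h := g s; field.
by rewrite gt_eqF.
Qed.

Let dC a j : is_derive a (delta_mx 0 j) C (- S a * (th * xi 0 j)).
Proof.
have D : is_derive a (delta_mx 0 j) (fun y => th * dotv xi y + c) (th * xi 0 j).
  apply: (is_derive_eq (is_derive_add (is_derive_mul (is_derive_cst th a (delta_mx 0 j)) (is_derive_dotv xi a j)) (is_derive_cst c a (delta_mx 0 j)))).
  by rewrite mul0r add0r addr0.
exact: (is_derive_comp_dir (is_derive_cos _) D).
Qed.

Let dS a j : is_derive a (delta_mx 0 j) S (C a * (th * xi 0 j)).
Proof.
have D : is_derive a (delta_mx 0 j) (fun y => th * dotv xi y + c) (th * xi 0 j).
  apply: (is_derive_eq (is_derive_add (is_derive_mul (is_derive_cst th a (delta_mx 0 j)) (is_derive_dotv xi a j)) (is_derive_cst c a (delta_mx 0 j)))).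
  by rewrite mul0r add0r addr0.
exact: (is_derive_comp_dir (is_derive_sin _) D).
Qed.

Lemma is_derive_test_fun_t a s (t : R) : is_derive t (1 : R) (test_fun a s) (test_fun_t a s t).
Proof.
have De : is_derive t (1 : R) e (expR (k * t + 0) * k).
  exact: (is_derive_comp_dir (is_derive_expR _) (is_derive_affine k 0 t)).
apply: (is_derive_eq (is_derive_mul De (is_derive_cst (C a * (1 - th ^+ 2 * chi s) + th * psi s * S a) t (1 : R)))).
by rewrite mulr0 addr0 /test_fun_t; congr (_ * _); exact: mulrC.
Qed.

Lemma is_derive_test_fun_a j (a : V) s t :
  is_derive a (delta_mx 0 j) (fun a => test_fun a s t) (test_fun_a j a s t).
Proof.
have K (x : R) := is_derive_cst x a (delta_mx 0 j).
apply: (is_derive_eq (is_derive_mul (K (e t)) (is_derive_add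
  (is_derive_mul (dC a j) (K (1 - th ^+ 2 * chi s))) (is_derive_mul (K (th * psi s)) (dS a j))))).
by rewrite /test_fun_a /cst; ring.
Qed.

Let lin_s (f0 f1 : R -> R) a (s : R) t (x y d0 d1 : R) :
  is_derive s (1 : R) f0 d0 -> is_derive s (1 : R) f1 d1 ->
  is_derive s (1 : R) (fun s => e t * (C a * (y - th ^+ 2 * f0 s) + th * f1 s * S a))
    (e t * (C a * (- (th ^+ 2 * d0)) + th * d1 * S a)).
Proof.
move=> D0 D1; have K (x : R) := is_derive_cst x s (1 : R).
apply: (is_derive_eq (is_derive_mul (K (e t)) (is_derive_add
  (is_derive_mul (K (C a)) (is_derive_sub (K y) (is_derive_mul (K (th ^+ 2)) D0)))
  (is_derive_mul (is_derive_mul (K th) D1) (K (S a)))))).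
by rewrite /cst; ring.
Qed.

Lemma is_derive_test_fun_s a (s : R) t :
  is_derive s (1 : R) (fun s => test_fun a s t) (test_fun_s a s t).
Proof. exact: lin_s. Qed.

Lemma is_derive_test_fun_ss a (s : R) t :
  is_derive s (1 : R) (fun s => test_fun_s a s t) (test_fun_ss a s t).
Proof.
have := lin_s a t 0 0 (dchi1 s) (dpsi1 s).
by under eq_fun do rewrite sub0r.
Qed.

Let cC : pcont (fun a _ _ => C a).
Proof.
apply: pcont_a; exact: (continuous_comp_phase (@continuous_cos R)).
Qed.

Let cS : pcont (fun a _ _ => S a).
Proof.
apply: pcont_a; exact: (continuous_comp_phase (@continuous_sin R)).
Qed.

Let ce : pcont (fun _ _ t => e t).
Proof.
have H : continuous e.
  move=> t; apply: (cvg_comp (fun t => k * t + 0) expR); last exact: continuous_expR.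
  exact: continuous_affine.
exact: (pcont_t H).
Qed.

Let K x := @pcont_cst R n x.
Let cpsi := is_derive_continuous dpsi.
Let cpsi1 := is_derive_continuous dpsi1.
Let cchi := is_derive_continuous dchi.
Let cchi1 := is_derive_continuous dchi1.

Let lin_cont (h1 h2 : R -> R) : continuous h1 -> continuous h2 ->
  pcont (fun a s t => e t * (C a * (- (th ^+ 2 * h1 s)) + th * h2 s * S a)).
Proof.
move=> c1 c2; exact: (pcontM ce (pcontD (pcontM cC (pcontN (pcontM (@K (th ^+ 2)) (pcont_s c1))))
  (pcontM (pcontM (@K th) (pcont_s c2)) cS))).
Qed.

Let c1chi : pcont (fun _ s _ => 1 - th ^+ 2 * chi s).
Proof.
exact: (pcontD (@K 1) (pcontN (pcontM (@K (th ^+ 2)) (pcont_s cchi)))).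
Qed.

Let cthpsi : pcont (fun _ s _ => th * psi s).
Proof. exact: (pcontM (@K th) (pcont_s cpsi)). Qed.

Lemma pcont_test_fun : pcont test_fun.
Proof. exact: (pcontM ce (pcontD (pcontM cC c1chi) (pcontM cthpsi cS))). Qed.

Lemma pcont_test_fun_t : pcont test_fun_t.
Proof. exact: (pcontM (pcontM (@K k) ce) (pcontD (pcontM cC c1chi) (pcontM cthpsi cS))). Qed.

Lemma pcont_test_fun_a j : pcont (test_fun_a j).
Proof.
exact: (pcontM ce (pcontM (@K (th * xi 0 j)) (pcontD (pcontM cthpsi cC) (pcontN (pcontM cS c1chi))))).
Qed.

Lemma pcont_test_fun_s : pcont test_fun_s.
Proof. exact: lin_cont. Qed.

Lemma pcont_test_fun_ss : pcont test_fun_ss.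
Proof.
apply: lin_cont; last by apply: continuousMf cg; exact: cst_continuous.
apply: (@continuousMf _ (cst _)); first exact: cst_continuous.
apply: continuousDf; last exact: cst_continuous.
exact: continuousMf.
Qed.

Variables (A B G : R).
Hypotheses (psiA : forall s, `|psi s| <= A) (chiB : forall s, `|chi s| <= B)
  (gG : forall s, `|g s| <= G).
Hypotheses (th_gt0 : 0 < th) (th_le1 : th <= 1) (q0 : 0 <= q).

Let A0 : 0 <= A. Proof. exact: le_trans (normr_ge0 _) (psiA 0). Qed.
Let B0 : 0 <= B. Proof. exact: le_trans (normr_ge0 _) (chiB 0). Qed.
Let C1 a : `|C a| <= 1. Proof. exact: normr_cos_le1. Qed.
Let S1 a : `|S a| <= 1. Proof. exact: normr_sin_le1. Qed.

Let e_le t : th ^+ 2 * t <= 2 -> e t <= expR q.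
Proof.
move=> tht; rewrite ler_expR addr0 /k (_ : th ^+ 2 * q / 2 * t = q / 2 * (th ^+ 2 * t)); last by ring.
by rewrite -[leRHS](@divfK _ 2)// ler_wpM2l ?divr_ge0.
Qed.

Lemma test_fun_generator_le a s t : th ^+ 2 * t <= 2 ->
  `|test_fun_t a s t + \sum_(j < n) z s 0 j * test_fun_a j a s t + eps ^+ 2 / 2 * test_fun_ss a s t|
  <= expR q * (q / 2 * (A + B) + G * B) * th ^+ 3.
Proof.
move=> tht; rewrite test_fun_generator normrM [X in X * _]normrM (ger0_norm (expR_ge0 _)).
rewrite (ger0_norm (exprn_ge0 _ (ltW th_gt0))) mulrAC ler_wpM2r ?exprn_ge0 ?(ltW th_gt0)//.
apply: ler_pM => //.
  exact: e_le.
apply: (le_trans (ler_normD _ _)); apply: lerD.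
  rewrite normrM ger0_norm ?divr_ge0// ler_wpM2l ?divr_ge0//.
  apply: (le_trans (ler_normB _ _)); rewrite !normrM (gtr0_norm th_gt0); apply: lerD.
    by rewrite -[leRHS]mulr1 ler_pM.
  rewrite -[leRHS]mulr1; apply: ler_pM => //; first by rewrite mulr_ge0// ltW.
  by rewrite -[leRHS]mul1r ler_pM// ltW.
rewrite !normrM -[leRHS]mulr1; apply: ler_pM => //.
by rewrite ler_pM.
Qed.

Lemma test_fun_approx a s t : th ^+ 2 * t <= 2 ->
  `|test_fun a s t - e t * C a| <= expR q * (A + B) * th.
Proof.
move=> tht; rewrite /test_fun -mulrBr normrM (ger0_norm (expR_ge0 _)) -[leRHS]mulrA.
apply: ler_pM => //.
  exact: e_le.
rewrite (_ : _ - _ = th * (psi s * S a - th * (chi s * C a))); last by ring.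
rewrite normrM (gtr0_norm th_gt0) mulrC ler_wpM2r ?(ltW th_gt0)//.
apply: (le_trans (ler_normB _ _)); rewrite !normrM (gtr0_norm th_gt0); apply: lerD.
  by rewrite -[leRHS]mulr1 ler_pM.
rewrite -[leRHS]mul1r; apply: ler_pM => //; first exact: ltW.
by rewrite -[leRHS]mulr1 ler_pM.
Qed.

End test_function.

Section expectation.
Context {R : realType} (n : nat) (eps l R0 M : R) (z : R -> 'rV[R]_n).
Notation V := 'rV[R]_n.
Notation pcont := (@continuous_at_positive_times R n).
Notation PI := (phase_integral l).
Variable f : V -> R -> R -> R.
Hypothesis eps_gt0 : 0 < eps.
Hypothesis l_gt0 : 0 < l.
Hypothesis M_ge0 : 0 <= M.
Hypothesis z_cont : forall k, continuous (fun s => z s 0 k).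
Hypothesis f_per : forall a s t, 0 < t -> f a (s + l) t = f a s t.
Hypothesis f_reg : regular_at_positive_times f.
Hypothesis f_eq : forall a s t, 0 < t ->
  d_t f a s t + \sum_(k < n) z s 0 k * d_a k f a s t = eps ^+ 2 / 2 * d_s (d_s f) a s t.
Hypothesis f_supp : forall a s t, 0 < t -> R0 + M * t < `|a| -> f a s t = 0.
Hypothesis f_ge0 : forall a s t, 0 < t -> 0 <= f a s t.
Hypothesis f_mass : forall r t, 0 < t -> R0 + M * t < r -> PI r (fun a s => f a s t) = 1.

Let cf : pcont f. Proof. by case: f_reg => _ [c _ _ _ _]; exact: c. Qed.

(** [f] at time [t] is a probability density on the phase box, so that an error
    proportional to [f] integrates to its factor. *)
Lemma phase_expect_le r t (W : V -> R -> R) (m K : R) : 0 < t -> R0 + M * t < r ->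
  jcontinuous W -> (forall a s, `|W a s - m * f a s t| <= K * f a s t) ->
  `|PI r W - m| <= K.
Proof.
move=> t0 tr cW WK; have jf := pcont_jcontinuous cf t0.
have jK x : jcontinuous (fun a s => x * f a s t).
  exact: (pcont_jcontinuous (pcontM (@pcont_cst R n x) cf) t0).
have E x : PI r (fun a s => x * f a s t) = x.
  by rewrite phase_integralZ// f_mass// mulr1.
rewrite ler_norml; apply/andP; split.
- rewrite lerBrDl -[leLHS]E; apply: le_phase_integral => // a s _ _.
  by have := WK a s; rewrite ler_norml mulrBl => /andP[? _]; lra.
- rewrite lerBlDl -[leRHS]E; apply: le_phase_integral => // a s _ _.
  by have := WK a s; rewrite ler_norml mulrDl => /andP[_ ?]; lra.
Qed.

Variables (xi : V) (c q A B G : R) (psi psi1 chi chi1 : R -> R).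
Let g (s : R) := dotv xi (z s).
Hypothesis dpsi : forall s, is_derive s (1 : R) psi (psi1 s).
Hypothesis dpsi1 : forall s, is_derive s (1 : R) psi1 (2 / eps ^+ 2 * g s).
Hypothesis dchi : forall s, is_derive s (1 : R) chi (chi1 s).
Hypothesis dchi1 : forall s, is_derive s (1 : R) chi1 (2 / eps ^+ 2 * (psi s * g s + q / 2)).
Hypothesis psi_per : forall s, psi (s + l) = psi s.
Hypothesis chi_per : forall s, chi (s + l) = chi s.
Hypotheses (psiA : forall s, `|psi s| <= A) (chiB : forall s, `|chi s| <= B)
  (gG : forall s, `|g s| <= G) (q0 : 0 <= q).

Let D := expR q * (q / 2 * (A + B) + G * B).
Let E := expR q * (A + B).
Let H := q / 2 * expR q + (\sum_j `|xi 0 j|) * (R0 + M).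

(** At time 1 the mass sits in a fixed bounded region, on which [th * dotv xi a]
    is small; between the times 1 and [T = th^-2] the expectation of the test
    function moves by at most [D th^3 T]. *)
Lemma expectation_estimate (T : R) (th := (Num.sqrt T)^-1) (r := R0 + M * (T + 1) + 1) : 1 <= T ->
  `|PI r (fun a s => cos (th * dotv xi a + c) * f a s T) - expR (- (q / 2)) * cos c| <=
  (D + 2 * E + H) * th.
Proof.
move=> T1; have T0 : 0 < T by exact: lt_le_trans T1.
have s0 : 0 < Num.sqrt T by rewrite sqrtr_gt0.
have th0 : 0 < th by rewrite invr_gt0.
have thT : th ^+ 2 * T = 1 by rewrite exprVn sqr_sqrtr ?(ltW T0)// mulVf// gt_eqF.
have th1 : th <= 1 by rewrite invf_le1// -sqrtr1 ler_wsqrtr.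
clearbody th.
have th2 : th ^+ 2 <= th by rewrite expr2 ler_piMl// ltW.
have tht t : t < T + 1 -> th ^+ 2 * t <= 2.
  move=> tT; apply: (@le_trans _ _ (th ^+ 2 * (2 * T))); last by rewrite mulrCA thT mulr1.
  by rewrite ler_wpM2l ?exprn_ge0 ?(ltW th0)//; lra.
have tr t : t < T + 1 -> R0 + M * t < r.
  move=> tT; rewrite /r -addrA ltrD2l; apply: (@le_lt_trans _ _ (M * (T + 1))); last by rewrite ltrDl.
  by rewrite ler_wpM2l// ltW.
pose u := test_fun xi c q psi chi th.
pose ut := test_fun_t xi c q psi chi th.
pose uss := test_fun_ss eps z xi c q psi th.
pose ua := test_fun_a xi c q psi chi th.
have cu : pcont u by exact: (pcont_test_fun dpsi dchi).
have cut : pcont ut by exact: (pcont_test_fun_t dpsi dchi).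
have cua k : pcont (ua k) by exact: (pcont_test_fun_a dpsi dchi).
have cus : pcont (test_fun_s xi c q psi1 chi1 th) by exact: (pcont_test_fun_s dpsi1 dchi1).
have cuss : pcont uss by exact: (pcont_test_fun_ss z_cont dpsi).
have did (x : R) : is_derive x (1 : R) (@id R) (1 : R) := is_derive_id x (1 : R).
have d1 (x : R) : is_derive x (1 : R) (cst 1 : R -> R) (0 : R) := is_derive_cst (1 : R) x (1 : R).
have u_per a s t : 0 < t -> u a (s + l) t = u a s t.
  by move=> _; rewrite /u /test_fun psi_per chi_per.
have supp a s t : r < `|a| -> 0 < t < T + 1 -> u a s t * id (f a s t) = 0.
  by move=> ra /andP[t0 tT]; rewrite f_supp ?mulr0//; exact: lt_trans (tr t tT) ra.
pose J t := PI r (fun a s => u a s t * f a s t).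
pose rate := energy_rate eps z f u ut uss ua id (cst 0).
pose J' t := PI r (fun a s => rate a s t).
have dJ t : 0 < t < T + 1 -> is_derive t (1 : R) J (J' t).
  move=> tT; apply: (energy_identity l_gt0 z_cont f_per f_reg f_eq cu cut cus cuss cua _ _ _ _ u_per did d1 _ supp tT).
  - by move=> a s x _; exact: is_derive_test_fun_t.
  - by move=> k a s x _; exact: is_derive_test_fun_a.
  - by move=> a s x _; exact: (is_derive_test_fun_s xi c q dpsi dchi).
  - by move=> a s x _; exact: (is_derive_test_fun_ss c dpsi1 dchi1).
  - exact: cst_continuous.
have crate : pcont rate.
  by apply: (pcont_energy_rate z_cont f_reg cu cut cuss cua did); exact: cst_continuous.
have J'_le t : 0 < t < T + 1 -> `|J' t| <= D * th ^+ 3.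
  move=> /andP[t0 tT]; rewrite -[J' t]subr0.
  apply: (phase_expect_le t0 (tr t tT) (pcont_jcontinuous crate t0)) => a s.
  rewrite /rate /energy_rate /= !(mulr0, mul0r, subr0) normrM.
  rewrite (ger0_norm (f_ge0 a s t0)) ler_wpM2r ?f_ge0//.
  exact: (test_fun_generator_le eps_gt0 _ psiA chiB gG th0 th1 q0 _ _ (tht t tT)).
have key (sg : R) : `|sg| = 1 -> sg * J T - sg * J 1 <= D * th.
  move=> sg1.
  have dL t : 0 < t < T + 1 -> is_derive t (1 : R) (fun t => sg * J t - D * th ^+ 3 * t) (sg * J' t - D * th ^+ 3).
    move=> tT; have K (x : R) := is_derive_cst x t (1 : R).
    apply: (is_derive_eq (is_derive_sub (is_derive_mul (K sg) (dJ t tT)) (is_derive_mul (K (D * th ^+ 3)) (did t)))).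
    by rewrite /cst; ring.
  have L_le t : 0 < t < T + 1 -> sg * J' t - D * th ^+ 3 <= 0.
    move=> tT; rewrite subr_le0; apply: (le_trans (ler_norm _)).
    by rewrite normrM sg1 mul1r J'_le.
  have T1' : T < T + 1 by rewrite ltrDl.
  have := le_of_derive_le0 dL L_le ltr01 T1 T1'.
  have -> : D * th ^+ 3 * T = D * th.
    by rewrite -[RHS]mulr1 -thT (exprS th 2) !mulrA.
  have D30 : 0 <= D * th ^+ 3 * 1.
    rewrite mulr1; apply: le_trans (J'_le 1 _) => //.
    by rewrite ltr01/=; lra.
  by move=> ?; lra.
have JJ : `|J T - J 1| <= D * th.
  rewrite ler_norml; apply/andP; split.
    have := key (-1); rewrite normrN normr1 => /(_ erefl); rewrite !mulN1r => ?; lra.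
  by have := key 1; rewrite normr1 => /(_ erefl); rewrite !mul1r.
pose C (a : V) := cos (th * dotv xi a + c).
have cC : pcont (fun a _ _ => C a).
  by apply: pcont_a; exact: (continuous_comp_phase (@continuous_cos R)).
pose e t := expR (th ^+ 2 * q / 2 * t + 0).
pose I := PI r (fun a s => C a * f a s T).
have TT1 : T < T + 1 by rewrite ltrDl.
have jCf : jcontinuous (fun a s => C a * f a s T).
  exact: (pcont_jcontinuous (pcontM cC cf) T0).
have eT : e T = expR (q / 2).
  have h : th ^+ 2 * q / 2 * T = q / 2 * (th ^+ 2 * T) by ring.
  by rewrite /e addr0 h thT mulr1.
have JT : `|J T - expR (q / 2) * I| <= E * th.
  rewrite -eT -phase_integralZ// -[J T]/(PI r (fun a s => u a s T * f a s T)).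
  have jd : jcontinuous (fun a s => (u a s T - e T * C a) * f a s T).
    exact: (pcont_jcontinuous (pcontM (pcontD cu (pcontN (pcontM (@pcont_cst R n (e T)) cC))) cf) T0).
  have -> : (fun a s => u a s T * f a s T) = (fun a s => (u a s T - e T * C a) * f a s T + e T * (C a * f a s T)).
    by apply/funext => a; apply/funext => s; ring.
  rewrite phase_integralD//; last first.
    exact: (pcont_jcontinuous (pcontM (@pcont_cst R n (e T)) (pcontM cC cf)) T0).
  rewrite addrK -[X in `|X|]subr0.
  apply: (phase_expect_le T0 (tr T TT1) jd) => a s.
  rewrite mul0r subr0 normrM (ger0_norm (f_ge0 a s T0)) ler_wpM2r ?f_ge0//.
  exact: (test_fun_approx _ _ psiA chiB th0 th1 q0 _ _ (tht T TT1)).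
have oneT : 1 < T + 1 by lra.
have J1 : `|J 1 - cos c| <= (E + H) * th.
  apply: (phase_expect_le ltr01 (tr 1 oneT)) => [|a s].
    exact: (pcont_jcontinuous (pcontM cu cf) ltr01).
  have [aR|aR] := ltP (R0 + M * 1) `|a|.
    by rewrite f_supp// !mulr0 subrr normr0.
  rewrite -mulrBl normrM (ger0_norm (f_ge0 a s ltr01)) ler_wpM2r ?f_ge0//.
  have h1 := test_fun_approx xi c psiA chiB th0 th1 q0 a s (tht 1 oneT).
  have h2 : `|C a - cos c| <= (\sum_j `|xi 0 j|) * (R0 + M) * th.
    apply: (le_trans (cos_lipschitz _ _)); rewrite addrK normrM (gtr0_norm th0) mulrC.
    rewrite ler_wpM2r ?(ltW th0)//; apply: (le_trans (dotv_norm_le _ _)).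
    by rewrite ler_wpM2l ?sumr_ge0// -[M]mulr1.
  have h3 : `|(e 1 - 1) * C a| <= q / 2 * expR q * th.
    rewrite normrM -[leRHS]mulr1; apply: ler_pM => //; last exact: normr_cos_le1.
    have k0 : 0 <= th ^+ 2 * q / 2 by rewrite divr_ge0// mulr_ge0// exprn_ge0// ltW.
    rewrite /e mulr1 addr0 ger0_norm; last by rewrite subr_ge0 -[leLHS]expR0 ler_expR.
    apply: (le_trans (expR_sub1_le _)).
    rewrite (_ : q / 2 * expR q * th = (th * q / 2) * expR q); last by ring.
    have k1 : th ^+ 2 * q / 2 <= th * q / 2 by rewrite ler_wpM2r// ler_wpM2r.
    apply: ler_pM => //.
    rewrite ler_expR (le_trans k1)//; apply: (@le_trans _ _ (q / 2)); last by rewrite ler_pdivrMr// ler_peMr// ler1n.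
    by rewrite -mulrA ler_piMl ?divr_ge0.
  have -> : u a s 1 - cos c = (u a s 1 - e 1 * C a) + ((e 1 - 1) * C a + (C a - cos c)) by ring.
  apply: (le_trans (ler_normD _ _)); rewrite [leRHS]mulrDl; apply: lerD; first exact: h1.
  apply: (le_trans (ler_normD _ _)); rewrite [leRHS]mulrDl; apply: lerD; first exact: h3.
  exact: h2.
have fin : `|expR (q / 2) * I - cos c| <= (D + 2 * E + H) * th.
  move: JJ JT J1; rewrite !ler_norml; move: (J T) (J 1) (expR (q / 2) * I) (cos c) => x1 x2 x3 x4.
  rewrite !(mulrDl, mulr_natl) => /andP[? ?] /andP[? ?] /andP[? ?].
  by apply/andP; split; lra.
have -> : I - expR (- (q / 2)) * cos c = expR (- (q / 2)) * (expR (q / 2) * I - cos c).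
  by rewrite mulrBr mulrA -expRD addNr expR0 mul1r.
rewrite normrM (ger0_norm (expR_ge0 _)); apply: le_trans fin.
by rewrite ler_piMl// -[leRHS]expR0 ler_expR oppr_le0 divr_ge0.
Qed.

End expectation.

(** * The normal law, the covariance and the correctors *)

Section gaussian_density.
Context {R : realType} (n : nat) (C : 'M[R]_n).
Notation V := 'rV[R]_n.
Hypothesis Cpos : posdef C.

Let Cunit : C \in unitmx. Proof. by rewrite unitmxE unitfE gt_eqF// posdef_det_gt0. Qed.

Lemma posdef_invmx : posdef (invmx C).
Proof.
have [CT C0] := Cpos; have QT : (invmx C)^T = invmx C by rewrite trmx_inv CT.
split=> // x x0; have -> : qform (invmx C) x x = qform C (x *m invmx C) (x *m invmx C).
  by rewrite /qform trmx_mul QT !mulmxA mulmxKV.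
apply: C0; apply: contra_neq x0 => h.
by rewrite -[x](mulmxKV Cunit) h mul0mx.
Qed.

Let Qpos := posdef_invmx.
Let N := Num.sqrt ((2 * pi) ^+ n / \det (invmx C)).

Let N0 : 0 < N.
Proof.
rewrite sqrtr_gt0 divr_gt0 ?posdef_det_gt0// exprn_gt0// mulr_gt0//; exact: pi_gt0.
Qed.

Lemma normal_densityE a :
  normal_density 0 C a = N^-1 * expR (- (qform (invmx C) a a / 2)).
Proof.
rewrite /normal_density subr0 /N det_inv invrK; congr (_ * expR _).
by rewrite mulNr.
Qed.

Lemma normal_probability_density : probability_density (normal_density 0 C).
Proof.
rewrite (funext normal_densityE); split.
- apply: measurable_funM; first exact: measurable_cst.
  by apply/measurable_EFinP; exact: measurable_expR_qform.
- by move=> a; rewrite mulr_ge0 ?expR_ge0// invr_ge0 ltW.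
- transitivity (\int[lebesgue_rV n]_a (N^-1%:E * (expR (- (qform (invmx C) a a / 2)))%:E))%E.
    by apply: eq_integral => a _; rewrite EFinM.
  rewrite (ge0_integralZl _ measurableT (measurable_expR_qform _)).
  + by rewrite integral_expR_qform// -EFinM mulVf// gt_eqF.
  + by move=> a _; rewrite lee_fin expR_ge0.
  + by rewrite lee_fin invr_ge0 ltW.
Qed.

(** [C^-1] pairs the vector [xi C] with [a] to [dotv xi a]. *)
Lemma normal_density_fourier xi c :
  \int[lebesgue_rV n]_a (cos (dotv xi a + c) * normal_density 0 C a) =
  expR (- (qform C xi xi / 2)) * cos c.
Proof.
have [CT _] := Cpos.
have E a : qform (invmx C) (xi *m C) a = dotv xi a.
  rewrite /qform mulmxK// mxE; apply: eq_bigr => j _.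
  by rewrite mxE.
have EE : qform (invmx C) (xi *m C) (xi *m C) = qform C xi xi.
  by rewrite /qform mulmxK// trmx_mul CT mulmxA.
have := integral_cos_expR_qform (xi *m C) c Qpos; rewrite -/N EE.
rewrite (eq_Rintegral _ (g := fun a => cos (dotv xi a + c) * expR (- (qform (invmx C) a a / 2)))); last first.
  by move=> a _; rewrite E.
move=> I.
rewrite (eq_Rintegral _ (g := fun a => N^-1 * (cos (dotv xi a + c) * expR (- (qform (invmx C) a a / 2))))); last first.
  by move=> a _; rewrite normal_densityE mulrCA.
rewrite RintegralZl//.
  by rewrite I -!mulrA mulKf// gt_eqF.
have := integrable_cos_expR_qform (xi *m C) c Qpos; apply: eq_integrable => // a _.
by rewrite /= E.
Qed.

End gaussian_density.

Section periodic.
Context {R : realType}.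
Notation leb := (@lebesgue_measure R).

Lemma periodic_bounded (g : R -> R) l : 0 < l -> continuous g -> (forall s, g (s + l) = g s) ->
  exists A, forall s, `|g s| <= A.
Proof.
move=> l0 cg gl.
have [|A _ gA] := @compact_continuous_bounded R _ g _ (@segment_compact R 0 l).
  by move=> x _; exact: cg.
exists A => s; have [s' [/andP[s0 sl] E]] := period_reduce s l0.
by rewrite (E g gl); apply: gA; rewrite /= in_itv /= s0 ltW.
Qed.

(** An antiderivative of a nonnegative periodic function of mean zero is both
    monotone and periodic, hence constant. *)
Lemma periodic_ge0_mean0 (h : R -> R) l : 0 < l -> continuous h ->
  (forall s, h (s + l) = h s) -> (forall s, 0 <= h s) ->
  \int[leb]_(s in `[0, l]) h s = 0 -> forall s, h s = 0.
Proof.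
move=> l0 ch hl h0 int0 s.
have [F [F1 [_ dF1 _ F1l]]] := periodic_double_antiderivative l0 ch hl int0.
have cF := is_derive_continuous dF1.
have mono x y : x <= y -> F1 x <= F1 y.
  rewrite le_eqVlt => /orP[/eqP -> //|xy].
  have [c _ E] := MVT xy (fun x _ => dF1 x) (continuous_subspaceT cF).
  by rewrite -subr_ge0 E mulr_ge0// subr_ge0 ltW.
apply: (derive_locally_cst (c := F1 s) (dF1 s)).
have : \forall y \near s, `|s - y| < l.
  have := @nbhsx_ballx _ R s _ l0; apply: filterS => y.
  by rewrite -ball_normE.
apply: filterS => y; rewrite ltr_norml => /andP[h1 h2].
apply/eqP; rewrite eq_le; apply/andP; split.
  by rewrite -(F1l s); apply: mono; lra.
by rewrite -(F1l y); apply: mono; lra.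
Qed.

Lemma Rintegral_sum_continuous (I : Type) (r : seq I) (h : I -> R -> R) (a b : R) :
  (forall i, continuous (h i)) ->
  \int[leb]_(s in `[a, b]) (\sum_(i <- r) h i s) = \sum_(i <- r) \int[leb]_(s in `[a, b]) h i s.
Proof.
move=> ch; elim: r => [|i r IH].
  rewrite big_nil (eq_Rintegral _ (g := cst 0)) => [|s _]; last by rewrite big_nil.
  by rewrite /Rintegral integral0.
rewrite big_cons -IH -RintegralD//.
- by apply: eq_Rintegral => s _; rewrite big_cons.
- exact: continuous_integrable_itv.
- apply: continuous_integrable_itv => s; apply: (@continuous_sumf R R _ _ h) => j; exact: ch.
Qed.

End periodic.

Section corrector.
Context {R : realType} (n : nat) (eps l : R) (gamma phi : R -> 'rV[R]_n).
Notation V := 'rV[R]_n.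
Notation leb := (@lebesgue_measure R).
Hypothesis eps_gt0 : 0 < eps.
Hypothesis l_gt0 : 0 < l.
Hypothesis phi_analytic : rV_analytic phi.
Hypothesis phi_periodic : forall s, phi (s + l) = phi s.
Hypothesis phi_eq : forall s, derive1n 2 phi s = gamma s.

Let p (xi : V) s := dotv xi (phi s).
Let p1 (xi : V) s := dotv xi (derive1 phi s).
Let g (xi : V) s := dotv xi (gamma s).
Let Sig := Sigma_mx l phi.

Let da1 := rV_analytic_derive phi_analytic.
Let da2 := rV_analytic_derive da1.2.

Let dotv_derive (xi : V) (h : R -> V) (h1 : V) (s : R) :
  (forall k, is_derive s (1 : R) (fun s => h s 0 k) (h1 0 k)) ->
  is_derive s (1 : R) (fun s => dotv xi (h s)) (dotv xi h1).
Proof.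
move=> dh; apply: (is_derive_eq (is_derive_sumf (fun j =>
  is_derive_mul (is_derive_cst (xi 0 j) s (1 : R)) (dh j)))).
by apply: eq_bigr => j _; rewrite mul0r add0r.
Qed.

Let dp xi (s : R) : is_derive s (1 : R) (p xi) (p1 xi s).
Proof. by apply: dotv_derive => k; exact: da1.1. Qed.

Let dp1 xi (s : R) : is_derive s (1 : R) (p1 xi) (g xi s).
Proof. by apply: dotv_derive => k; rewrite -phi_eq; exact: da2.1. Qed.

Lemma gamma_continuous k : continuous (fun s => gamma s 0 k).
Proof.
have := rV_analytic_continuous (k := k) da2.2.
by rewrite (_ : (fun s => gamma s 0 k) = (fun s => derive1 (derive1 phi) s 0 k)) //; apply/funext => s; rewrite -phi_eq.
Qed.

Let cg xi : continuous (g xi).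
Proof.
move=> s; apply: (@continuous_sumf R R _ _ (fun j s => xi 0 j * gamma s 0 j)) => j.
by apply: (@continuousM _ _ (cst (xi 0 j)) (fun s => gamma s 0 j)); [exact: cst_continuous|exact: gamma_continuous].
Qed.

Let cp xi := is_derive_continuous (dp xi).
Let cp1 xi := is_derive_continuous (dp1 xi).

Let p_per xi s : p xi (s + l) = p xi s. Proof. by rewrite /p phi_periodic. Qed.
Let p1_per xi : forall s, p1 xi (s + l) = p1 xi s. Proof. exact: (is_derive_periodic (p_per xi) (dp xi)). Qed.
Let g_per xi : forall s, g xi (s + l) = g xi s. Proof. exact: (is_derive_periodic (p1_per xi) (dp1 xi)). Qed.

Lemma qform_Sigma (xi : V) : qform Sig xi xi = l^-1 * \int[leb]_(s in `[0, l]) (p1 xi s * p1 xi s).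
Proof.
have cphi1 k : continuous (fun s => derive1 phi s 0 k) by exact: rV_analytic_continuous da1.2.
have cc k j : continuous (fun s => derive1 phi s 0 k * derive1 phi s 0 j) by exact: continuousMf.
have ck (x : R) : continuous (cst x : R -> R) by exact: cst_continuous.
rewrite qformE.
have -> : (fun s => p1 xi s * p1 xi s) = (fun s => \sum_i \sum_j xi 0 i * xi 0 j * (derive1 phi s 0 i * derive1 phi s 0 j)).
  apply/funext => s; rewrite /p1 /dotv mulr_suml; apply: eq_bigr => i _.
  by rewrite mulr_sumr; apply: eq_bigr => j _; ring.
rewrite (Rintegral_sum_continuous _ _ _ (h := fun i s => \sum_j xi 0 i * xi 0 j * (derive1 phi s 0 i * derive1 phi s 0 j))); last first.
  move=> i s; apply: (@continuous_sumf R R _ _ (fun j s => xi 0 i * xi 0 j * (derive1 phi s 0 i * derive1 phi s 0 j))) => j.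
  exact: (continuousMf (ck _) (cc i j)).
rewrite mulr_sumr; apply: eq_bigr => i _.
rewrite (Rintegral_sum_continuous _ _ _ (h := fun j s => xi 0 i * xi 0 j * (derive1 phi s 0 i * derive1 phi s 0 j))); last first.
  by move=> j; exact: (continuousMf (ck _) (cc i j)).
rewrite mulr_sumr; apply: eq_bigr => j _; rewrite RintegralZl//; last first.
  by apply: continuous_integrable_itv; exact: cc.
by rewrite mxE; ring.
Qed.

(** If [Sigma] degenerates in the direction [xi], then [xi] is orthogonal to [phi'],
    hence to its derivative [gamma], hence to all differences of points of the curve. *)
Lemma posdef_Sigma : spans_rV [set v | exists z1 z2 : V,
    [/\ range gamma z1, range gamma z2 & v = z1 - z2]] -> posdef Sig.
Proof.
move=> span; split.
  apply/matrixP => i j; rewrite !mxE; congr (_ * _).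
  by apply: eq_Rintegral => s _; rewrite mulrC.
move=> xi xi0; rewrite qform_Sigma.
have cc : continuous (fun s => p1 xi s * p1 xi s) by exact: continuousMf.
have pp s : 0 <= p1 xi s * p1 xi s by rewrite -expr2 sqr_ge0.
rewrite lt_neqAle mulr_ge0 ?invr_ge0 ?(ltW l_gt0) ?Rintegral_ge0// andbT eq_sym.
apply: mulf_neq0; first by rewrite invr_eq0 gt_eqF.
apply: contra_neq xi0 => int0.
have pper s : p1 xi (s + l) * p1 xi (s + l) = p1 xi s * p1 xi s by rewrite p1_per.
have sq0 := periodic_ge0_mean0 l_gt0 cc pper pp int0.
have p10 s : p1 xi s = 0.
  by apply/eqP; rewrite -[_ == 0]orbb -mulf_eq0 sq0.
have g0 s : g xi s = 0.
  have N : \forall y \near s, p1 xi y = 0 by exists 1 => //= y _; exact: p10.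
  exact: (derive_locally_cst (dp1 xi s) N).
have [k [c [w [wA Exi]]]] := span xi.
have w0 i : dotv xi (w i) = 0.
  have [z1 [z2 [[s1 _ <-] [s2 _ <-] ->]]] := wA i.
  by rewrite dotvC dotvBl !(dotvC _ xi) [dotv xi (gamma s1)]g0 [dotv xi (gamma s2)]g0 subrr.
have : dotv xi xi = 0.
  rewrite (_ : dotv xi xi = \sum_i c i * dotv xi (w i)).
    by rewrite big1// => i _; rewrite w0 mulr0.
  rewrite {2}Exi /dotv.
  under [RHS]eq_bigr do rewrite mulr_sumr.
  rewrite exchange_big; apply: eq_bigr => j _; rewrite summxE mulr_sumr.
  by apply: eq_bigr => i _; rewrite mxE; ring.
move=> xx0; apply/eqP; rewrite -normr_eq0 -[_ == 0]orbb -mulf_eq0 -expr2 eq_le exprn_ge0// andbT.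
by rewrite -xx0 norm_le_dotv.
Qed.

(** Integration by parts gives [psi g] the mean [- q/2], which is the solvability
    condition for [chi]: this is where the limit covariance comes from. *)
Lemma corrector_exists (xi : V) (q := qform ((4 / eps ^+ 2) *: Sig) xi xi) :
  exists psi psi1 chi chi1 : R -> R,
  [/\ [/\ forall s, is_derive s (1 : R) psi (psi1 s),
      forall s, is_derive s (1 : R) psi1 (2 / eps ^+ 2 * dotv xi (gamma s)),
      forall s, is_derive s (1 : R) chi (chi1 s) &
      forall s, is_derive s (1 : R) chi1 (2 / eps ^+ 2 * (psi s * dotv xi (gamma s) + q / 2))],
      forall s, psi (s + l) = psi s & forall s, chi (s + l) = chi s].
Proof.
pose k := 2 / eps ^+ 2.
pose psi s := k * p xi s; pose psi1 s := k * p1 xi s.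
have qE : q / 2 * l = k * \int[leb]_(s in `[0, l]) (p1 xi s * p1 xi s).
  have -> : q = 4 / eps ^+ 2 * qform Sig xi xi by rewrite /q /qform -scalemxAr -scalemxAl mxE.
  rewrite qform_Sigma /k; set J := \int[leb]_(s in _) _; field.
  by rewrite !gt_eqF.
have dk (h h1 : R -> R) (s : R) : is_derive s (1 : R) h (h1 s) -> is_derive s (1 : R) (fun s => k * h s) (k * h1 s).
  move=> D; apply: (is_derive_eq (is_derive_mul (is_derive_cst k s (1 : R)) D)).
  by rewrite mul0r add0r.
have ck (x : R) : continuous (cst x : R -> R) by exact: cst_continuous.
pose h s := k * (psi s * g xi s + q / 2).
have cpsig : continuous (fun s => psi s * g xi s) by exact: (continuousMf (continuousMf (ck k) (cp (xi := xi))) (cg (xi := xi))).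
have ch : continuous h by exact: (continuousMf (ck k) (continuousDf cpsig (ck (q / 2)))).
have hl s : h (s + l) = h s by rewrite /h /psi p_per g_per.
have cpp : continuous (fun s => k * (p1 xi s * p1 xi s)) by exact: (continuousMf (ck k) (continuousMf (cp1 (xi := xi)) (cp1 (xi := xi)))).
have I1 : \int[leb]_(s in `[0, l]) (psi s * g xi s) = - (k * \int[leb]_(s in `[0, l]) (p1 xi s * p1 xi s)).
  apply/eqP; rewrite -addr_eq0; apply/eqP.
  rewrite -RintegralZl//; last by apply: continuous_integrable_itv; exact: continuousMf.
  rewrite -RintegralD//; last 2 first.
  - exact: continuous_integrable_itv.
  - exact: continuous_integrable_itv.
  have D s : is_derive s (1 : R) (fun s => psi s * p1 xi s) (psi s * g xi s + k * (p1 xi s * p1 xi s)).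
    apply: (is_derive_eq (is_derive_mul (dk _ _ s (dp xi s)) (dp1 xi s))).
    by rewrite addrC mulrA.
  rewrite (Rintegral_derive l_gt0 (continuousDf cpsig cpp) D).
  by rewrite /psi -[l]add0r p_per p1_per subrr.
have Iq : \int[leb]_(s in `[0, l]) (q / 2) = q / 2 * l.
  rewrite (@Rintegral_derive R (fun s => q / 2 * s + 0) (cst (q / 2)) 0 l l_gt0 (ck _) (is_derive_affine (q / 2) 0)).
  by rewrite mulr0 !addr0 subr0.
have h0 : \int[leb]_(s in `[0, l]) h s = 0.
  rewrite RintegralZl//; last first.
    by apply: continuous_integrable_itv; exact: (continuousDf cpsig (ck (q / 2))).
  rewrite RintegralD//; last 2 first.
  - exact: continuous_integrable_itv.
  - by apply: continuous_integrable_itv; exact: ck.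
  by rewrite I1 Iq qE addNr mulr0.
have [chi [chi1 [d1 d2 per1 per2]]] := periodic_double_antiderivative l_gt0 ch hl h0.
exists psi, psi1, chi, chi1; split => //.
- by split => // s; [exact: (dk _ _ s (dp xi s))|exact: (dk _ _ s (dp1 xi s))].
- by move=> s; rewrite /psi p_per.
Qed.

End corrector.

(** * The rescaled position *)

Section rescaled.
Context {R : realType} (n : nat) (l R0 M : R).
Notation V := 'rV[R]_n.
Notation lam := (@lebesgue_rV R n).
Notation leb := (@lebesgue_measure R).
Notation pcont := (@continuous_at_positive_times R n).
Notation PI := (phase_integral l).
Variable f : V -> R -> R -> R.
Hypothesis cf : pcont f.
Hypothesis f_supp : forall a s t, 0 < t -> R0 + M * t < `|a| -> f a s t = 0.
Hypothesis f_ge0 : forall a s t, 0 < t -> 0 <= f a s t.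
Hypothesis f_mass : forall r t, 0 < t -> R0 + M * t < r -> PI r (fun a s => f a s t) = 1.

Definition marginal (t : R) (a : V) : R := \int[leb]_(s in `[0, l]) f a s t.

Lemma marginal_ge0 t a : 0 < t -> 0 <= marginal t a.
Proof. by move=> t0; apply: Rintegral_ge0 => s _; exact: f_ge0. Qed.

Lemma measurable_marginal t : 0 < t -> measurable_fun setT (marginal t).
Proof.
move=> t0; have jf := pcont_jcontinuous cf t0.
have mI : measurable (`[0, l]%classic : set (measurableTypeR R)) by exact: measurable_itv.
pose h (p : V * measurableTypeR R) : \bar R := (f p.1 p.2 t * \1_(`[0, l]%classic : set (measurableTypeR R)) p.2)%:E.
have mh : measurable_fun setT h.
  apply/measurable_EFinP; apply: measurable_funM; first exact: (jcontinuous_measurable jf).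
  exact: (measurableT_comp (measurable_indic mI) measurable_snd).
have h0 p : (0 <= h p)%E by rewrite lee_fin mulr_ge0// f_ge0.
have E : marginal t = (fun a => fine (\int[leb]_s h (a, s))%E).
  apply/funext => a; rewrite /marginal /Rintegral integral_mkcond epatch_indic.
  by congr fine; apply: eq_integral => s _; rewrite /h EFinM.
rewrite E; exact: (measurableT_comp (@fine_measurable R setT measurableT) (measurable_fun_fubini_tonelli_F (m2 := leb) _ mh h0)).
Qed.

Lemma integral_marginal (w : V -> R) t r : 0 < t -> R0 + M * t < r -> continuous w ->
  \int[lam]_a (w a * marginal t a) = PI r (fun a s => w a * f a s t).
Proof.
move=> t0 tr cw.
have jwf := pcont_jcontinuous (pcontM (pcont_a cw) cf) t0.
rewrite phase_integral_as//.
rewrite [RHS](eq_Rintegral _ (g := fun a => w a * marginal t a)); last first.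
  move=> a _; rewrite /marginal -RintegralZl//; apply: continuous_integrable_itv.
  exact: (jcontinuous_fix_a (pcont_jcontinuous cf t0)).
rewrite integral_compact_support// => a ra.
rewrite (_ : marginal t a = 0) ?mulr0// /marginal.
rewrite (eq_Rintegral _ (g := cst 0)) => [|s _]; last by rewrite f_supp//; exact: lt_trans ra.
by rewrite /Rintegral integral0.
Qed.

Lemma marginal_density t : 0 < t -> probability_density (marginal t).
Proof.
move=> t0; split; [exact: measurable_marginal|by move=> a; exact: marginal_ge0|].
have tr : R0 + M * t < R0 + M * t + 1 by rewrite ltrDl.
have c1 : continuous (fun _ : V => 1 : R) by exact: cst_continuous.
have := integral_marginal t0 tr c1.
have -> : (fun a s => 1 * f a s t) = (fun a s => f a s t).
  by apply/funext => a; apply/funext => s; rewrite mul1r.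
rewrite f_mass// (eq_Rintegral _ (g := marginal t)) => [|a _]; last by rewrite mul1r.
rewrite /Rintegral; case: integral => [x /= ->//| |] /= /eqP.
  by rewrite eq_sym oner_eq0.
by rewrite eq_sym oner_eq0.
Qed.

Lemma rescaled_marginal t a : 0 < t ->
  rescaled_position_density l f t a = Num.sqrt t ^+ n * marginal t (Num.sqrt t *: a).
Proof.
move=> t0; rewrite /rescaled_position_density; congr (_ * _).
by rewrite mulrC powRrM powR12_sqrt ?(ltW t0)// powR_mulrn// sqrtr_ge0.
Qed.

Lemma integral_rescaled (u : V -> R) B t : 0 < t -> continuous u -> (forall a, `|u a| <= B) ->
  (\int[lam]_a (u a * rescaled_position_density l f t a)%:E =
   \int[lam]_b (u ((Num.sqrt t)^-1 *: b) * marginal t b)%:E)%E.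
Proof.
move=> t0 cu uB; have s0 : 0 < Num.sqrt t by rewrite sqrtr_gt0.
have dm := marginal_density t0.
have cus : continuous (fun b : V => u ((Num.sqrt t)^-1 *: b)).
  suff H (b : V) : {for b, continuous (fun b : V => u ((Num.sqrt t)^-1 *: b))} by move=> b; exact: H.
  apply: (@continuous_comp _ _ _ (fun b : V => (Num.sqrt t)^-1 *: b) u); last exact: cu.
  exact: (@scaler_continuous _ _ (Num.sqrt t)^-1 b).
have ig := density_integrable dm (continuous_measurable_rV cus) (fun b => uB _).
pose g b : R := Num.sqrt t ^+ n * (u ((Num.sqrt t)^-1 *: b) * marginal t b).
have ig' : lam.-integrable setT (EFin \o g) by exact: integrable_mulr ig.
have -> : (fun a => (u a * rescaled_position_density l f t a)%:E) = (fun a => (EFin \o g) (Num.sqrt t *: a)).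
  apply/funext => a; rewrite /g /= rescaled_marginal// scalerA mulVf ?gt_eqF// scale1r.
  by rewrite mulrCA.
rewrite (integral_rV_scale s0 ig').
rewrite (_ : EFin \o g = fun b => ((Num.sqrt t ^+ n)%:E * (u ((Num.sqrt t)^-1 *: b) * marginal t b)%:E)%E); last first.
  by apply/funext => b; rewrite /g /= EFinM.
rewrite integralZl// muleA -EFinM mulVf ?mul1e//.
by rewrite expf_neq0// gt_eqF.
Qed.

Lemma rescaled_density t : 0 < t -> probability_density (rescaled_position_density l f t).
Proof.
move=> t0; have s0 : 0 < Num.sqrt t by rewrite sqrtr_gt0.
split.
- rewrite (funext (fun a => rescaled_marginal a t0)).
  apply: measurable_funM; first exact: measurable_cst.
  apply: (measurableT_comp (measurable_marginal t0)).
  apply/measurable_fun_rVP => i; under eq_fun do rewrite mxE.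
  by apply: measurable_funM; [exact: measurable_cst|exact: measurable_rV_coord].
- move=> a; rewrite rescaled_marginal// mulr_ge0 ?exprn_ge0 ?(ltW s0)//.
  exact: marginal_ge0.
- have c1 : continuous (fun _ : V => 1 : R) by exact: cst_continuous.
  have B1 (a : V) : `|1 : R| <= 1 by rewrite normr1.
  have := integral_rescaled t0 c1 B1.
  under eq_integral do rewrite mul1r.
  under [X in _ = X -> _]eq_integral do rewrite mul1r.
  by move=> ->; have [_ _] := marginal_density t0.
Qed.

(** Rescaling the position by the square root of [t] rescales the frequency. *)
Lemma rescaled_fourier xi c t r : 0 < t -> R0 + M * t < r ->
  \int[lam]_a (cos (dotv xi a + c) * rescaled_position_density l f t a) =
  PI r (fun a s => cos ((Num.sqrt t)^-1 * dotv xi a + c) * f a s t).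
Proof.
move=> t0 tr.
have cc : continuous (fun a : V => cos (dotv xi a + c)).
  have := continuous_comp_phase (th := 1) (c := c) (xi := xi) (@continuous_cos R).
  by under eq_fun do rewrite mul1r.
have cB (a : V) : `|cos (dotv xi a + c)| <= 1 by exact: normr_cos_le1.
rewrite /Rintegral (integral_rescaled t0 cc cB).
have cc' : continuous (fun a : V => cos ((Num.sqrt t)^-1 * dotv xi a + c)).
  exact: (continuous_comp_phase (@continuous_cos R)).
rewrite -(integral_marginal t0 tr cc') /Rintegral; congr fine.
by apply: eq_integral => b _; rewrite (dotvC xi) dotvZl (dotvC b).
Qed.

End rescaled.

(** * Convergence in distribution *)

Section quadratic_form.
Context {R : realType} (n : nat).

Lemma posdef_scale (C : 'M[R]_n) (k : R) : 0 < k -> posdef C -> posdef (k *: C).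
Proof.
move=> k0 [CT C0]; split=> [|x x0]; first by rewrite linearZ /= CT.
by rewrite /qform -scalemxAr -scalemxAl mxE mulr_gt0// C0.
Qed.

Lemma posdef_ge0 (C : 'M[R]_n) x : posdef C -> 0 <= qform C x x.
Proof.
move=> [_ C0]; have [->|/C0/ltW//] := eqVneq x 0.
by rewrite /qform !mul0mx mxE.
Qed.

End quadratic_form.

Lemma sqrtV_cvg_pinfty (R : realType) (T : R^nat) (K : R) :
  T k @[k --> \oo] --> +oo -> K * (Num.sqrt (T k))^-1 @[k --> \oo] --> (0 : R).
Proof.
move=> Too; rewrite -[X in _ --> X](mulr0 K); apply: cvgM; first exact: cvg_cst.
apply/cvgrPdist_le => e e0; near=> k.
have hk : e ^- 2 <= T k by near: k; move/cvgryPge : Too; exact.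
have ei : 0 < e ^- 2 by rewrite invr_gt0 exprn_gt0.
have s0 : 0 < Num.sqrt (T k) by rewrite sqrtr_gt0; exact: lt_le_trans hk.
rewrite sub0r normrN gtr0_norm ?invr_gt0// -[leRHS]invrK lef_pV2 ?posrE ?invr_gt0//.
rewrite -(ler_pXn2r (n := 2)) ?nnegrE ?(ltW s0) ?invr_ge0 ?(ltW e0)//.
by rewrite exprVn sqr_sqrtr// ltW// (lt_le_trans ei).
Unshelve. all: by end_near. Qed.

Unset Implicit Arguments.

Theorem proposition3p1 (R : realType) (n : nat) (eps l : R)
    (gamma phi : R -> 'rV[R]_n)
    (f0 : 'rV[R]_n -> R -> R) (f : 'rV[R]_n -> R -> R -> R)
    (eps_gt0 : 0 < eps)
    (gamma_analytic : rV_analytic gamma)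
    (gamma_period : minimal_period gamma l)
    (gamma_spans : spans_rV
       [set v | exists z1 z2 : 'rV[R]_n,
          [/\ range gamma z1, range gamma z2 & v = z1 - z2]])
    (gamma_mean0 : forall k : 'I_n,
       \int[lebesgue_measure]_(s in `[0, l]) gamma s 0 k = 0)
    (phi_analytic : rV_analytic phi)
    (phi_periodic : forall s, phi (s + l) = phi s)
    (phi_eq : forall s, derive1n 2 phi s = gamma s)
    (f0_density : initial_density l f0)
    (f_solution : fokker_planck_solution eps l gamma f0 f) :
  densities_cvg_in_distribution (rescaled_position_density l f)
    (normal_density 0 ((4 / eps ^+ 2) *: Sigma_mx l phi)).
Proof.
have [l0 gl _] := gamma_period.
have [_ mf0 f0_ge0 [K cK f0K] f0_mass] := f0_density.
have [f_per f_reg f_eq _] := f_solution.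
have z_cont := gamma_continuous phi_analytic phi_eq.
have cf : continuous_at_positive_times f by case: f_reg => _ [c _ _ _ _]; exact: c.
(* [M] bounds the speed in position, [R0] the initial support. *)
have [M0 M0P] : exists A, forall s, `|\sum_(k < n) `|gamma s 0 k| | <= A.
  apply: (@periodic_bounded R (fun s => \sum_(k < n) `|gamma s 0 k|) l l0) => [s|s]; last by rewrite gl.
  apply: (@continuous_sumf R R _ _ (fun k s => `|gamma s 0 k|)) => k.
  by apply: cvg_norm; exact: z_cont.
pose M := Num.max M0 1.
have M_gt0 : 0 < M by rewrite lt_max ltr01 orbT.
have zM s : \sum_(k < n) `|gamma s 0 k| <= M.
  by apply: (le_trans (ler_norm _)); rewrite le_max M0P.
have [R0 f0_supp] : exists R0 : R, forall a s, R0 < `|a| -> f0 a s = 0.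
  have [N [_ NP]] := compact_bounded cK; exists (N + 1).
  move=> a s Na; apply: f0K => /(NP (N + 1) _) aN.
  by have := lt_le_trans Na (aN ltac:(by rewrite ltrDl)); rewrite ltxx.
have f_supp := solution_support l0 z_cont M_gt0 zM f_solution mf0 f0_supp.
have f_ge0 := solution_ge0 l0 z_cont M_gt0 zM f_solution mf0 f0_supp f0_ge0 f0_mass.
have f_mass := solution_mass l0 z_cont M_gt0 zM f_solution mf0 f0_supp f0_ge0 f0_mass.
set C := (4 / eps ^+ 2) *: Sigma_mx l phi.
have Cpos : posdef C.
  apply: posdef_scale; first by rewrite divr_gt0// exprn_gt0.
  exact: (posdef_Sigma l0 phi_analytic phi_periodic phi_eq gamma_spans).
have dp t : 0 < t -> probability_density (rescaled_position_density l f t).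
  by move=> t0; exact: (rescaled_density cf f_supp f_ge0 f_mass t0).
have dq := normal_probability_density Cpos.
split=> [t t0| |u cu [B uB]]; [exact: dp|exact: dq|].
have mu := continuous_measurable_rV cu.
have main : \int[lebesgue_rV n]_a (u a * rescaled_position_density l f t a) @[t --> +oo] -->
    \int[lebesgue_rV n]_a (u a * normal_density 0 C a).
  apply/cvg_pinftyP => y yoo.
  (* Times before 1 are moved to 1, which changes finitely many terms. *)
  pose T k := Num.max (y k) 1.
  have T1 k : 1 <= T k by rewrite le_max lexx orbT.
  have T0 k : 0 < T k by exact: lt_le_trans (T1 k).
  have Too : T k @[k --> \oo] --> +oo.
    apply/cvgryPge => A; move/cvgryPge : yoo => /(_ A); apply: filterS => k.
    by rewrite le_max => ->.
  have near_T : \forall k \near \oo, T k = y k.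
    move/cvgryPge : yoo => /(_ 1); apply: filterS => k yk.
    by rewrite /T; apply/max_idPl.
  have fourier xi c : \int[lebesgue_rV n]_a (cos (dotv xi a + c) * rescaled_position_density l f (T k) a)
      @[k --> \oo] --> \int[lebesgue_rV n]_a (cos (dotv xi a + c) * normal_density 0 C a).
    rewrite normal_density_fourier//.
    have [psi [psi1 [chi [chi1 [[d1 d2 d3 d4] psi_per chi_per]]]]] :=
      corrector_exists eps_gt0 l0 phi_analytic phi_periodic phi_eq xi.
    have [A psiA] := periodic_bounded l0 (is_derive_continuous d1) psi_per.
    have [B' chiB] := periodic_bounded l0 (is_derive_continuous d3) chi_per.
    have [G gG] : exists G, forall s, `|dotv xi (gamma s)| <= G.
      apply: (@periodic_bounded R (fun s => dotv xi (gamma s)) l l0) => [s|s]; last by rewrite gl.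
      apply: (@continuous_sumf R R _ _ (fun j s => xi 0 j * gamma s 0 j)) => j.
      by apply: (@continuousM _ _ (cst (xi 0 j)) (fun s => gamma s 0 j)); [exact: cst_continuous|exact: z_cont].
    have [K0 est] : exists K0, forall k,
        `|phase_integral l (R0 + M * (T k + 1) + 1)
            (fun a s => cos ((Num.sqrt (T k))^-1 * dotv xi a + c) * f a s (T k)) -
          expR (- (qform C xi xi / 2)) * cos c| <= K0 * (Num.sqrt (T k))^-1.
      eexists => k; exact: (expectation_estimate eps_gt0 l0 (ltW M_gt0) z_cont f_per f_reg f_eq
        f_supp f_ge0 f_mass c d1 d2 d3 d4 psi_per chi_per psiA chiB gG (posdef_ge0 xi Cpos) (T1 k)).
    apply/subr_cvg0; apply: norm_cvg0.
    apply: (@squeeze_cvgr _ _ _ _ (cst 0) (fun k => K0 * (Num.sqrt (T k))^-1)).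
    - apply: nearW => k; rewrite normr_ge0 /=.
      rewrite (rescaled_fourier cf f_supp f_ge0 f_mass xi c (T0 k) (r := R0 + M * (T k + 1) + 1)); first exact: est.
      by rewrite -addrA ltrD2l mulrDr -addrA ltrDl ltr_pwDr// mulr1 ltW.
    - exact: cvg_cst.
    - exact: sqrtV_cvg_pinfty.
  have := levy_continuity (fun k => dp _ (T0 k)) dq fourier cu uB.
  apply: cvg_trans; apply: near_eq_cvg; apply: filterS near_T => k -> //.
have iq := density_integrable dq mu uB.
rewrite -(EFin_Rintegral measurableT iq).
have near_E : \forall t \near +oo,
    (\int[lebesgue_rV n]_a (u a * rescaled_position_density l f t a))%:E =
    (\int[lebesgue_rV n]_a (u a * rescaled_position_density l f t a)%:E)%E.
  have : \forall t \near +oo, 0 < (t : R) by exact: nbhs_pinfty_gt.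
  apply: filterS => t t0.
  by rewrite (EFin_Rintegral measurableT (density_integrable (dp t t0) mu uB)).
apply: (cvg_trans (near_eq_cvg near_E)).
by apply: (cvg_comp _ EFin main).
Qed.
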